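(* There is a constant $C\ge 1$ such that, for any edge-probability $p=p(n)\in[0,1]$, with high probability the random graph $G_{n,p}$ satisfies $$\frac{\chi_c(G_{n,p})}{\max\left\{1,\ \dfrac{e^{-np^2}np}{\log n},\ \min\left\{\dfrac{p^{3/2}n}{\sqrt{\log n}},\ \dfrac1p\right\}\right\}}\ \in\ \Big[(C\log n)^{-1},\ C\log n\Big].$$
   Context: $G_{n,p}$ denotes the binomial random graph on vertex set $[n]$ in which each pair of vertices is an edge independently with probability $p$. The clique chromatic number $\chi_c(G)$ of a graph $G$ is the smallest number of colors in a vertex coloring of $G$ such that no inclusion-maximal clique of $G$ is monochromatic, where maximal cliques consisting of a single isolated vertex are ignored. ''With high probability'' means with probability tending to $1$ as $n\to\infty$. $\log$ is the natural logarithm; $1/p:=\infty$ when $p=0$. *)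

(* Defs.v *)
(* MathComp world (with MathComp-Analysis for real functions and limits). *)
From mathcomp Require Import all_boot all_order all_algebra.
From mathcomp Require Import all_classical all_reals all_analysis.
Set Implicit Arguments.
Unset Strict Implicit.
Unset Printing Implicit Defensive.
Import Order.TTheory GRing.Theory Num.Theory numFieldNormedType.Exports.
Local Open Scope set_scope.

Notation vpair T := {e : {set T} | #|e| == 2%N}.

(* A finite simple graph on the vertex set T, given by its set of edges; every
   set of vertex pairs is a graph. *)
Notation graph T := {set vpair T}.

Section CliqueColoring.
Variables (T : finType) (G : graph T).

Definition adj (x y : T) : bool :=
  [exists e in G, val e == [set x; y] :> {set T}].

Definition clique (K : {set T}) : bool :=
  [forall x in K, forall y in K, (x != y) ==> adj x y].

Definition maximal_clique (K : {set T}) : bool := maxset clique K.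

Definition monochromatic k (f : {ffun T -> 'I_k}) (K : {set T}) : bool :=
  [exists c, forall x in K, f x == c].

(* The condition 1 < #|K| discards the maximal cliques that consist of a single
   isolated vertex (and the empty clique of the graph without vertices). *)
Definition clique_coloring k (f : {ffun T -> 'I_k}) : bool :=
  [forall K : {set T},
    maximal_clique K && (1 < #|K|)%N ==> ~~ monochromatic f K].

Definition clique_colorable k : bool :=
  [exists f : {ffun T -> 'I_k}, clique_coloring f].

Lemma clique_colorable_ex : exists k, clique_colorable k.
Proof.
exists #|T|; apply/existsP; exists [ffun x => enum_rank x].
apply/forallP => K; apply/implyP => /andP[_ /card_gt1P[x [y [xK yK xy]]]].
apply/existsP => -[c /forall_inP fc].
move: (fc _ xK) (fc _ yK); rewrite !ffunE => /eqP <- /eqP /enum_rank_inj yx.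
by rewrite yx eqxx in xy.
Qed.

Definition clique_chromatic_number : nat := ex_minn clique_colorable_ex.

End CliqueColoring.

Local Open Scope ring_scope.

Section RandomGraph.
Variables (R : realType) (n : nat) (p : R).

Definition Gnp_mass (G : graph 'I_n) : R :=
  \prod_(e : vpair 'I_n) (if e \in G then p else 1 - p).

(* The probability that the binomial random graph G_{n,p} satisfies A. *)
Definition Gnp_prob (A : pred (graph 'I_n)) : R :=
  \sum_(G : graph 'I_n | A G) Gnp_mass G.

(* min {p^(3/2) n / sqrt (log n), 1/p}, with 1/p read in the extended reals, so
   that it is +oo for p = 0; the minimum itself is always finite. *)
Definition min_term : R :=
  fine (mine (p `^ (3 / 2) * n%:R / Num.sqrt (ln n%:R))%:E (p%:E)^-1)%E.

Definition clique_chromatic_scale : R :=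
  Num.max 1 (Num.max (expR (- (n%:R * p ^+ 2)) * n%:R * p / ln n%:R) min_term).

End RandomGraph.

(* Main.v *)
(* Write L = ln n. A colouring with no monochromatic triangle and no monochromatic
   edge that lies in no triangle is a clique colouring, and Rosenfeld's counting
   argument finds one with 2 sqrt D + h colours if every vertex lies in at most D
   triangles and h such lone edges; with high probability D = O(L (np)(np^2)) and
   h = O(np e^(-np^2) + L). When p^(5/2) n >= sqrt L, some O(L/p) vertices dominate
   the graph, and colouring each vertex by a dominating neighbour is a clique
   colouring. When np^2 <= 1, the maximum degree bound suffices.

   For the lower bounds, call a clique K in a set A closed if A contains every
   common neighbour of K. A set with a closed clique contains a maximal clique, so
   it is not monochromatic, and chi_c >= n/s if every set of s vertices has one. The
   three terms of the scale come from three sizes of closed cliques. Edges: a second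
   moment computation gives about s^2 e^(-np^2) pairs of A without common neighbour
   outside A, and one of them is an edge. Triangles, for np^3 small: few triples of
   A have a common neighbour outside A, and Janson's inequality produces a triangle
   among the other ones. Cliques with j + 4 vertices, where np^(j+4) is small: j
   vertices of A with about p^j s common neighbours in A are chosen greedily, and
   Janson's inequality inside their common neighbourhood supplies the last four. *)
Require Import Defs.
From mathcomp Require Import all_boot all_order all_algebra.
From mathcomp Require Import zify ring lra.
From mathcomp Require Import all_classical all_reals all_analysis.
From mathcomp Require Import fintype finset.
Set Implicit Arguments.
Unset Strict Implicit.
Unset Printing Implicit Defensive.
Import Order.TTheory GRing.Theory Num.Theory numFieldNormedType.Exports.
Local Open Scope set_scope.
Local Open Scope ring_scope.

(** A union bound over the sets [A] of size [s] costs a factor [expR (s * L)], so a single set must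
    fail with a still smaller probability. This is why Janson's inequality supplies the cliques with
    at least three vertices, and why the cliques spoilt by a common neighbour outside [A] need
    exponential moments instead of a first moment bound. Both requirements are decoupled by exposing
    the edges that leave [A] before those inside: the former decide which subsets of [A] have no
    common neighbour outside, the latter whether one of these is a clique. Resampling a set of edges
    ([mix]) plays the role of conditioning. For larger [p] the size of a clique with few common
    neighbours is unbounded in [n], while the constants in Janson's inequality deteriorate with the
    size of the cliques; choosing all but four vertices greedily keeps the constants absolute. Since
    the number of colours is at least 1, the lower bound is only at stake when the scale exceeds
    [C * L]; this extra factor provides the room in all numerical conditions. *)

Lemma eq_ler (R : realType) (a b : R) : a = b -> a <= b.
Proof. by move=> ->. Qed.

(** * Product measures and concentration *)

Section ProductMeasure.
Variables (R : realType) (E : finType) (p : R).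
Hypotheses (p0 : 0 <= p) (p1 : p <= 1).
Implicit Types (G S D : {set E}) (F H : {set E} -> R) (A B : pred {set E}).

Definition mass G : R := \prod_e (if e \in G then p else 1 - p).
Definition Ex F : R := \sum_G mass G * F G.
Definition Pr A : R := Ex (fun G => (A G)%:R).

Lemma mass_ge0 G : 0 <= mass G.
Proof. by apply: prodr_ge0 => e _; case: ifP => _; rewrite ?subr_ge0. Qed.

Lemma Ex_prod (a b : E -> R) :
  Ex (fun G => \prod_e (if e \in G then a e else b e))
    = \prod_e (p * a e + (1 - p) * b e).
Proof.
rewrite bigA_distr; apply: eq_bigr => G _.
by rewrite -big_split; apply: eq_bigr => e _; case: ifP.
Qed.

Lemma eq_Ex F H : F =1 H -> Ex F = Ex H.
Proof. by move=> FH; apply: eq_bigr => G _; rewrite FH. Qed.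

Lemma Ex1 : Ex (fun=> 1) = 1.
Proof.
transitivity (Ex (fun G => \prod_e (if e \in G then 1 else 1))).
  by apply: eq_Ex => G; rewrite big1 // => e _; case: ifP.
by rewrite Ex_prod big1 // => e _; rewrite !mulr1; lra.
Qed.

Lemma ExZ c F : Ex (fun G => c * F G) = c * Ex F.
Proof. by rewrite /Ex mulr_sumr; apply: eq_bigr => G _; rewrite mulrCA. Qed.

Lemma Ex_cst c : Ex (fun=> c) = c.
Proof. by rewrite -[RHS]mulr1 -Ex1 -ExZ; apply: eq_Ex => G; rewrite mulr1. Qed.

Lemma ExD F H : Ex (fun G => F G + H G) = Ex F + Ex H.
Proof. by rewrite -big_split; apply: eq_bigr => G _; rewrite mulrDr. Qed.

Lemma ExB F H : Ex (fun G => F G - H G) = Ex F - Ex H.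
Proof. by rewrite -sumrB; apply: eq_bigr => G _; rewrite mulrBr. Qed.

Lemma Ex_sum (I : Type) (r : seq I) (P : pred I) (F : I -> {set E} -> R) :
  Ex (fun G => \sum_(i <- r | P i) F i G) = \sum_(i <- r | P i) Ex (F i).
Proof.
by rewrite exchange_big; apply: eq_bigr => G _; rewrite mulr_sumr.
Qed.

Lemma le_Ex F H : (forall G, F G <= H G) -> Ex F <= Ex H.
Proof. by move=> FH; apply: ler_sum => G _; rewrite ler_wpM2l ?mass_ge0. Qed.

Lemma Ex_ge0 F : (forall G, 0 <= F G) -> 0 <= Ex F.
Proof. by move=> F0; apply: sumr_ge0 => G _; rewrite mulr_ge0 ?mass_ge0. Qed.

Lemma Ex_gt_ex F c : c <= Ex F -> exists G, c <= F G.
Proof.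
move=> cF; apply: contrapT => nG.
have Fc G : F G < c by rewrite ltNge; apply/negP => cG; apply: nG; exists G.
have [G mG] : exists G, 0 < mass G.
  apply: contrapT => nm; have := Ex1; rewrite /Ex big1 ?mulr1 => [|G _].
    by move/eqP; rewrite eq_sym oner_eq0.
  rewrite mulr1; apply/eqP; rewrite eq_le mass_ge0 andbT leNgt.
  by apply/negP => mG; apply: nm; exists G.
move: cF; apply/negP; rewrite -ltNge -subr_gt0 -[X in X - _]Ex_cst -ExB.
rewrite /Ex (bigD1 G) //= ltr_pwDl ?mulr_gt0 ?subr_gt0 //.
by apply: sumr_ge0 => K _; rewrite mulr_ge0 ?mass_ge0 // subr_ge0 ltW.
Qed.

Lemma Pr_ge0 A : 0 <= Pr A.
Proof. by apply: Ex_ge0 => G; rewrite ler0n. Qed.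

Lemma le_Pr A B : (forall G, A G -> B G) -> Pr A <= Pr B.
Proof. by move=> AB; apply: le_Ex => G; rewrite ler_nat; case: (A G) (AB G) => // ->. Qed.

Lemma eq_Pr A B : A =1 B -> Pr A = Pr B.
Proof. by move=> AB; apply: eq_Ex => G; rewrite AB. Qed.

Lemma Pr_pred0 : Pr (fun=> false) = 0.
Proof. by rewrite /Pr Ex_cst. Qed.

Lemma Pr_le1 A : Pr A <= 1.
Proof. by rewrite -Ex1; apply: le_Ex => G; case: (A G); rewrite ?ler01. Qed.

Lemma Pr_not A : Pr (fun G => ~~ A G) = 1 - Pr A.
Proof. by rewrite -Ex1 -ExB; apply: eq_Ex => G; case: (A G); rewrite ?subrr ?subr0. Qed.

Lemma Pr_or A B : Pr (fun G => A G || B G) <= Pr A + Pr B.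
Proof.
rewrite -ExD; apply: le_Ex => G.
by case: (A G) (B G) => -[]; rewrite ?addr0 ?add0r //= lerDl.
Qed.

Lemma Pr_exists (I : finType) (P : pred I) (A : I -> pred {set E}) :
  Pr (fun G => [exists (i | P i), A i G]) <= \sum_(i | P i) Pr (A i).
Proof.
rewrite -Ex_sum; apply: le_Ex => G; case: existsP => [[i /andP[Pi AiG]]|_].
  by rewrite (bigD1 i) //= AiG lerDl sumr_ge0 // => j _; rewrite ler0n.
by rewrite sumr_ge0 // => j _; rewrite ler0n.
Qed.

Lemma Pr_exists_in_le (I : finType) (P : pred I) (A : I -> pred {set E}) c :
  (forall i, P i -> Pr (A i) <= c) ->
  Pr (fun G => [exists (i | P i), A i G]) <= #|[set i | P i]|%:R * c.
Proof.
move=> Ac; apply: le_trans (Pr_exists _ _) _.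
rewrite -sum1_card natr_sum mulr_suml [leRHS](eq_bigl P) => [|i]; last by rewrite inE.
by apply: ler_sum => i Pi; rewrite mul1r Ac.
Qed.

Lemma Pr_exists_le (I : finType) (A : I -> pred {set E}) c :
  (forall i, Pr (A i) <= c) -> Pr (fun G => [exists i, A i G]) <= #|I|%:R * c.
Proof.
move=> Ac; have := @Pr_exists_in_le I xpredT A c (fun i _ => Ac i).
by rewrite cardsE.
Qed.

Lemma Ex_markov F c A : 0 < c -> (forall G, 0 <= F G) ->
  (forall G, A G -> c <= F G) -> Pr A <= Ex F / c.
Proof.
move=> c0 F0 AF; rewrite ler_pdivlMr // mulrC -ExZ; apply: le_Ex => G.
by case: (boolP (A G)) => [/AF|_]; rewrite ?mulr1 ?mulr0.
Qed.

(** The edges in [D] are taken from [S], the others from [G]: with [S] and [G] independent samples,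
    fixing [S] replaces conditioning on the edges in [D]. *)
Definition mix D S G := (S :&: D) :|: (G :\: D).

Lemma in_mix D S G e : (e \in mix D S G) = (if e \in D then e \in S else e \in G).
Proof. by rewrite !inE; case: ifP; rewrite ?andbT ?andbF ?orbF. Qed.

Lemma mass_mix D S G : mass S * mass G = mass (mix D S G) * mass (mix D G S).
Proof.
rewrite -!big_split; apply: eq_bigr => e _ /=; rewrite !in_mix.
by case: (e \in D); rewrite // mulrC.
Qed.

(** Exchanging two configurations on [D] is an involution that preserves the product of their
    masses, so [mix D S G] is distributed like a single sample. *)
Lemma Ex_mix D F : Ex F = Ex (fun S => Ex (fun G => F (mix D S G))).
Proof.
transitivity (\sum_S \sum_G mass S * mass G * F S).
  apply: eq_bigr => S _; rewrite -[in LHS](mulr1 (F S)) -Ex1 /Ex !mulr_sumr.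
  by apply: eq_bigr => G _; rewrite mulr1; ring.
rewrite pair_big /=.
have mixK : involutive (fun u : {set E} * {set E} => (mix D u.1 u.2, mix D u.2 u.1)).
  by move=> [S G] /=; congr (_, _); apply/setP => e; rewrite !in_mix; case: (e \in D).
rewrite (reindex_inj (inv_inj mixK)) /=.
under eq_bigr do rewrite -mass_mix -mulrA.
rewrite -(pair_big xpredT xpredT (fun S G => mass S * (mass G * F (mix D S G)))) /=.
by apply: eq_bigr => S _; rewrite mulr_sumr.
Qed.

Lemma Pr_mix_le D A c : (forall S, Pr (fun G => A (mix D S G)) <= c) -> Pr A <= c.
Proof. by move=> Ac; rewrite /Pr (Ex_mix D) -[leRHS]Ex_cst; apply: le_Ex => S; exact: Ac. Qed.

(** Measurability of [f] with respect to the edges in [D]. *)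
Definition dep (T : Type) D (f : {set E} -> T) :=
  forall S G, S :&: D = G :&: D -> f S = f G.

Lemma dep_in T D (f : {set E} -> T) :
  (forall S G, {in D, S =i G} -> f S = f G) -> dep D f.
Proof.
move=> fD S G SG; apply: fD => e eD.
by move/setP/(_ e): SG; rewrite !inE eD !andbT.
Qed.

Lemma dep_eq T D (f : {set E} -> T) S G : dep D f -> {in D, S =i G} -> f S = f G.
Proof.
move=> fD SG; apply: fD; apply/setP => e; rewrite !inE.
by case: (boolP (e \in D)) => [/SG ->|]; rewrite ?andbF.
Qed.

Lemma dep_comp T U D (f : {set E} -> T) (g : T -> U) : dep D f -> dep D (g \o f).
Proof. by move=> fD S G SG /=; rewrite (fD _ _ SG). Qed.

(** In [mix D S G] the function [F] reads only [S] and [H] reads only [G]. *)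
Lemma Ex_indep D D' F H : [disjoint D & D'] -> dep D F -> dep D' H ->
  Ex (fun G => F G * H G) = Ex F * Ex H.
Proof.
move=> /pred0P dD FD HD; rewrite (Ex_mix D) mulrC -ExZ; apply: eq_Ex => S.
rewrite mulrC -ExZ; apply: eq_Ex => G; congr (_ * _).
  by apply: (dep_eq FD) => e eD; rewrite in_mix eD.
apply: (dep_eq HD) => e eD; rewrite in_mix; case: ifP => // eD'.
by have := dD e; rewrite /= eD eD'.
Qed.

Lemma Ex_indep_prod (I : finType) (P : pred I) (D : I -> {set E})
    (F : I -> {set E} -> R) :
  (forall i j, P i -> P j -> i != j -> [disjoint D i & D j]) ->
  (forall i, P i -> dep (D i) (F i)) ->
  Ex (fun G => \prod_(i | P i) F i G) = \prod_(i | P i) Ex (F i).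
Proof.
move=> dD FD; have: uniq (index_enum I) by exact: index_enum_uniq.
elim: (index_enum I) => [_|i r IHr /= /andP[ir ur]].
  by under eq_Ex do rewrite big_nil; rewrite big_nil Ex1.
case: (boolP (P i)) => Pi; last first.
  by rewrite big_cons (negPf Pi) -IHr //; apply: eq_Ex => G; rewrite big_cons (negPf Pi).
rewrite big_cons Pi -IHr //.
rewrite -(@Ex_indep (D i) (\bigcup_(j <- r | P j) D j)) ?FD //.
- by apply: eq_Ex => G; rewrite big_cons Pi.
- rewrite big_seq_cond; apply: (big_ind (fun X : {set E} => [disjoint D i & X])).
  + by rewrite disjoints_subset setC0 subsetT.
  + by move=> X Y; rewrite !disjoints_subset setCU subsetI => -> ->.
  + by move=> j /andP[jr Pj]; rewrite dD //; apply: contraNneq ir => ->.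
- exact: FD.
- apply: dep_in => S G SG; rewrite big_seq_cond [RHS]big_seq_cond.
  apply: eq_bigr => j /andP[jr Pj]; apply: (dep_eq (FD j Pj)) => e ej.
  apply: SG; rewrite (big_rem j) //= Pj; exact/setUP/or_introl.
Qed.

Lemma Pr_sub D : Pr (fun G => D \subset G) = p ^+ #|D|.
Proof.
transitivity (Ex (fun G => \prod_e (if e \in G then 1 else (e \notin D)%:R))).
  apply: eq_Ex => G; case: (boolP (D \subset G)) => [/subsetP DG|/subsetPn[e eD eG]].
    rewrite big1 // => e _; case: ifP => // /negP eG.
    by rewrite (contra_notN (DG e)).
  by rewrite (bigD1 e) //= (negPf eG) eD mul0r.
rewrite Ex_prod -prodr_const [RHS]big_mkcond; apply: eq_bigr => e _.
by case: ifP => _; rewrite !mulr1 ?mulr0 //; lra.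
Qed.

Lemma Pr_disj D : Pr (fun G => [disjoint D & G]) = (1 - p) ^+ #|D|.
Proof.
transitivity (Ex (fun G => \prod_e (if e \in G then (e \notin D)%:R else 1))).
  apply: eq_Ex => G; case: (boolP [disjoint D & G]) => [/pred0P DG|/pred0Pn[e /andP[/= eD eG]]].
    rewrite big1 // => e _; case: ifP => // eG.
    by have := DG e; rewrite /= eG andbT => ->.
  by rewrite (bigD1 e) //= eG eD mul0r.
rewrite Ex_prod -prodr_const [RHS]big_mkcond; apply: eq_bigr => e _.
by case: ifP => _; rewrite !mulr1 ?mulr0 //; lra.
Qed.

End ProductMeasure.

(** * Chernoff bounds for counts of independent events *)

Section Concentration.
Variables (R : realType) (E : finType) (p : R).
Hypotheses (p0 : 0 <= p) (p1 : p <= 1).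

Lemma expR_le_quad (x : R) : 0 <= x <= 1 / 2 -> expR x <= 1 + x + 2 * x ^+ 2.
Proof.
move=> /andP[x0 x1]; rewrite -[expR x]invrK -expRN.
have e0 : 0 < 1 - x by lra.
have ie : 1 - x <= expR (- x) by have := expR_ge1Dx (- x); lra.
rewrite invf_ple ?posrE ?expR_gt0 //; last by nra.
apply: le_trans ie; rewrite -[leRHS]invrK lef_pV2 ?posrE ?invr_gt0 //; last by nra.
rewrite -[leLHS]mul1r ler_pdivrMr //.
nra.
Qed.

Lemma expRN_le_quad (x : R) : 0 <= x -> expR (- x) <= 1 - x + x ^+ 2.
Proof.
move=> x0; rewrite expRN; have e1 : 1 + x <= expR x := expR_ge1Dx x.
apply: (@le_trans _ _ (1 + x)^-1); first by rewrite lef_pV2 ?posrE ?expR_gt0 //; lra.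
by rewrite -[leLHS]mul1r ler_pdivrMr; nra.
Qed.

Variables (I : finType) (P : pred I) (D : I -> {set E}) (X : I -> pred {set E}).
Hypothesis dD : forall i j, P i -> P j -> i != j -> [disjoint D i & D j].
Hypothesis XD : forall i, P i -> dep (D i) (X i).

Let N G : R := (#|[set i | P i & X i G]|)%:R.

Lemma card_setI_sum G : N G = \sum_(i | P i) (X i G)%:R.
Proof.
rewrite /N -sum1_card natr_sum big_mkcond [RHS]big_mkcond; apply: eq_bigr => i _.
by rewrite inE; case: (P i); case: (X i G).
Qed.

Lemma Ex_expR_count (l : R) :
  Ex p (fun G => expR (l * N G)) = \prod_(i | P i) (1 + Pr p (X i) * (expR l - 1)).
Proof.
transitivity (Ex p (fun G => \prod_(i | P i) expR (l * (X i G)%:R))).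
  by apply: eq_Ex => G; rewrite card_setI_sum mulr_sumr expR_sum.
rewrite (Ex_indep_prod p dD) => [|i Pi]; last first.
  by apply: (dep_comp (fun b : bool => expR (l * b%:R))); exact: XD.
apply: eq_bigr => i _.
rewrite -[X in X + _](Ex1 E p) mulrC -ExZ // -ExD; apply: eq_Ex => G.
by case: (X i G); rewrite ?mulr1 ?mulr0 ?expR0 ?addr0 //; lra.
Qed.

Lemma Ex_expR_count_le (l q : R) : (forall i, P i -> Pr p (X i) <= q) -> 0 <= l ->
  Ex p (fun G => expR (l * N G)) <= expR ((expR l - 1) * q * (#|[set i | P i]|)%:R).
Proof.
move=> Xq l0; rewrite Ex_expR_count.
have el : 0 <= expR l - 1 by rewrite subr_ge0 -expR0 ler_expR.
have -> : (#|[set i | P i]|)%:R = \sum_(i | P i) (1 : R).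
  by rewrite -sum1_card natr_sum; apply: eq_bigl => i; rewrite inE.
rewrite mulr_sumr expR_sum; apply: ler_prod => i Pi; rewrite mulr1.
apply/andP; split; first by have := Pr_ge0 p0 p1 (X i); nra.
apply: le_trans (expR_ge1Dx _); rewrite lerD2l mulrC ler_wpM2l //; exact: Xq.
Qed.

(** Markov's inequality for [expR (l * N)], where [expR l - 1 <= l + 2 * l ^+ 2] gives the relative
    error [2 * l] and the tail [expR (- r)] costs the additive error [r / l]. With both errors
    explicit, no relation between [r] and the mean is imposed, and [l] can be tuned at each use. *)
Lemma chernoff_upper (l q r m : R) : (forall i, P i -> Pr p (X i) <= q) ->
  0 < l <= 1 / 2 -> q * (#|[set i | P i]|)%:R <= m ->
  Pr p (fun G => m * (1 + 2 * l) + r / l <= N G) <= expR (- r).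
Proof.
move=> Xq /andP[l0 l1] qm.
have m0 : 0 <= m.
  have [n0|] := posnP #|[set i | P i]|; first by move: qm; rewrite n0 mulr0.
  rewrite card_gt0 => /set0Pn[i]; rewrite inE => Pi.
  apply: le_trans qm; rewrite mulr_ge0 // (le_trans _ (Xq i Pi)) //; exact: Pr_ge0.
apply: (le_trans (Ex_markov p0 p1 (F := fun G => expR (l * N G))
  (c := expR (l * (m * (1 + 2 * l) + r / l))) _ _ _)).
- exact: expR_gt0.
- by move=> G; apply: expR_ge0.
- by move=> G NG; rewrite ler_expR ler_pM2l.
rewrite -expRN; apply: le_trans (ler_wpM2r (expR_ge0 _) (Ex_expR_count_le Xq (ltW l0))) _.
rewrite -expRD ler_expR.
have -> : l * (m * (1 + 2 * l) + r / l) = l * (m * (1 + 2 * l)) + r.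
  by field; apply: lt0r_neq0.
have : expR l <= 1 + l + 2 * l ^+ 2 by apply: expR_le_quad; lra.
have : 1 <= expR l by rewrite -expR0 ler_expR ltW.
rewrite -mulrA; set mm := q * _ in qm *; move=> h1 h2.
have : (expR l - 1) * mm <= (l + 2 * l ^+ 2) * m.
  apply: (@le_trans _ _ ((expR l - 1) * m)); first by rewrite ler_wpM2l; lra.
  by rewrite ler_wpM2r //; lra.
by lra.
Qed.

Lemma chernoff_lower (l q r m : R) : (forall i, P i -> q <= Pr p (X i)) ->
  0 < l -> 0 <= q -> 0 <= m <= q * (#|[set i | P i]|)%:R ->
  Pr p (fun G => N G <= m * (1 - l) - r / l) <= expR (- r).
Proof.
move=> Xq l0 q0 /andP[m0 qm].
apply: (le_trans (Ex_markov p0 p1 (F := fun G => expR (- l * N G))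
  (c := expR (- l * (m * (1 - l) - r / l))) _ _ _)).
- exact: expR_gt0.
- by move=> G; apply: expR_ge0.
- by move=> G NG; rewrite ler_expR !mulNr lerN2 ler_pM2l.
rewrite -expRN Ex_expR_count.
have h1 : expR (- l) <= 1 - l + l ^+ 2 by apply: expRN_le_quad; lra.
have h2 : 0 < expR (- l) by apply: expR_gt0.
have h3 : expR (- l) < 1 by rewrite expR_lt1 oppr_lt0.
apply: (@le_trans _ _ (expR (- (1 - expR (- l)) * (q * (#|[set i | P i]|)%:R)) *
    expR (- (- l * (m * (1 - l) - r / l))))).
  rewrite ler_wpM2r ?expR_ge0 //.
  have -> : (#|[set i | P i]|)%:R = \sum_(i | P i) (1 : R).
    by rewrite -sum1_card natr_sum; apply: eq_bigl => i; rewrite inE.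
  rewrite !mulr_sumr expR_sum; apply: ler_prod => i Pi; rewrite mulr1.
  have := Pr_le1 p0 p1 (X i); have := Xq i Pi.
  set x := Pr _ _ => qx x1.
  have a1 := expR_ge1Dx (- (1 - expR (- l)) * q).
  apply/andP; split; nra.
rewrite -expRD ler_expR.
have -> : - (- l * (m * (1 - l) - r / l)) = l * (m * (1 - l)) - r.
  by field; apply: lt0r_neq0.
set mm := q * _ in qm *.
have mm0 : 0 <= mm by rewrite mulr_ge0.
have [l1|l1] := lerP l 1; last by nra.
have : (l - l ^+ 2) * m <= (1 - expR (- l)) * mm.
  apply: (@le_trans _ _ ((1 - expR (- l)) * m)).
    by rewrite ler_wpM2r //; lra.
  by rewrite ler_wpM2l //; lra.
by lra.
Qed.

End Concentration.

(** * Correlation inequalities *)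

Section Correlation.
Variables (R : realType) (E : finType) (p : R).
Hypotheses (p0 : 0 <= p) (p1 : p <= 1).
Implicit Types (G S D : {set E}) (F H : {set E} -> R).

Lemma Ex_split e F :
  Ex p F = p * Ex p (fun G => F (e |: G)) + (1 - p) * Ex p (fun G => F (G :\ e)).
Proof.
rewrite (Ex_mix p [set e]).
have pe : Pr p (fun S => e \in S) = p.
  rewrite -[RHS]expr1 -(cards1 e) -Pr_sub; apply: eq_Pr => S.
  by rewrite sub1set.
set A1 := Ex p (fun G => F (e |: G)); set A0 := Ex p (fun G => F (G :\ e)).
transitivity (Ex p (fun S => A1 * (e \in S)%:R + A0 * (~~ (e \in S))%:R)); last first.
  by rewrite ExD !ExZ -/(Pr p _) -/(Pr p (fun S => ~~ (e \in S))) Pr_not pe; ring.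
apply: eq_Ex => S; case: (boolP (e \in S)) => eS /=.
  rewrite mulr0 addr0 mulr1; apply: eq_Ex => G.
  by congr F; apply/setP => x; rewrite in_mix !inE; case: eqP => // ->.
rewrite mulr0 add0r mulr1; apply: eq_Ex => G.
congr F; apply/setP => x; rewrite in_mix !inE; case: eqP => // ->.
by rewrite (negPf eS).
Qed.

Definition increasing_on F := forall S G, S \subset G -> F S <= F G.

(** Induction on the edges that [F] and [H] may read. Splitting on one edge leaves the covariance
    [p * (1 - p) * ((a1 - a0) * (b1 - b0))] of two functions of a single bit, and monotonicity makes
    both factors nonnegative. *)
Lemma harris F H : increasing_on F -> increasing_on H ->
  Ex p F * Ex p H <= Ex p (fun G => F G * H G).
Proof.
suff main (s : seq E) : forall F H, increasing_on F -> increasing_on H ->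
    dep [set x in s] F -> dep [set x in s] H ->
    Ex p F * Ex p H <= Ex p (fun G => F G * H G).
  move=> Fi Hi; apply: (main (enum E)) => //; apply: dep_in => S G SG.
    by congr F; apply/setP => e; rewrite SG // inE mem_enum.
  by congr H; apply/setP => e; rewrite SG // inE mem_enum.
elim: s => [|e s IHs] {}F {}H Fi Hi Fd Hd.
  have Fc G : F G = F set0 by apply: (dep_eq Fd) => x; rewrite inE.
  have Hc G : H G = H set0 by apply: (dep_eq Hd) => x; rewrite inE.
  have -> : Ex p (fun G => F G * H G) = Ex p (fun _ : {set E} => F set0 * H set0).
    by apply: eq_Ex => G; rewrite Fc Hc.
  by rewrite (eq_Ex p Fc) (eq_Ex p Hc) !Ex_cst.
rewrite (Ex_split e F) (Ex_split e H) (Ex_split e (fun G => F G * H G)).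
have inc1 K : increasing_on K -> increasing_on (fun G => K (e |: G)).
  by move=> Ki S G SG; apply: Ki; apply: setUS.
have inc0 K : increasing_on K -> increasing_on (fun G => K (G :\ e)).
  by move=> Ki S G SG; apply: Ki; apply: setSD.
have dep1 (K : {set E} -> R) : dep [set x in e :: s] K -> dep [set x in s] (fun G => K (e |: G)).
  move=> Kd; apply: dep_in => S G SG; apply: (dep_eq Kd) => x.
  by rewrite !inE; case: eqP => //= _ xs; apply: SG; rewrite inE.
have dep0 (K : {set E} -> R) : dep [set x in e :: s] K -> dep [set x in s] (fun G => K (G :\ e)).
  move=> Kd; apply: dep_in => S G SG; apply: (dep_eq Kd) => x.
  by rewrite !inE; case: eqP => //= _ xs; apply: SG; rewrite inE.
have h1 := IHs _ _ (inc1 _ Fi) (inc1 _ Hi) (dep1 _ Fd) (dep1 _ Hd).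
have h0 := IHs _ _ (inc0 _ Fi) (inc0 _ Hi) (dep0 _ Fd) (dep0 _ Hd).
have le K : increasing_on K -> Ex p (fun G => K (G :\ e)) <= Ex p (fun G => K (e |: G)).
  move=> Ki; apply: le_Ex => // G; apply: Ki.
  exact: subset_trans (subsetDl _ _) (subsetUr _ _).
move: (le _ Fi) (le _ Hi) h1 h0.
set a1 := Ex p (fun G => F (e |: G)); set a0 := Ex p (fun G => F (G :\ e)).
set b1 := Ex p (fun G => H (e |: G)); set b0 := Ex p (fun G => H (G :\ e)).
set c1 := Ex p _; set c0 := Ex p _ => ha hb h1 h0.
apply: (@le_trans _ _ (p * (a1 * b1) + (1 - p) * (a0 * b0))).
  rewrite -subr_ge0.
  have -> : p * (a1 * b1) + (1 - p) * (a0 * b0) -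
     (p * a1 + (1 - p) * a0) * (p * b1 + (1 - p) * b0)
     = p * (1 - p) * ((a1 - a0) * (b1 - b0)) by ring.
  by rewrite !mulr_ge0 ?subr_ge0.
by rewrite lerD // ler_wpM2l // subr_ge0.
Qed.

Lemma Pr_incr_decr (A B : pred {set E}) :
  (forall S G, S \subset G -> A S -> A G) -> (forall S G, S \subset G -> B G -> B S) ->
  Pr p (fun G => A G && B G) <= Pr p A * Pr p B.
Proof.
move=> Ai Bd.
have := @harris (fun G => (A G)%:R) (fun G => - (B G)%:R).
rewrite -[Pr p _]opprK lerNl -mulrN /Pr => h.
have -> : - Ex p (fun G => (B G)%:R) = Ex p (fun G => - (B G)%:R).
  rewrite -[LHS]mulN1r -ExZ; apply: eq_Ex => G; lra.
apply: le_trans (h _ _) _.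
- by move=> S G SG; rewrite ler_nat; case: (A S) (Ai _ _ SG) => // ->.
- by move=> S G SG; rewrite lerN2 ler_nat; case: (B G) (Bd _ _ SG) => // ->.
rewrite -[leRHS]mulN1r -ExZ; apply: le_Ex => // G.
by case: (A G) (B G) => -[] /=; lra.
Qed.

(** * Janson's inequality *)

Section Janson.
Variables (I : finType) (D : I -> {set E}).

Let none (r : seq I) G := all (fun i => ~~ (D i \subset G)) r.
(** The weight of a pair in Janson's correlation sum: the probability that [D i] and [D j] are both
    present, counted only when they share an element. *)
Let w i j : R := if [disjoint D i & D j] then 0 else p ^+ #|D i :|: D j|.

Let w_ge0 i j : 0 <= w i j.
Proof. by rewrite /w; case: ifP => // _; rewrite exprn_ge0. Qed.

(* Boppana and Spencer: by Harris' inequality, conditioning on the events [D j]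
   disjoint from [D i] is harmless, and the others cost at most [w i j] each. *)
Lemma Pr_none_seq (r : seq I) : uniq r ->
  Pr p (none r) <= expR (- (\sum_(i <- r) p ^+ #|D i|)
                         + \sum_(i <- r) \sum_(j <- r | j != i) w i j).
Proof.
elim: r => [_|i r IHr /= /andP[ir ur]].
  by rewrite !big_nil oppr0 addr0 expR0 Pr_le1.
(* [rr] is a lower bound for the probability of [D i \subset G] given that no set of [r] is present;
   if it is not positive, [i] is simply dropped. *)
pose rr : R := p ^+ #|D i| - \sum_(j <- r) w i j.
have key : Pr p (none (i :: r)) <= Pr p (none r) * expR (- rr).
  have [rr0|rr0] := lerP rr 0.
    apply: (@le_trans _ _ (Pr p (none r))).
      by apply: le_Pr => // G /= /andP[].
    by rewrite -[leLHS]mulr1 ler_wpM2l ?Pr_ge0 // -expR0 ler_expR; lra.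
  apply: (@le_trans _ _ (Pr p (none r) * (1 - rr))); last first.
    by rewrite ler_wpM2l ?Pr_ge0 // expR_ge1Dx.
  pose r1 := [seq j <- r | [disjoint D i & D j]].
  have none_decr (s : seq I) S G : S \subset G -> none s G -> none s S.
    move=> SG /allP h; apply/allP => j js; apply: contra (h _ js) => jS.
    exact: subset_trans jS SG.
  have e1 : Pr p (fun G => (D i \subset G) && none r1 G) = p ^+ #|D i| * Pr p (none r1).
    rewrite -Pr_sub /Pr.
    rewrite -(@Ex_indep _ _ p (D i) (~: D i)).
    - by apply: eq_Ex => G; rewrite -natrM mulnb.
    - by rewrite disjoints_subset setCK.
    - apply: dep_in => S G SG; congr (_%:R); congr nat_of_bool.
      by apply/subsetP/subsetP => h e eD; [rewrite -SG|rewrite SG] => //; apply: h.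
    - apply: dep_in => S G SG; congr (_%:R); congr nat_of_bool.
      apply: eq_in_all => j; rewrite mem_filter => /andP[dj _]; congr (~~ _).
      have ne e : e \in D j -> e \in ~: D i.
        by rewrite inE => ej; apply: contraTN dj => ei; apply/pred0Pn; exists e; rewrite /= ei.
      by apply/subsetP/subsetP => h e eD; [rewrite -SG ?ne|rewrite SG ?ne] => //; apply: h.
  have e2 : Pr p (none (i :: r)) = Pr p (none r) - Pr p (fun G => (D i \subset G) && none r G).
    rewrite /Pr -ExB; apply: eq_Ex => G /=.
    by case: (D i \subset G); case: (none r G); rewrite /= ?subr0 ?subrr.
  (* If [none r1] holds and [none r] fails, some [D j] that meets [D i] is present; Harris'
     inequality separates this increasing event from the decreasing [none r1]. *)
  have e3 : Pr p (fun G => (D i \subset G) && none r1 G) <=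
     Pr p (fun G => (D i \subset G) && none r G) + \sum_(j <- r) w i j * Pr p (none r1).
    apply: (@le_trans _ _ (Pr p (fun G => (D i \subset G) && none r G) +
       \sum_(j <- r | ~~ [disjoint D i & D j]) Pr p (fun G => (D i :|: D j \subset G) && none r1 G))).
      rewrite /Pr -Ex_sum -ExD; apply: le_Ex => // G.
      case: (boolP (D i \subset G)) => /= iG; last first.
        by rewrite add0r sumr_ge0 // => j _; rewrite ler0n.
      case: (boolP (none r1 G)) => n1; last first.
        by rewrite addr_ge0 ?ler0n ?sumr_ge0 // => j _; rewrite ler0n.
      case: (boolP (none r G)) => nr.
        by rewrite lerDl sumr_ge0 // => j _; rewrite ler0n.
      case/allPn: nr => j jr; rewrite negbK => jG.
      have dj : ~~ [disjoint D i & D j].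
        apply: contraL jG => dj; move/allP: n1; apply.
        by rewrite mem_filter dj.
      rewrite add0r (big_rem j) //= dj subUset iG jG lerDl sumr_ge0 // => k _.
    rewrite lerD2l big_mkcond; apply: ler_sum => j _; rewrite /w.
    case: ifP => /= dj; last by rewrite (negbFE dj) mul0r.
    rewrite (negPf dj) -Pr_sub; apply: Pr_incr_decr => [S G SG h|S G]; last exact: none_decr.
    exact: subset_trans h SG.
  have e4 : Pr p (none r) <= Pr p (none r1).
    apply: le_Pr => // G /allP h; apply/allP => j; rewrite mem_filter => /andP[_]; exact: h.
  move: e3; rewrite -mulr_suml e1 e2 => e3.
  have : Pr p (none r) * rr <= Pr p (none r1) * rr by rewrite ler_wpM2r // ltW.
  by rewrite {2}/rr; lra.
apply: le_trans key _.
apply: (le_trans (ler_wpM2r (expR_ge0 _) (IHr ur))).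
rewrite -expRD ler_expR /rr !big_cons eqxx /=.
have -> : \sum_(j <- r | j != i) w i j = \sum_(j <- r) w i j.
  rewrite big_seq_cond [RHS]big_seq_cond; apply: eq_bigl => j.
  by case: (boolP (j \in r)) => //= jr; apply: contraNneq ir => <-.
have : \sum_(j <- r) \sum_(k <- r | k != j) w j k
    <= \sum_(j <- r) \sum_(k <- i :: r | k != j) w j k.
  apply: ler_sum => j _; rewrite big_cons; case: ifP => // _.
  by rewrite lerDr.
by lra.
Qed.

(* [Pr_none_seq] is applied to a random subset of [O], whose density is optimised. *)
Lemma janson (O : {set I}) (m B : R) :
  m = \sum_(i in O) p ^+ #|D i| ->
  \sum_(i in O) \sum_(j in O) w i j <= B -> 0 <= m <= B -> 0 < B ->
  Pr p (fun G => [forall i in O, ~~ (D i \subset G)]) <= expR (- (m ^+ 2 / (4 * B))).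
Proof.
(* The maximiser of [q * m - q ^+ 2 * B]; it is a probability because [m <= B]. *)
move=> mE wB /andP[m0 mB] B0; pose q := m / (2 * B).
have q0 : 0 <= q by rewrite divr_ge0 //; lra.
have q1 : q <= 1 by rewrite ler_pdivrMr; lra.
pose Phi (S : {set I}) : R := \sum_(i in O) (i \in S)%:R * p ^+ #|D i|
  - \sum_(i in O) \sum_(j in O | j != i) ((i \in S) && (j \in S))%:R * w i j.
have prS (A : {set I}) : Pr q (fun S : {set I} => A \subset S) = q ^+ #|A| by exact: Pr_sub.
have ExPhi : m ^+ 2 / (4 * B) <= Ex q Phi.
  rewrite ExB Ex_sum.
  have -> : \sum_(i in O) Ex q (fun S : {set I} => (i \in S)%:R * p ^+ #|D i|) = q * m.
    rewrite mE mulr_sumr; apply: eq_bigr => i _.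
    have pi : Ex q (fun S : {set I} => (i \in S)%:R) = q.
      by rewrite -[RHS]expr1 -(cards1 i) -prS; apply: eq_Ex => S; rewrite sub1set.
    by rewrite [RHS]mulrC -[X in _ = _ * X]pi -ExZ; apply: eq_Ex => S; rewrite mulrC.
  rewrite Ex_sum.
  have h : \sum_(i in O) Ex q (fun S : {set I} =>
     \sum_(j in O | j != i) ((i \in S) && (j \in S))%:R * w i j) <= q ^+ 2 * B.
    apply: (@le_trans _ _ (q ^+ 2 * \sum_(i in O) \sum_(j in O) w i j)).
      2: by rewrite ler_wpM2l ?exprn_ge0.
    rewrite mulr_sumr; apply: ler_sum => i _.
    rewrite Ex_sum mulr_sumr big_mkcondr /=; apply: ler_sum => j _.
    case: ifP => ji; last by rewrite mulr_ge0 ?exprn_ge0.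
    have pij : Ex q (fun S : {set I} => ((i \in S) && (j \in S))%:R) = q ^+ 2.
      have := prS [set i; j]; rewrite cards2 eq_sym ji => <-.
      by apply: eq_Ex => S; rewrite subUset !sub1set.
    by rewrite [leRHS]mulrC -[X in _ <= _ * X]pij -ExZ; apply: le_Ex => // S; rewrite mulrC.
  have -> : m ^+ 2 / (4 * B) = q * m - q ^+ 2 * B by rewrite /q; field; apply: lt0r_neq0.
  by rewrite lerD2l lerN2.
have [S hS] := Ex_gt_ex q0 q1 ExPhi.
apply: (@le_trans _ _ (Pr p (none (enum (O :&: S))))).
  apply: le_Pr => // G /forall_inP h; apply/allP => i; rewrite mem_enum inE => /andP[iO _].
  exact: h.
apply: le_trans (Pr_none_seq (enum_uniq _)) _.
rewrite ler_expR lerNr opprD opprK.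
apply: le_trans hS _; rewrite /Phi.
have e1 : \sum_(i in O) (i \in S)%:R * p ^+ #|D i| = \sum_(i <- enum (O :&: S)) p ^+ #|D i|.
  rewrite big_enum /= [RHS]big_mkcond [LHS]big_mkcond; apply: eq_bigr => i _.
  by rewrite inE; case: (i \in O); case: (i \in S); rewrite ?mul1r ?mul0r.
rewrite e1 lerD2l lerN2 big_enum /= [leLHS]big_mkcond [leRHS]big_mkcond.
apply: ler_sum => i _; rewrite inE; case: (i \in O) => //=; case: (i \in S) => /=.
  rewrite big_enum_cond /= [leLHS]big_mkcond [leRHS]big_mkcond; apply: ler_sum => j _.
  rewrite inE; case: (j \in O) => //=; case: (j \in S) => //=; case: (j != i) => //=.
    by rewrite mul1r.
  by rewrite mul0r.
by apply: sumr_ge0 => j _; rewrite mul0r.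
Qed.

End Janson.
End Correlation.

(** * Colouring by counting *)

Lemma card_bigcup_le (I U : finType) (P : {set I}) (F : I -> {set U}) :
  (#|\bigcup_(i in P) F i| <= \sum_(i in P) #|F i|)%N.
Proof.
elim/big_rec2: _ => [|i A m _ IH]; first by rewrite cards0.
by apply: leq_trans (leq_card_setU _ _) _; rewrite leq_add2l.
Qed.

Section ColouringCount.
Local Open Scope nat_scope.
Variables (T : finType) (Q : nat).
Implicit Types (f : {ffun T -> 'I_Q}) (S : {set T}).

Definition recolour f v (c : 'I_Q) : {ffun T -> 'I_Q} :=
  [ffun x => if x == v then c else f x].

(** Recolouring [v] arbitrarily is injective on the colourings with [f v = f y], as the old colour
    of [v] can be read off at [y]. A forced coincidence thus loses a factor [Q]. *)
Lemma card_forced_colour v (P : pred {ffun T -> 'I_Q}) y : y != v ->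
  (forall f c, P (recolour f v c) = P f) ->
  Q * #|[set f | P f & f v == f y]| <= #|[set f | P f]|.
Proof.
move=> yv Pv.
rewrite mulnC -[X in _ * X](card_ord Q) -cardsT -cardsX.
rewrite -(@card_in_imset _ _ (fun u : {ffun T -> 'I_Q} * 'I_Q => recolour u.1 v u.2)).
  apply/subset_leq_card/subsetP => g /imsetP[[f c]]; rewrite !inE /= => /andP[/andP[Pf _] _] ->.
  by rewrite Pv.
move=> [f c] [g d]; rewrite !inE /= !andbT => /andP[_ /eqP fv] /andP[_ /eqP gv] /ffunP E.
have cd : c = d by have := E v; rewrite !ffunE eqxx.
have fg x : x != v -> f x = g x by move=> xv; have := E x; rewrite !ffunE (negPf xv).
congr (_, _) => //; apply/ffunP => x.
by have [->|/fg //] := eqVneq x v; rewrite fv gv fg.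
Qed.

Variables (e : rel T) (t : T -> T -> T -> bool).
Hypothesis e_sym : symmetric e.
Hypotheses (t_rot : forall x y z, t x y z -> t y z x)
           (t_swap : forall x y z, t x y z -> t x z y).

(** The forbidden pairs [e] and triples [t] stay abstract because two instances are used: lone edges
    with triangles, and all edges with no triples. *)
Definition proper_on S f :=
  [forall x in S, forall y in S, (x != y) && e x y ==> (f x != f y)] &&
  [forall x in S, forall y in S, forall z in S,
     [&& x != y, x != z, y != z & t x y z] ==> ~~ ((f x == f y) && (f y == f z))].

Lemma proper_onP S f : reflect
  ((forall x y, x \in S -> y \in S -> x != y -> e x y -> f x != f y) /\
   (forall x y z, x \in S -> y \in S -> z \in S -> x != y -> x != z -> y != z ->
      t x y z -> ~~ ((f x == f y) && (f y == f z))))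
  (proper_on S f).
Proof.
apply: (iffP andP) => [[/forall_inP h1 /forall_inP h2]|[h1 h2]].
  split=> [x y xS yS xy exy|x y z xS yS zS xy xz yz txyz].
    by have /forall_inP/(_ y yS)/implyP := h1 x xS; apply; rewrite xy.
  have /forall_inP/(_ y yS)/forall_inP/(_ z zS)/implyP := h2 x xS; apply.
  by rewrite xy xz yz.
split; apply/forall_inP => x xS; apply/forall_inP => y yS.
  by apply/implyP => /andP[xy exy]; apply: h1.
by apply/forall_inP => z zS; apply/implyP => /and4P[xy xz yz txyz]; apply: h2.
Qed.

Lemma proper_on_recolour S f v c : v \notin S ->
  proper_on S (recolour f v c) = proper_on S f.
Proof.
move=> vS; have E x : x \in S -> recolour f v c x = f x.
  by rewrite ffunE; case: eqP => // -> /(negP vS).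
apply/proper_onP/proper_onP => -[h1 h2]; split=> [x y xS yS|x y z xS yS zS].
- by rewrite -(E x xS) -(E y yS); apply: h1.
- by rewrite -(E x xS) -(E y yS) -(E z zS); apply: h2.
- by rewrite (E x xS) (E y yS); apply: h1.
- by rewrite (E x xS) (E y yS) (E z zS); apply: h2.
Qed.

Lemma proper_onS S S' f : S' \subset S -> proper_on S f -> proper_on S' f.
Proof.
move=> /subsetP sS /proper_onP[h1 h2]; apply/proper_onP; split=> [x y /sS xS /sS yS|].
  exact: h1.
by move=> x y z /sS xS /sS yS /sS zS; apply: h2.
Qed.

Definition count_proper S := #|[set f | proper_on S f]|.

Variables (b h : nat).
Hypotheses (b_gt0 : 0 < b) (Qbh : 2 * b + h <= Q).
Hypothesis eh : forall v, #|[set x | (x != v) && e v x]| <= h.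
Hypothesis tb : forall v,
  #|[set u : T * T | [&& v != u.1, v != u.2, u.1 != u.2 & t v u.1 u.2]]| <= b * b.

(* Rosenfeld's counting argument: the number of proper partial colourings grows
   by a factor at least [b] with each new vertex [v]. A colouring spoilt by a
   triple [v, x, y] is determined by its restriction to the complement of
   [{v, x}], and such restrictions are few by induction. *)
Lemma count_proper_grow S v : v \notin S -> b * count_proper S <= Q * count_proper (v |: S).
Proof.
have Q0 : 0 < Q by apply: leq_trans Qbh; rewrite addn_gt0 muln_gt0 b_gt0.
have [n] := ubnP #|S|; elim: n S v => // n IHn S v Sn vS.
pose N1 x := #|[set f | proper_on S f & f v == f x]|.
pose N2 (u : T * T) := #|[set f | [&& proper_on S f, f u.1 == f u.2 & f v == f u.2]]|.
pose P1 := [set x in S | (x != v) && e v x].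
pose P2 := [set u : T * T | [&& v != u.1, v != u.2, u.1 != u.2 & t v u.1 u.2]
              && ((u.1 \in S) && (u.2 \in S))].
have step : count_proper S <= count_proper (v |: S) + (\sum_(x in P1) N1 x + \sum_(u in P2) N2 u).
  pose U := [set f | proper_on (v |: S) f] :|: (\bigcup_(x in P1) [set f | proper_on S f & f v == f x]
    :|: \bigcup_(u in P2) [set f | [&& proper_on S f, f u.1 == f u.2 & f v == f u.2]]).
  apply: (@leq_trans #|U|); last first.
    apply: leq_trans (leq_card_setU _ _) _; rewrite leq_add2l.
    apply: leq_trans (leq_card_setU _ _) _; apply: leq_add; exact: card_bigcup_le.
  apply/subset_leq_card/subsetP => f; rewrite !inE => pf.
  case: (boolP (proper_on (v |: S) f)) => //= npf.
  have [/existsP[x /andP[xS fx]]|noe] := boolP [exists x, (x \in P1) && (f v == f x)].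
    by apply/orP; left; apply/bigcupP; exists x; rewrite // inE pf.
  have [/existsP[u /and3P[uS f1 f2]]|not3] :=
      boolP [exists u, [&& u \in P2, f u.1 == f u.2 & f v == f u.2]].
    by apply/orP; right; apply/bigcupP; exists u; rewrite // inE pf f1 f2.
  case/negP: npf; apply/proper_onP.
  have /proper_onP[pe pt] := pf.
  have edge x : x \in S -> e v x -> f v != f x.
    move=> xS vx; apply/negP => fvx; case/existsP: noe; exists x.
    by rewrite !inE xS vx fvx andbT andbT; apply: contraNneq vS => <-.
  have tri x y : x \in S -> y \in S -> x != y -> t v x y -> f v = f x -> f x = f y -> False.
    move=> xS yS xy vxy fvx fxy; case/existsP: not3; exists (x, y).
    rewrite !inE /= xS yS xy vxy -fxy fvx !eqxx !andbT.
    by apply/andP; split; apply: contraNneq vS => ->.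
  split=> [x y|x y z].
    rewrite !inE => /predU1P[->|xS] /predU1P[->|yS]; first by rewrite eqxx.
    - by move=> _; apply: edge.
    - by move=> _; rewrite e_sym eq_sym; apply: edge.
    - exact: pe.
  rewrite !inE => /predU1P[->|xS] /predU1P[->|yS] /predU1P[->|zS]; rewrite ?eqxx //.
  - by move=> _ _ yz vyz; apply/negP => /andP[/eqP fvy /eqP fyz]; apply: (tri y z).
  - move=> _ xz _ xvz; apply/negP => /andP[/eqP fxv /eqP fvz].
    by apply: (tri x z xS zS xz); [exact/t_swap/t_rot|exact/esym|rewrite fxv].
  - move=> xy _ _ xyv; apply/negP => /andP[/eqP fxy /eqP fyv].
    by apply: (tri x y xS yS xy); [exact/t_rot/t_rot|rewrite fxy|].
  - exact: pt.
have H1 : Q * (\sum_(x in P1) N1 x) <= h * count_proper S.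
  rewrite big_distrr /=; apply: (@leq_trans (\sum_(x in P1) count_proper S)).
    apply: leq_sum => x; rewrite inE => /andP[xS /andP[xv _]].
    by apply: card_forced_colour => // f c; rewrite proper_on_recolour.
  rewrite sum_nat_const leq_mul2r; apply/orP; right; apply: leq_trans (eh v).
  by apply/subset_leq_card/subsetP => x; rewrite !inE => /andP[].
(* Each triple spoils at most [count_proper S / (b * Q)] colourings: its two forced colours save
   [Q * Q] compared with the colourings of [S :\ x], of which there are at most [Q / b] times
   [count_proper S] by induction. There are at most [b * b] triples. *)
have H2 : Q * (\sum_(u in P2) N2 u) <= b * count_proper S.
  rewrite -(leq_pmul2l b_gt0) mulnA big_distrr /= mulnA.
  apply: (@leq_trans (\sum_(u in P2) count_proper S)); last first.
    rewrite sum_nat_const leq_mul2r; apply/orP; right; apply: leq_trans (tb v).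
    by apply/subset_leq_card/subsetP => x; rewrite !inE => /andP[].
  apply: leq_sum => -[x y]; rewrite inE /= => /andP[/and4P[vx vy xy _] /andP[xS yS]].
  rewrite -(leq_pmul2l Q0).
  have xSx : x \notin S :\ x by rewrite !inE eqxx.
  apply: leq_trans (_ : b * count_proper (S :\ x) <= _); last first.
    have := IHn (S :\ x) x; rewrite setD1K //; apply=> //.
    by move: Sn; rewrite (cardsD1 x S) xS ltnS.
  have -> : Q * (b * Q * N2 (x, y)) = b * (Q * (Q * N2 (x, y))) by lia.
  rewrite leq_mul2l; apply/orP; right.
  apply: (@leq_trans (Q * #|[set f | proper_on (S :\ x) f & f x == f y]|)); last first.
    apply: card_forced_colour; first by rewrite eq_sym.
    by move=> f c; rewrite proper_on_recolour.
  rewrite leq_mul2l; apply/orP; right.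
  apply: (@leq_trans (Q * #|[set f | (proper_on (S :\ x) f && (f x == f y)) & f v == f y]|)).
    rewrite leq_mul2l; apply/orP; right; apply/subset_leq_card/subsetP => f.
    rewrite !inE /= => /and3P[pf -> ->]; rewrite !andbT.
    by apply: proper_onS pf; apply: subsetDl.
  apply: card_forced_colour; first by rewrite eq_sym.
  move=> f c; rewrite proper_on_recolour ?inE ?negb_and ?vS ?orbT //.
  by rewrite !ffunE !(eq_sym _ v) (negPf vx) (negPf vy).
(* Of the factor [2 * b + h] contained in [Q], the pairs consume [h] and the triples [b], so that
   [b] remains. *)
have : Q * count_proper S <= Q * count_proper (v |: S) + (h * count_proper S + b * count_proper S).
  apply: leq_trans (leq_mul (leqnn Q) step) _.
  by rewrite mulnDr leq_add2l mulnDr leq_add.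
have : (2 * b + h) * count_proper S <= Q * count_proper S by rewrite leq_mul2r Qbh orbT.
by lia.
Qed.

Lemma proper_colouring_exists : exists f, proper_on [set: T] f.
Proof.
have Q0 : 0 < Q by apply: leq_trans Qbh; rewrite addn_gt0 muln_gt0 b_gt0.
suff main n S : #|S| = n -> 0 < count_proper S.
  by have := main _ [set: T] erefl; rewrite card_gt0 => /set0Pn[f]; rewrite inE; exists f.
elim: n S => [|n IHn] S.
  move=> /cards0_eq ->; apply/card_gt0P; exists [ffun=> Ordinal Q0]; rewrite inE.
  by apply/proper_onP; split=> [x y|x y z]; rewrite inE.
move=> Sn; have /card_gt0P[v vS] : 0 < #|S| by rewrite Sn.
have Sv : #|S :\ v| = n by apply/eqP; rewrite -(eqn_add2l 1) -[1]/(true : nat) -{1}vS -cardsD1 Sn.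
have vSv : v \notin S :\ v by rewrite !inE eqxx.
have := count_proper_grow vSv; rewrite setD1K // => le.
have : 0 < Q * count_proper S by apply: leq_trans le; rewrite muln_gt0 b_gt0 IHn.
by rewrite muln_gt0 => /andP[].
Qed.

End ColouringCount.

(** * Deterministic bounds on the clique chromatic number *)

Section CliqueColouringBounds.
Local Open Scope nat_scope.
Variables (T : finType) (G : graph T).
Implicit Types (x y z v w : T) (K A : {set T}).

Lemma adj_sym : symmetric (adj G).
Proof. by move=> x y; rewrite /adj; apply: eq_existsb => e; rewrite setUC. Qed.

Lemma adj_irr x : adj G x x = false.
Proof.
apply/negbTE/negP => /existsP[e /andP[_ /eqP ex]].
by have := valP e; rewrite /= ex setUid cards1.
Qed.

Lemma adj_neq x y : adj G x y -> x != y.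
Proof. by apply: contraTneq => ->; rewrite adj_irr. Qed.

Lemma cliqueP K : reflect {in K &, forall x y, x != y -> adj G x y} (clique G K).
Proof.
apply: (iffP forall_inP) => [h x y xK yK|h x xK].
  by have /forall_inP/(_ y yK)/implyP := h x xK.
by apply/forall_inP => y yK; apply/implyP; exact: h.
Qed.

Lemma clique_ext K w : clique G K -> {in K, forall x, adj G w x} -> clique G (w |: K).
Proof.
move=> /cliqueP cK wK; apply/cliqueP => x y; rewrite !inE.
case/predU1P=> [->|xK] /predU1P[->|yK]; rewrite ?eqxx //.
- by move=> _; apply: wK.
- by move=> _; rewrite adj_sym; apply: wK.
- exact: cK.
Qed.

Lemma maximal_clique_no_ext K w :
  maximal_clique G K -> ~ {in K, forall x, adj G w x}.
Proof.
move=> /maxsetP[cK mK] wK; have := mK _ (clique_ext cK wK) (subsetUr _ _).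
move=> E; have wKK : w \in K by rewrite -E !inE eqxx.
by have := wK _ wKK; rewrite adj_irr.
Qed.

Lemma no_ext_maximal_clique K :
  clique G K -> (forall w, ~ {in K, forall x, adj G w x}) -> maximal_clique G K.
Proof.
move=> cK mK; apply/maxsetP; split=> // K' cK' KK'; apply/eqP; rewrite eqEsubset KK' andbT.
apply/subsetP => w wK'; apply/negPn/negP => wK; apply: (mK w) => x xK.
move/cliqueP: cK'; apply=> //; first exact: (subsetP KK').
by apply: contraNneq wK => ->.
Qed.

Lemma chi_le k : clique_colorable G k -> clique_chromatic_number G <= k.
Proof. by rewrite /clique_chromatic_number; case: ex_minnP => m _; apply. Qed.

Definition lone_edge x y := adj G x y && [forall z, ~~ (adj G x z && adj G y z)].
Definition triangle x y z := [&& adj G x y, adj G y z & adj G x z].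

Lemma lone_edge_sym : symmetric lone_edge.
Proof.
move=> x y; rewrite /lone_edge adj_sym; congr (_ && _).
by apply: eq_forallb => z; rewrite andbC.
Qed.

(** A monochromatic maximal clique with a third vertex contains a monochromatic triangle. With two
    vertices only it is an edge that is not lone, and a common neighbour of its ends extends it. *)
Lemma colourable_lone_triangle k (f : {ffun T -> 'I_k}) :
  (forall x y, lone_edge x y -> f x != f y) ->
  (forall x y z, triangle x y z -> ~~ ((f x == f y) && (f y == f z))) ->
  clique_colorable G k.
Proof.
move=> fe ft; apply/existsP; exists f; apply/forallP => K; apply/implyP => /andP[mK].
case/card_gt1P => x [y [xK yK xy]]; apply/negP => /existsP[c /forall_inP fc].
have cK : {in K &, forall x y, x != y -> adj G x y} by apply/cliqueP; case/maxsetP: mK.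
have fE u v : u \in K -> v \in K -> f u == f v.
  by move=> uK vK; rewrite (eqP (fc u uK)) (eqP (fc v vK)).
have xy_adj := cK _ _ xK yK xy.
have [/existsP[z /and3P[zK zx zy]]|no] := boolP [exists z, [&& z \in K, z != x & z != y]].
  have := ft x y z; rewrite /triangle xy_adj !cK //= 1?eq_sym // => /(_ isT).
  by rewrite !fE.
have : ~~ [forall z, ~~ (adj G x z && adj G y z)].
  by apply/negP => h; have := fe x y; rewrite fE // /lone_edge xy_adj h => /(_ isT).
rewrite negb_forall => /existsP[z]; rewrite negbK => /andP[xz yz].
apply: (maximal_clique_no_ext (w := z) mK) => u uK.
have [->|ux] := eqVneq u x; first by rewrite adj_sym.
have [->|uy] := eqVneq u y; first by rewrite adj_sym.
by case/existsP: no; exists u; rewrite uK ux uy.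
Qed.

(** The counting argument without triples, for [b = 1] and [h = d]; hence [d + 2] colours instead of
    the greedy [d + 1]. *)
Lemma chi_le_degree d :
  (forall x, #|[set y | adj G x y]| <= d) -> clique_chromatic_number G <= d + 2.
Proof.
move=> degd.
have [f /proper_onP[fe _]] : exists f : {ffun T -> 'I_(d + 2)},
    proper_on (adj G) (fun _ _ _ => false) [set: T] f.
  apply: (@proper_colouring_exists _ _ _ _ adj_sym _ _ 1 d) => // [|v|v].
  - by rewrite addnC.
  - by apply: leq_trans (degd v); apply/subset_leq_card/subsetP => x; rewrite !inE => /andP[].
  - by rewrite eq_card0 // => u; rewrite !inE !andbF.
apply: chi_le; apply: (colourable_lone_triangle (f := f)) => [x y /andP[xy _]|x y z /and3P[xy _ _]].
  by apply: fe; rewrite ?inE // (adj_neq xy).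
by rewrite negb_and fe ?inE // (adj_neq xy).
Qed.

Lemma chi_le_lone_triangle b h : 0 < b ->
  (forall x, #|[set y | lone_edge x y]| <= h) ->
  (forall x, #|[set u : T * T | triangle x u.1 u.2]| <= b * b) ->
  clique_chromatic_number G <= 2 * b + h.
Proof.
move=> b0 eh tb.
have [f /proper_onP[fe ft]] : exists f : {ffun T -> 'I_(2 * b + h)},
    proper_on lone_edge triangle [set: T] f.
  apply: (@proper_colouring_exists _ _ _ _ lone_edge_sym _ _ b h) => // [x y z|x y z|v|v].
  - by rewrite /triangle => /and3P[xy yz xz]; rewrite yz adj_sym xz adj_sym xy.
  - by rewrite /triangle => /and3P[xy yz xz]; rewrite xz adj_sym yz xy.
  - by apply: leq_trans (eh v); apply/subset_leq_card/subsetP => x; rewrite !inE => /andP[].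
  - by apply: leq_trans (tb v); apply/subset_leq_card/subsetP => x; rewrite !inE => /and4P[].
apply: chi_le; apply: (colourable_lone_triangle (f := f)) => [x y xy|x y z xyz].
  by apply: fe; rewrite ?inE //; case/andP: xy => /adj_neq.
by apply: ft; rewrite ?inE //; case/and3P: (xyz) => /adj_neq ? /adj_neq ? /adj_neq.
Qed.

(* Colour each vertex by the index of a neighbour among the [v i]; this neighbour
   extends every clique of that colour. *)
Lemma chi_le_dominating k (v : 'I_k -> T) :
  (forall x, exists i, adj G x (v i)) -> clique_chromatic_number G <= k.
Proof.
move=> dom; apply: chi_le; have [i0 _|T0] := pickP (mem [set: T]); last first.
  apply/existsP.
  have f : {ffun T -> 'I_k} by apply: finfun => x; have := T0 x; rewrite !inE.
  by exists f; apply/forallP => K; apply/implyP => /andP[_ /card_gt1P[x _]]; have := T0 x; rewrite !inE.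
have [i1 _] := dom i0.
apply/existsP; exists [ffun x => odflt i1 [pick i | adj G x (v i)]].
apply/forallP => K; apply/implyP => /andP[mK _]; apply/negP => /existsP[c /forall_inP fc].
apply: (maximal_clique_no_ext (w := v c) mK) => x xK.
have := fc x xK; rewrite ffunE; case: pickP => [i xi /eqP <-|no]; first by rewrite adj_sym.
by have [i xi] := dom x; rewrite no in xi.
Qed.

(* Every clique containing [K] lies in [A], so [A] contains a maximal clique. *)
Definition closed_clique A K := [&& K \subset A, clique G K, 1 < #|K| &
  [forall w, [forall x in K, adj G w x] ==> (w \in A)]].

Lemma closed_clique_not_mono k (f : {ffun T -> 'I_k}) A K c :
  clique_coloring G f -> closed_clique A K -> {in A, forall x, f x = c} -> False.
Proof.
move=> fG /and4P[KA cK K1 /forallP Kcl] fA.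
have [K' KK' /andP[K'c K'm]] : exists2 K' : {set T}, K \subset K' & (clique G K' && (K' \subset A))
    && [forall w in A, ~~ [forall x in K', adj G w x]].
  have [K' /maxsetP[/andP[cK' K'A] mK'] KK'] :=
    @maxset_exists T (fun B => clique G B && (B \subset A)) K (introT andP (conj cK KA)).
  exists K' => //; rewrite cK' K'A; apply/forall_inP => w wA; apply/negP => /forall_inP wK'.
  have := mK' (w |: K'); rewrite clique_ext // subUset sub1set wA K'A subsetUr => /(_ isT isT) E.
  by have := wK' w; rewrite -{1}E !inE eqxx adj_irr => /(_ isT).
case/andP: K'c => cK' K'A.
have mK' : maximal_clique G K'.
  apply: no_ext_maximal_clique => // w wK'.
  have wA : w \in A.
    apply: (implyP (Kcl w)); apply/forall_inP => x xK; apply: wK'; exact: (subsetP KK').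
  by move/forall_inP: K'm => /(_ w wA)/negP; apply; apply/forall_inP.
move/forallP/(_ K'): fG; rewrite mK' (leq_trans K1) ?subset_leq_card //= => /negP; apply.
by apply/existsP; exists c; apply/forall_inP => x /(subsetP K'A)/fA ->.
Qed.

Lemma chi_ge_closed_clique s : 0 < s ->
  (forall A, #|A| = s -> exists K, closed_clique A K) ->
  #|T| <= clique_chromatic_number G * s.
Proof.
move=> s0 hA; rewrite /clique_chromatic_number; case: ex_minnP => k /existsP[f fG] _.
have -> : #|T| = \sum_(c < k) #|[set x | f x == c]|.
  rewrite -sum1_card (partition_big f xpredT) //=; apply: eq_bigr => c _.
  by rewrite -sum1_card; apply: eq_bigl => x; rewrite inE.
rewrite -[X in X * _](card_ord k) -sum_nat_const; apply: leq_sum => c _.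
rewrite leqNgt; apply/negP => /ltnW sc.
have [A /andP[Ac /eqP As]] : exists A, (A \subset [set x | f x == c]) && (#|A| == s).
  have [B] : exists B, B \in [set B : {set T} | B \subset [set x | f x == c] & #|B| == s].
    by apply/set0Pn; rewrite -card_gt0 cards_draws bin_gt0.
  by rewrite inE; exists B.
have [K /(closed_clique_not_mono (c := c) fG)] := hA A As.
by apply=> x /(subsetP Ac); rewrite inE => /eqP.
Qed.

End CliqueColouringBounds.

(** * Degrees, codegrees and lone edges of the random graph *)

Section RandomAdjacency.
Variables (R : realType) (T : finType) (p : R).
Hypotheses (p0 : 0 <= p) (p1 : p <= 1).
Implicit Types (G S : graph T) (D : {set vpair T}) (x y z u v w : T) (A K W : {set T}).

(** The edges from [w] to [K]. Events at distinct vertices outside [K] read disjoint stars, which is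
    the source of nearly all independence below. *)
Definition star w K : {set vpair T} := [set e | [exists u in K, val e == [set w; u]]].

Lemma in_star w K (e : vpair T) :
  reflect (exists2 u, u \in K & val e = [set w; u]) (e \in star w K).
Proof.
rewrite inE; apply: (iffP exists_inP) => [[u uK /eqP eu]|[u uK eu]]; exists u => //.
exact/eqP.
Qed.

Definition vpair_of x y (xy : x != y) : vpair T :=
  Sub [set x; y] (introT eqP (etrans (cards2 x y) (congr1 (fun b : bool => b.+1) xy))).

Lemma adjE G x y (xy : x != y) : adj G x y = (vpair_of xy \in G).
Proof.
apply/existsP/idP => [[e /andP[eG /eqP exy]]|h].
  by suff -> : vpair_of xy = e by []; apply: val_inj; rewrite /= exy.
by exists (vpair_of xy); rewrite h /=.
Qed.

Lemma mem_star w u K : w \notin K -> u \in K -> forall wu : w != u, vpair_of wu \in star w K.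
Proof. by move=> wK uK wu; apply/in_star; exists u. Qed.

Lemma star_disjoint w w' K K' : w != w' -> w \notin K' -> [disjoint star w K & star w' K'].
Proof.
move=> ww wK; apply/pred0P => e; apply/negbTE/negP => /andP[/in_star[u uK eu] /in_star[u' uK' eu']].
have : w \in [set w'; u'] by rewrite -eu' eu !inE eqxx.
by rewrite !inE (negPf ww) /= => /eqP wu; rewrite wu uK' in wK.
Qed.

Lemma star_disjointK w K K' : w \notin K -> w \notin K' -> [disjoint K & K'] ->
  [disjoint star w K & star w K'].
Proof.
move=> wK wK' /pred0P KK'; apply/pred0P => e; apply/negbTE/negP => /andP[/in_star[u uK eu] /in_star[u' uK' eu']].
have : u \in [set w; u'] by rewrite -eu' eu !inE eqxx orbT.
rewrite !inE => /orP[/eqP uw|/eqP uu]; first by rewrite -uw uK in wK.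
by have := KK' u; rewrite /= uK uu uK'.
Qed.

Lemma card_star w K : w \notin K -> #|star w K| = #|K|.
Proof.
move=> wK.
have wu u : u \in K -> w != u by move=> uK; apply: contraNneq wK => ->.
rewrite -(card_imset _ val_inj) -(card_in_imset (f := fun u => [set w; u]) (D := K)).
  apply: eq_card => B; apply/imsetP/imsetP => [[e /in_star[u uK eu] ->]|[u uK ->]].
    by exists u.
  by exists (vpair_of (wu u uK)) => //; apply/in_star; exists u.
move=> u u' uK uK' E; have : u \in [set w; u'] by rewrite -E !inE eqxx orbT.
by rewrite !inE eq_sym (negPf (wu u uK)) => /eqP.
Qed.

Lemma adj_agree S G D x y : {in D, S =i G} ->
  (forall xy : x != y, vpair_of xy \in D) -> adj S x y = adj G x y.
Proof.
move=> SG xyD; have [->|xy] := eqVneq x y; first by rewrite !adj_irr.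
by rewrite !(adjE _ xy) SG.
Qed.

Lemma dep_star (U : Type) w K (f : graph T -> U) : w \notin K ->
  (forall S G, {in K, adj S w =1 adj G w} -> f S = f G) -> dep (star w K) f.
Proof.
move=> wK h; apply: dep_in => S G SG; apply: h => u uK.
by apply: (adj_agree SG) => wu; apply: mem_star.
Qed.

Lemma Pr_all_adj w K : w \notin K ->
  Pr p (fun G => [forall u in K, adj G w u]) = p ^+ #|K|.
Proof.
move=> wK; rewrite -(card_star wK) -Pr_sub; apply: eq_Pr => G.
apply/forall_inP/subsetP => [h e /in_star[u uK eu]|h u uK].
  have wu : w != u by apply: contraNneq wK => ->.
  have := h u uK; rewrite (adjE _ wu).
  by suff -> : vpair_of wu = e by []; apply: val_inj; rewrite /= eu.
have wu : w != u by apply: contraNneq wK => ->.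
by rewrite (adjE _ wu); apply: h; apply: mem_star.
Qed.

Lemma Pr_no_adj w K : w \notin K ->
  Pr p (fun G => [forall u in K, ~~ adj G w u]) = (1 - p) ^+ #|K|.
Proof.
move=> wK; rewrite -(card_star wK) -Pr_disj; apply: eq_Pr => G.
apply/forall_inP/pred0P => [h e|h u uK].
  apply/negbTE/negP => /andP[/in_star[u uK eu] eG].
  have wu : w != u by apply: contraNneq wK => ->.
  have := h u uK; rewrite (adjE _ wu).
  suff -> : vpair_of wu = e by move=> /negP; apply.
  by apply: val_inj; rewrite /= eu.
have wu : w != u by apply: contraNneq wK => ->.
rewrite (adjE _ wu); apply/negP => eG.
by have := h (vpair_of wu); rewrite /= eG mem_star.
Qed.

Lemma Pr_adj w u : w != u -> Pr p (fun G => adj G w u) = p.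
Proof.
move=> wu; transitivity (Pr p (fun G => [forall x in [set u], adj G w x])); last first.
  by rewrite Pr_all_adj ?inE // cards1 expr1.
apply: eq_Pr => G; apply/idP/forall_inP => [h x /set1P->//|]; apply; exact: set11.
Qed.

Definition nbrs G x W := [set y in W | adj G x y].

Lemma degree_upper x W (l r m : R) : 0 < l <= 1 / 2 -> p * #|W|%:R <= m ->
  Pr p (fun G => m * (1 + 2 * l) + r / l <= #|nbrs G x W|%:R) <= expR (- r).
Proof.
move=> hl hm.
have dD : forall y z, y \in W :\ x -> z \in W :\ x -> y != z -> [disjoint star y [set x] & star z [set x]].
  by move=> y z; rewrite !inE => /andP[yx _] _ yz; apply: star_disjoint; rewrite // inE.
have XD y : y \in W :\ x -> dep (star y [set x]) (fun G => adj G y x).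
  rewrite !inE => /andP[yx _]; apply: dep_star; first by rewrite inE.
  by move=> S G; apply; rewrite inE.
have := chernoff_upper p0 p1 dD XD (l := l) (q := p) (m := m) r.
move=> h; apply: le_trans (h _ hl _).
- apply: le_Pr => // G /le_trans; apply; rewrite ler_nat; apply/subset_leq_card/subsetP => y.
  by rewrite !inE => /andP[yW xy]; rewrite yW adj_sym xy (adj_neq (G := G)) // adj_sym.
- by move=> y; rewrite !inE => /andP[yx _]; rewrite Pr_adj.
- apply: le_trans hm; rewrite ler_wpM2l // ler_nat; apply/subset_leq_card/subsetP => y.
  by rewrite !inE => /andP[].
Qed.

Definition codegree G x y := #|[set z | adj G x z && adj G y z]|.

Lemma codegree_upper x y (l r m : R) : x != y -> 0 < l <= 1 / 2 -> p ^+ 2 * #|T|%:R <= m ->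
  Pr p (fun G => m * (1 + 2 * l) + r / l <= (codegree G x y)%:R) <= expR (- r).
Proof.
move=> xy hl hm; pose B := [set x; y].
have dD : forall w z, w \in ~: B -> z \in ~: B -> w != z -> [disjoint star w B & star z B].
  by move=> w z; rewrite inE => wB _ wz; apply: star_disjoint.
have XD w : w \in ~: B -> dep (star w B) (fun G => [forall u in B, adj G w u]).
  rewrite inE => wB; apply: dep_star => // S G SG.
  by apply/forall_inP/forall_inP => h u uB; have := h u uB; rewrite SG.
have := chernoff_upper p0 p1 dD XD (l := l) (q := p ^+ 2) (m := m) r.
move=> h; apply: le_trans (h _ hl _).
- apply: le_Pr => // G /le_trans; apply; rewrite ler_nat; apply/subset_leq_card/subsetP => z.
  rewrite inE => /andP[xz yz]; rewrite !inE negb_or !(eq_sym z) (adj_neq xz) (adj_neq yz) /=.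
  by apply/forall_inP => u; rewrite !inE => /orP[]/eqP->; rewrite adj_sym.
- by move=> w; rewrite inE => wB; rewrite Pr_all_adj // cards2 xy.
- by apply: le_trans hm; rewrite ler_wpM2l ?exprn_ge0 // ler_nat max_card.
Qed.

Lemma degree_ge_prob (c : R) :
  Pr p (fun G => [exists x, 2 * (p * #|T|%:R) + 2 * c <= #|[set y | adj G x y]|%:R])
    <= #|T|%:R * expR (- c).
Proof.
apply: (Pr_exists_le p0 p1) => x.
have h := @degree_upper x [set: T] (1 / 2) c (p * #|T|%:R).
apply: le_trans (h _ _); rewrite ?cardsT //; last lra.
apply: le_Pr => // G; rewrite /nbrs (_ : [set y in [set: T] | _] = [set y | adj G x y]).
  by move=> k; apply: le_trans k; lra.
by apply/setP => y; rewrite !inE.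
Qed.

Lemma codegree_ge_prob (c : R) :
  Pr p (fun G => [exists u : T * T, (u.1 != u.2) &&
      (2 * (p ^+ 2 * #|T|%:R) + 2 * c <= (codegree G u.1 u.2)%:R)])
    <= #|T|%:R ^+ 2 * expR (- c).
Proof.
rewrite -natrX -mulnn -card_prod; apply: (Pr_exists_le p0 p1) => -[x y] /=.
have [->|xy] := eqVneq x y.
  by rewrite (eq_Pr p (B := fun=> false)) // Pr_pred0 expR_ge0.
have h := @codegree_upper x y (1 / 2) c (p ^+ 2 * #|T|%:R) xy.
apply: le_trans (h _ _) => //; last lra.
by apply: le_Pr => // G /= k; apply: le_trans k; lra.
Qed.

(* If all elements of [K] are lone neighbours of [v], then [lone_star v K]; triangles
   inside [v |: K] are ignored, which keeps the probability a product. *)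
Definition lone_star v K G := [forall u in K, adj G v u] &&
  [forall w in ~: (v |: K), ~~ (adj G w v && [exists u in K, adj G w u])].

(** The stars of the vertices [w] outside [v |: K] are disjoint from one another and from the star
    of [v]; each [w] is adjacent to [v] and to some vertex of [K] with probability
    [p * (1 - (1 - p) ^+ #|K|)]. *)
Lemma Pr_lone_star v K : v \notin K -> Pr p (lone_star v K)
  = p ^+ #|K| * (1 - p * (1 - (1 - p) ^+ #|K|)) ^+ (#|T| - 1 - #|K|).
Proof.
move=> vK; pose X w G := ~~ (adj G w v && [exists u in K, adj G w u]).
have dX w : w \in ~: (v |: K) -> dep (star w (v |: K)) (X w).
  rewrite inE => wK; apply: dep_star => // S G SG; rewrite /X SG ?inE ?eqxx //; congr (~~ (_ && _)).
  by apply: eq_existsb => u; case: (boolP (u \in K)) => //= uK; rewrite SG // !inE uK orbT.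
have PX w : w \in ~: (v |: K) -> Pr p (X w) = 1 - p * (1 - (1 - p) ^+ #|K|).
  rewrite !inE negb_or => /andP[wv wK]; rewrite Pr_not; congr (1 - _).
  transitivity (Pr p (fun G => adj G w v) * Pr p (fun G => ~~ [forall u in K, ~~ adj G w u])).
    2: by rewrite Pr_adj // Pr_not Pr_no_adj.
  rewrite /Pr -(@Ex_indep _ _ p (star w [set v]) (star w K)).
  - apply: eq_Ex => G; rewrite -natrM mulnb; congr (_%:R); congr nat_of_bool; congr (_ && _).
    by rewrite negb_forall; apply: eq_existsb => u; rewrite negb_imply negbK.
  - by apply: star_disjointK; rewrite ?inE // disjoints_subset sub1set inE.
  - by apply: dep_star; rewrite ?inE // => S G ->; rewrite ?inE.
  - apply: dep_star => // S G SG; congr (_%:R); congr (nat_of_bool (~~ _)).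
    by apply: eq_forallb => u; case: (boolP (u \in K)) => //= uK; rewrite SG.
rewrite -(Pr_all_adj vK) /Pr.
have -> : (1 - p * (1 - (1 - p) ^+ #|K|)) ^+ (#|T| - 1 - #|K|)
    = \prod_(w in ~: (v |: K)) Ex p (fun G => (X w G)%:R).
  rewrite (eq_bigr (fun=> 1 - p * (1 - (1 - p) ^+ #|K|))); last by move=> w /PX.
  by rewrite prodr_const; congr (_ ^+ _); have := cardsCs (v |: K); have := cardsC (v |: K); rewrite cardsU1 vK; lia.
rewrite -(Ex_indep_prod p (D := fun w => star w (v |: K))).
- rewrite -(@Ex_indep _ _ p (star v K) (\bigcup_(w in ~: (v |: K)) star w (v |: K))).
  + apply: eq_Ex => G; rewrite /lone_star -mulnb natrM; congr (_ * _).
    case: (boolP [forall w in _, _]) => [/forall_inP h|].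
      by rewrite big1 // => w wK; rewrite /X h.
    rewrite negb_forall => /existsP[w]; rewrite negb_imply => /andP[wK nX].
    by rewrite (bigD1 w) //= /X (negPf nX) mul0r.
  + apply/pred0P => e; apply/negbTE/negP => /andP[e1 /bigcupP[w]]; rewrite inE => wK.
    have : [disjoint star v K & star w (v |: K)].
      rewrite disjoint_sym; apply: star_disjoint.
        by apply: contraNneq wK => ->; rewrite !inE eqxx.
      by apply: contraNN wK => wK'; rewrite !inE wK' orbT.
    by move=> /pred0P/(_ e)/=; rewrite (e1 : e \in star v K) /= => ->.
  + apply: dep_star => // S G SG; congr (_%:R); congr nat_of_bool.
    by apply: eq_forallb => u; case: (boolP (u \in K)) => //= uK; rewrite SG.
  + apply: dep_in => S G SG; apply: eq_bigr => w wK; congr (_%:R); congr nat_of_bool.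
    apply: (dep_eq (dX w wK)) => e ew; apply: SG; apply/bigcupP; exists w => //.
- by move=> w w' wK _ ww; apply: star_disjoint => //; move: wK; rewrite inE.
- by move=> w wK; apply: (dep_comp (fun b : bool => b%:R)); exact: dX.
Qed.

(** Lone edges at [v] are not independent, so a binomial moment replaces the exponential one: [m]
    lone neighbours contain ['C(m, k)] sets [K] with [lone_star v K]. *)
Lemma lone_count v k m :
  Pr p (fun G => m <= #|[set y | lone_edge G v y]|)%N * 'C(m, k)%:R
    <= 'C(#|T|, k)%:R * (p ^+ k * (1 - p * (1 - (1 - p) ^+ k)) ^+ (#|T| - 1 - k)).
Proof.
pose Fam := [set K : {set T} | (v \notin K) && (#|K| == k)].
apply: (@le_trans _ _ (\sum_(K in Fam) Pr p (lone_star v K))).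
  rewrite -Ex_sum mulrC -ExZ; apply: le_Ex => // G.
  case: (leqP m) => mG; last by rewrite mulr0 sumr_ge0 // => K _; rewrite ler0n.
  rewrite -natrM muln1 -natr_sum ler_nat.
  apply: (@leq_trans #|[set K : {set T} | (K \subset [set y | lone_edge G v y]) & (#|K| == k)]|).
    by rewrite cards_draws leq_bin2l.
  rewrite -sum1_card big_mkcond [leqRHS]big_mkcond; apply: leq_sum => K _.
  rewrite !inE; case: ifP => // /andP[/subsetP sK Kk].
  have vK : v \notin K by apply/negP => /sK; rewrite inE => /andP[]; rewrite adj_irr.
  rewrite vK Kk /= lt0b; apply/andP; split.
    by apply/forall_inP => u /sK; rewrite inE => /andP[].
  apply/forall_inP => w _; apply/negP => /andP[wv /exists_inP[u uK wu]].
  have := sK u uK; rewrite inE => /andP[_ /forallP/(_ w)/negP]; apply.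
  by rewrite adj_sym wv adj_sym.
rewrite (eq_bigr (fun=> p ^+ k * (1 - p * (1 - (1 - p) ^+ k)) ^+ (#|T| - 1 - k))).
  rewrite sumr_const -[leLHS]mulr_natl ler_wpM2r //.
    rewrite mulr_ge0 ?exprn_ge0 // subr_ge0.
    have : 0 <= (1 - p) ^+ k by rewrite exprn_ge0 // subr_ge0.
    by have := p0; have := p1; nra.
  rewrite ler_nat -card_draws; apply/subset_leq_card/subsetP => K; rewrite !inE => /andP[] //.
by move=> K; rewrite inE => /andP[vK /eqP Kk]; rewrite Pr_lone_star // Kk.
Qed.

End RandomAdjacency.

(** * Upper bounds for the random graph *)

Section UpperBounds.
Variables (R : realType) (T : finType) (p : R).
Hypotheses (p0 : 0 <= p) (p1 : p <= 1).
Implicit Types (G : graph T) (x y z u v w : T) (K : {set T}).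

Lemma chi_le_real (G : graph T) (d : R) : 0 <= d ->
  (forall x, #|[set y | adj G x y]|%:R < d) -> (clique_chromatic_number G)%:R <= d + 2 :> R.
Proof.
move=> d0 hd.
have h : (clique_chromatic_number G <= Num.truncn d + 2)%N.
  by apply: chi_le_degree => x; rewrite -ltnS -(ltr_nat R); apply: lt_trans (hd x) (truncnS_gt d).
apply: (@le_trans _ _ (Num.truncn d + 2)%:R); first by rewrite ler_nat.
by rewrite natrD lerD2r truncn_le.
Qed.

Lemma chi_prob_degree (L : R) : 0 <= L ->
  Pr p (fun G => 2 * (p * #|T|%:R) + 4 * L + 2 < (clique_chromatic_number G)%:R)
    <= #|T|%:R * expR (- (2 * L)).
Proof.
move=> L0; apply: le_trans (@degree_ge_prob R T p p0 p1 (2 * L)); apply: le_Pr => // G.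
apply: contraTT => /existsPn h; rewrite -leNgt.
have pT : 0 <= p * #|T|%:R by rewrite mulr_ge0.
have e : 4 * L = 2 * (2 * L) by ring.
apply: chi_le_real => [|x]; first lra.
by rewrite ltNge e; exact: h.
Qed.

(** The candidate vertices are fixed in advance. The exponent has [k.-1] because [x] may be one of
    them and must be dominated by another vertex. *)
Lemma chi_prob_dominating k : (0 < k <= #|T|)%N ->
  Pr p (fun G => k < clique_chromatic_number G)%N <= #|T|%:R * expR (- (p * (k.-1)%:R)).
Proof.
move=> /andP[k0 kT]; pose v (i : 'I_k) : T := enum_val (widen_ord kT i).
pose V := [set v i | i in 'I_k].
have cV : #|V| = k.
  rewrite card_imset ?card_ord // => i j /enum_val_inj E; apply: val_inj.
  by have := congr1 val E.
apply: (@le_trans _ _ (Pr p (fun G => [exists x, [forall u in V :\ x, ~~ adj G x u]]))).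
  apply: le_Pr => // G; apply: contraTT => /existsPn h; rewrite -leqNgt.
  apply: (chi_le_dominating (v := v)) => x.
  have := h x; rewrite negb_forall => /existsP[u]; rewrite negb_imply negbK.
  by move=> /andP[]; rewrite !inE => /andP[ux /imsetP[i _ ->]] xi; exists i.
apply: (Pr_exists_le p0 p1) => x; rewrite Pr_no_adj //; last by rewrite !inE eqxx.
have q0 : 0 <= 1 - p by rewrite subr_ge0.
apply: (@le_trans _ _ ((1 - p) ^+ k.-1)).
  rewrite ler_wiXn2l //; first by have := p0; lra.
  by rewrite -cV (cardsD1 x V); case: (x \in V); rewrite ?leq_pred.
rewrite -mulNr expRM_natr; apply: lerXn2r; rewrite ?nnegrE ?expR_ge0 //.
exact: expR_ge1Dx.
Qed.

Lemma triangle_card G x (d1 d2 : R) : 0 <= d2 ->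
  #|[set y | adj G x y]|%:R <= d1 ->
  (forall y, x != y -> (codegree G x y)%:R <= d2) ->
  #|[set u : T * T | triangle G x u.1 u.2]|%:R <= d1 * d2.
Proof.
move=> d20 hd1 hd2.
apply: (@le_trans _ _ (\sum_(y in [set y | adj G x y]) d2)); last first.
  by rewrite sumr_const -mulr_natl ler_wpM2r.
rewrite -sum1_card (reindex_onto (fun u : T * T => u) id) //= natr_sum.
rewrite (eq_bigl (fun u : T * T => (u.1 \in [set y | adj G x y]) && triangle G x u.1 u.2)); last first.
  by move=> [y z]; rewrite !inE /= eqxx andbT /triangle; case: (adj G x y).
rewrite -(pair_big_dep (mem [set y | adj G x y]) (fun y z => triangle G x y z) (fun _ _ => 1)) /=.
apply: ler_sum => y; rewrite inE => xy.
apply: le_trans (hd2 y (adj_neq xy)); rewrite sumr_const ler_nat.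
by apply/subset_leq_card/subsetP => z; rewrite unfold_in inE => /and3P[_ -> ->].
Qed.

Lemma chi_le_triangle_real G (d1 d2 : R) m : 0 <= d1 -> 0 <= d2 ->
  (forall x, #|[set y | adj G x y]|%:R <= d1) ->
  (forall x y, x != y -> (codegree G x y)%:R <= d2) ->
  (forall x, #|[set y | lone_edge G x y]| <= m)%N ->
  (clique_chromatic_number G)%:R <= 2 * Num.sqrt (d1 * d2) + 2 + m%:R :> R.
Proof.
move=> d10 d20 h1 h2 h3; set s := Num.sqrt _.
have s0 : 0 <= s by exact: sqrtr_ge0.
have st := truncnS_gt s.
have h : (clique_chromatic_number G <= 2 * (Num.truncn s).+1 + m)%N.
  apply: chi_le_lone_triangle => // x; rewrite -(ler_nat R) natrM.
  apply: le_trans (triangle_card d20 (h1 x) (h2 x)) _.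
  rewrite -[leLHS]sqr_sqrtr ?mulr_ge0 // -/s expr2.
  by apply: ler_pM => //; apply: ltW.
apply: (@le_trans _ _ (2 * (Num.truncn s).+1 + m)%:R); first by rewrite ler_nat.
rewrite natrD lerD2r natrM -natr1; have := truncn_le s; rewrite s0 => h'; lra.
Qed.

Lemma ffact_le_exp n k : (n ^_ k <= n ^ k)%N.
Proof.
rewrite ffact_prod -[X in (_ <= _ ^ X)%N](card_ord k) -prod_nat_const.
by apply: leq_prod => i _; rewrite leq_subr.
Qed.

Lemma exp_le_ffact n k : ((n - k) ^ k <= n ^_ k)%N.
Proof.
rewrite ffact_prod -[X in ((_ - _) ^ X <= _)%N](card_ord k) -prod_nat_const.
by apply: leq_prod => i _; rewrite leq_sub2l // ltnW.
Qed.

(** [lone_count] at [m = b.+1 * k]. The quotient of falling factorials is at most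
    [(N / (b * k)) ^+ k], and the outer vertices contribute [expR (k * (2 - p ^+ 2 * N))], the 2
    absorbing the second order errors by the last hypothesis. The hypothesis on [k] then cancels
    [p * N * expR (- (p ^+ 2 * N))] against [k]. *)
Lemma lone_degree_prob k b : (0 < k)%N -> (0 < b)%N ->
  p * #|T|%:R * expR (- (p ^+ 2 * #|T|%:R)) <= k%:R ->
  k.+1%:R * p ^+ 2 + #|T|%:R * k%:R * p ^+ 3 <= 2 ->
  Pr p (fun G => [exists v, (b.+1 * k <= #|[set y | lone_edge G v y]|)%N])
    <= #|T|%:R * (expR 2 / b%:R) ^+ k.
Proof.
move=> k0 b0 hk hp; apply: (Pr_exists_le p0 p1) => v.
set N := #|T|%:R in hk hp; set P := Pr _ _; pose M := (#|T| - 1 - k)%N.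
have N0 : 0 <= N by rewrite ler0n.
have P0 : 0 <= P by exact: Pr_ge0.
have key : P * (b * k)%:R ^+ k <= N ^+ k * (p ^+ k * (1 - p * (1 - (1 - p) ^+ k)) ^+ M).
  have := lone_count p0 p1 v k (b.+1 * k); rewrite -/P -/M => h.
  set rho := p ^+ k * _ in h *.
  have rho0 : 0 <= rho.
    rewrite mulr_ge0 ?exprn_ge0 // subr_ge0.
    have : 0 <= (1 - p) ^+ k by rewrite exprn_ge0 // subr_ge0.
    by have := p0; have := p1; nra.
  have h2 : P * ((b.+1 * k) ^_ k)%:R <= (#|T| ^_ k)%:R * rho.
    by rewrite -!bin_ffact !natrM (mulrA P) (mulrAC _ _ rho) ler_wpM2r.
  apply: (@le_trans _ _ (P * ((b.+1 * k) ^_ k)%:R)).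
    rewrite ler_wpM2l // -natrX ler_nat; apply: leq_trans (exp_le_ffact _ _).
    by rewrite mulSn addKn.
  by apply: le_trans h2 _; rewrite ler_wpM2r // -natrX ler_nat ffact_le_exp.
have rho_le : (1 - p * (1 - (1 - p) ^+ k)) ^+ M <= expR (k%:R * (2 - p ^+ 2 * N)).
  have e1 : (1 - p) ^+ k <= 1 - k%:R * p + (k%:R * p) ^+ 2.
    apply: le_trans (expRN_le_quad _); last by rewrite mulr_ge0.
    rewrite -mulrN mulrC expRM_natr; apply: lerXn2r; rewrite ?nnegrE ?expR_ge0 ?subr_ge0 //.
    exact: expR_ge1Dx.
  apply: (@le_trans _ _ (expR (- (p * (k%:R * p - (k%:R * p) ^+ 2))) ^+ M)).
    apply: lerXn2r; rewrite ?nnegrE ?expR_ge0 //.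
      have : 0 <= (1 - p) ^+ k by rewrite exprn_ge0 // subr_ge0.
      by have := p0; have := p1; nra.
    apply: le_trans (expR_ge1Dx _); rewrite lerD2l lerN2 ler_wpM2l //; lra.
  rewrite -expRM_natr ler_expR.
  have kk : 0 < k%:R :> R by rewrite ltr0n.
  have -> : - (p * (k%:R * p - (k%:R * p) ^+ 2)) * M%:R = k%:R * (- (p ^+ 2 * M%:R) + k%:R * p ^+ 3 * M%:R) by ring.
  rewrite ler_pM2l //.
  have MN : M%:R <= N by rewrite ler_nat /M; lia.
  have MN2 : N - k.+1%:R <= M%:R.
    by rewrite lerBlDr -natrD ler_nat /M; lia.
  have p20 : 0 <= p ^+ 2 by rewrite exprn_ge0.
  have kp3 : 0 <= k%:R * p ^+ 3 by rewrite mulr_ge0 // exprn_ge0.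
  have a1 := ler_wpM2l kp3 MN; have a2 := ler_wpM2l p20 MN2.
  by lra.
have bk0 : 0 < (b * k)%:R :> R by rewrite ltr0n muln_gt0 b0.
have : P * (b * k)%:R ^+ k <= (k%:R * expR 2) ^+ k.
  apply: le_trans key _; rewrite mulrA -exprMn.
  apply: (@le_trans _ _ ((N * p) ^+ k * expR (k%:R * (2 - p ^+ 2 * N)))).
    by rewrite ler_wpM2l // exprn_ge0 // mulr_ge0.
  rewrite expRM_natl -exprMn; apply: lerXn2r; rewrite ?nnegrE ?mulr_ge0 ?expR_ge0 //.
  rewrite expRD mulrCA -mulrA [leRHS]mulrC ler_wpM2l ?expR_ge0 //.
  by rewrite mulrA (mulrC N).
rewrite -ler_pdivlMr ?exprn_gt0 // -expr_div_n natrM.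
have -> // : k%:R * expR 2 / (b%:R * k%:R) = expR 2 / b%:R :> R.
by field; rewrite !pnatr_eq0 -!lt0n b0.
Qed.

End UpperBounds.

(** * Cliques without common neighbour outside a set *)

Section OpenCliques.
Variables (R : realType) (T : finType) (p : R).
Hypotheses (p0 : 0 <= p) (p1 : p <= 1).
Implicit Types (G S : graph T) (x y z u v w : T) (A K W : {set T}).

Definition inner K : {set vpair T} := [set e : vpair T | val e \subset K].

Lemma card_inner K : #|inner K| = 'C(#|K|, 2).
Proof.
rewrite -cards_draws -(card_imset _ val_inj); apply: eq_card => B; rewrite !inE.
apply/imsetP/andP => [[e]|[BK B2]]; first by rewrite inE => eK ->; split=> //; exact: (valP e).
by exists (Sub B B2) => //; rewrite inE.
Qed.

Lemma innerI K K' : inner K :&: inner K' = inner (K :&: K').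
Proof. by apply/setP => e; rewrite !inE subsetI. Qed.

Lemma clique_inner G K : clique G K = (inner K \subset G).
Proof.
apply/cliqueP/subsetP => [h e|h x y xK yK xy].
  rewrite inE => eK; have /cards2P[x [y [xy exy]]] := valP e.
  have := h x y; rewrite !(subsetP eK) ?exy ?inE ?eqxx ?orbT // => /(_ isT isT xy).
  by rewrite (adjE _ xy); suff -> : vpair_of xy = e by []; apply: val_inj; rewrite /= exy.
rewrite (adjE _ xy); apply: h; rewrite inE /=.
by apply/subsetP => u; rewrite !inE => /orP[]/eqP->.
Qed.

Lemma exp_le_bin a k : (2 * k <= a)%N -> a%:R ^+ k <= (2 ^ k * k`!)%:R * 'C(a, k)%:R :> R.
Proof.
move=> ka; rewrite -natrX -natrM ler_nat -mulnA (mulnC k`!) bin_ffact.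
apply: (@leq_trans (2 ^ k * (a - k) ^ k)).
  by rewrite -expnMn; case: k ka => // k ka; rewrite leq_exp2r //; lia.
by rewrite leq_mul2l exp_le_ffact orbT.
Qed.

(** Pairs of cliques are grouped by their intersection. A fixed [I] with [i] vertices has at most
    [a ^ (k - i)] partners, so by the hypothesis for [i] each of the [2 ^ k] groups contributes at
    most [a ^ k * p ^ (2 * e) / Lam]. The family [O] is arbitrary apart from containing half of all
    [k]-subsets, since it will be determined by the edges leaving [A]. *)
Lemma janson_cliques A k (O : {set {set T}}) (Lam : R) :
  (2 <= k)%N -> (2 * k <= #|A|)%N ->
  (forall K, K \in O -> K \subset A /\ #|K| = k) ->
  'C(#|A|, k)%:R / 2 <= #|O|%:R :> R -> 0 < Lam ->
  (forall i, (2 <= i <= k)%N -> Lam <= #|A|%:R ^+ i * p ^+ 'C(i, 2)) ->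
  Pr p (fun G => [forall K in O, ~~ clique G K])
    <= expR (- (Lam / (2 ^ (2 * k + 3) * k`!)%:R)).
Proof.
move=> k2 ka OA Obig Lam0 hLam.
set a := #|A| in ka Obig hLam *; pose e := 'C(k, 2).
have a0 : 0 < a%:R :> R by rewrite ltr0n; lia.
have hk := hLam k; rewrite k2 leqnn in hk; have {}hk := hk isT.
have pe0 : 0 <= p ^+ e by rewrite exprn_ge0.
have pe : 0 < p ^+ e.
  rewrite lt_neqAle pe0 andbT eq_sym; apply/eqP => E.
  by move: hk; rewrite -/e E mulr0 leNgt Lam0.
have pp : 0 < p.
  rewrite lt_neqAle p0 andbT; apply: contraTneq pe => <-.
  by rewrite expr0n -leqn0 leqNgt bin_gt0 k2 ltxx.
have O0 : 0 < #|O|%:R :> R.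
  apply: lt_le_trans Obig; rewrite divr_gt0 // ltr0n bin_gt0; lia.
pose B : R := #|O|%:R * ((2 ^ k)%:R * (a%:R ^+ k * (p ^+ e) ^+ 2 / Lam)).
pose mu : R := #|O|%:R * p ^+ e.
have E1 : mu = \sum_(K in O) p ^+ #|inner K|.
  rewrite /mu (eq_bigr (fun=> p ^+ e)) ?sumr_const ?mulr_natl // => K /OA[_ Kk].
  by rewrite card_inner Kk.
have B0 : 0 < B by rewrite mulr_gt0 // mulr_gt0 ?ltr0n ?expn_gt0 // divr_gt0 // mulr_gt0 // exprn_gt0.
have muB : 0 <= mu <= B.
  rewrite mulr_ge0 //= ler_pM2l //.
  have h : p ^+ e <= a%:R ^+ k * (p ^+ e) ^+ 2 / Lam.
    by rewrite ler_pdivlMr // expr2 mulrA mulrC ler_pM2r.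
  apply: (le_trans h); rewrite ler_peMl //; first exact: le_trans pe0 h.
  by rewrite ler1n expn_gt0.
have hB : \sum_(K in O) \sum_(K' in O) (if [disjoint inner K & inner K'] then 0
     else p ^+ #|inner K :|: inner K'|) <= B.
  rewrite /B mulr_natl -sumr_const; apply: ler_sum => K KO.
  have [KA Kk] := OA K KO.
  rewrite (partition_big (fun K' => K :&: K') (mem (powerset K))) /=; last first.
    by move=> K' _; rewrite inE subsetIl.
  rewrite -Kk -card_powerset mulr_natl -sumr_const; apply: ler_sum => I; rewrite inE => IK.
  pose i := #|I|.
  have ik : (i <= k)%N by rewrite -Kk subset_leq_card.
  have [i2|i2] := leqP 2 i; last first.
    rewrite big1 => [|K' /andP[_ /eqP KI]].
      by rewrite !mulr_ge0 ?invr_ge0 ?exprn_ge0 // ltW.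
    by rewrite -setI_eq0 innerI KI -cards_eq0 card_inner bin_small ?eqxx.
  apply: (@le_trans _ _ (\sum_(K' in O | K :&: K' == I) p ^+ (2 * e - 'C(i, 2)))).
    apply: ler_sum => K' /andP[K'O /eqP KI]; have [K'A K'k] := OA K' K'O.
    case: ifP => _; first by rewrite exprn_ge0.
    by rewrite cardsU innerI KI !card_inner Kk K'k -/e -/i mul2n addnn.
  rewrite sumr_const -[leLHS]mulr_natl.
  have cnt : (#|[pred K' | (K' \in O) && (K :&: K' == I)]|)%:R <= a%:R ^+ (k - i) :> R.
    rewrite -natrX ler_nat; apply: (@leq_trans 'C(a, k - i)); last first.
      by apply: leq_trans (ffact_le_exp _ _); rewrite -bin_ffact leq_pmulr // fact_gt0.
    rewrite /a -cards_draws -(card_in_imset (f := fun K' => K' :\: I) (D := [pred K' in O | K :&: K' == I])); last first.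
      move=> K1 K2; rewrite !inE => /andP[_ /eqP e1] /andP[_ /eqP e2] E.
      have i1 : K1 :&: I = I by apply/setIidPr; rewrite -e1 subsetIr.
      have i2' : K2 :&: I = I by apply/setIidPr; rewrite -e2 subsetIr.
      by rewrite -[K1](setID _ I) -[K2](setID _ I) i1 i2' E.
    apply/subset_leq_card/subsetP => J /imsetP[K']; rewrite inE => /andP[/OA[K'A K'k] /eqP KI] ->.
    rewrite (subset_trans (subsetDl _ _) K'A) /= cardsD K'k (setIidPr _) //.
    by rewrite -KI subsetIr.
  apply: le_trans (ler_wpM2r (exprn_ge0 _ p0) cnt) _.
  rewrite Kk ler_pdivlMr // -mulrA.
  have iC : ('C(i, 2) <= e)%N by rewrite leq_bin2l.
  have -> : a%:R ^+ k = a%:R ^+ (k - i) * a%:R ^+ i :> R by rewrite -exprD subnK.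
  rewrite -mulrA ler_wpM2l ?exprn_ge0 // -exprM mulnC.
  have -> : p ^+ (e * 2) = p ^+ (e * 2 - 'C(i, 2)) * p ^+ 'C(i, 2).
    by rewrite -exprD subnK // (leq_trans iC) // leq_pmulr.
  rewrite mulrCA ler_wpM2l ?exprn_ge0 //; apply: hLam; by rewrite i2.
have := janson p0 p1 (D := inner) E1 hB muB B0.
move=> h; apply: le_trans (le_trans h _).
  apply: le_Pr => // G; rewrite (eq_forallb (P2 := fun K => (K \in O) ==> ~~ (inner K \subset G))) // => K.
  by rewrite clique_inner.
rewrite ler_expR lerN2.
have -> : mu ^+ 2 / (4 * B) = #|O|%:R * Lam / ((2 ^ (k + 2))%:R * a%:R ^+ k).
  rewrite /mu /B expnD natrM; field.
  have ak0 : 0 < a%:R ^+ k :> R by rewrite exprn_gt0.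
  have tk0 : 0 < (2 ^ k)%:R :> R by rewrite ltr0n expn_gt0.
  by rewrite !lt0r_neq0.
have ak0 : 0 < a%:R ^+ k :> R by rewrite exprn_gt0.
rewrite ler_pdivlMr ?mulr_gt0 ?ltr0n ?expn_gt0 //.
rewrite mulrAC ler_pdivrMr ?ltr0n ?muln_gt0 ?expn_gt0 ?fact_gt0 //.
rewrite (mulrC _ Lam) -!mulrA ler_pM2l //.
have := exp_le_bin ka; rewrite -/a => hb.
have -> : (2 ^ (2 * k + 3) * k`!)%:R = (2 ^ (k + 2))%:R * (2 * (2 ^ k * k`!)%:R) :> R.
  rewrite mul2n -addnn !expnD -[(2 ^ 3)%N]/8%N -[(2 ^ 2)%N]/4%N.
  by move: (2 ^ k)%N (k`!)%N => u v; rewrite !natrM; ring.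
rewrite mulrCA ler_pM2l ?ltr0n ?expn_gt0 //.
apply: le_trans hb _; set c := (2 ^ k * k`!)%:R.
have c0 : 0 < c by rewrite ltr0n muln_gt0 expn_gt0 fact_gt0.
have : c * ('C(a, k)%:R / 2) <= c * #|O|%:R by rewrite ler_pM2l.
by lra.
Qed.

(** Closedness relative to an ambient set [W], which is either the whole vertex set or the common
    neighbourhood of a clique chosen before. *)
Definition unextended G W A K := [forall w in W :\: A, ~~ [forall u in K, adj G w u]].

(* The few vertices with far more neighbours in [A] than expected would spoil a
   first moment bound; their total degree into [A] has exponential moments. *)
Definition heavy G A w : R :=
  if 16 * (#|A|%:R * p) < #|nbrs G w A|%:R then #|nbrs G w A|%:R else 0.

Lemma expR2_le16 : expR 2 <= 16 :> R.
Proof.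
have h : expR (1 / 2) <= 2 :> R.
  by apply: le_trans (expR_le_quad _) _; lra.
have -> : (2 : R) = 4%:R * (1 / 2) by lra.
rewrite expRM_natl (_ : 16 = 2 ^+ 4); last by rewrite -natrX.
by apply: lerXn2r; rewrite ?nnegrE ?expR_ge0.
Qed.

(** If the degree [d] of [w] into [A] exceeds [16 * a * p], then [expR d <= expR (- (16 * a * p)) *
    expR (2 * d)], and the mean of [expR (2 * d)] is at most [expR (15 * a * p)] as [expR 2 <= 16].
    So each vertex contributes a factor at most [1 + expR (- (a * p))], and the hypothesis keeps the
    product below [expR 1]. *)
Lemma heavy_prob W A (c : R) : #|W|%:R * expR (- (#|A|%:R * p)) <= 1 ->
  Pr p (fun G => c <= \sum_(w in W :\: A) heavy G A w) <= expR (1 - c).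
Proof.
set a : R := #|A|%:R => hW.
have h0 G w : 0 <= heavy G A w by rewrite /heavy; case: ifP.
apply: (@le_trans _ _ (Ex p (fun G => expR (\sum_(w in W :\: A) heavy G A w)) / expR c)).
  apply: (Ex_markov p0 p1); [exact: expR_gt0|by move=> G; exact: expR_ge0|].
  by move=> G; rewrite ler_expR.
rewrite expRD expRN ler_wpM2r ?invr_ge0 ?expR_ge0 //.
have hd G w : w \in W :\: A -> forall S, {in A, adj S w =1 adj G w} -> nbrs S w A = nbrs G w A.
  by move=> _ S SG; apply/setP => u; rewrite !inE; case: (boolP (u \in A)) => //= /SG.
rewrite (eq_Ex p (H := fun G => \prod_(w in W :\: A) expR (heavy G A w))); last first.
  by move=> G; rewrite expR_sum.
rewrite (Ex_indep_prod p (D := fun w => star w A)); first last.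
- move=> w; rewrite inE => /andP[wA _]; apply: dep_star => // S G SG.
  by rewrite /heavy (_ : nbrs S w A = nbrs G w A) //; apply/setP => u; rewrite !inE; case: (boolP (u \in A)) => //= /SG.
- by move=> w w'; rewrite !inE => /andP[wA _] _ ww; apply: star_disjoint.
apply: (@le_trans _ _ (\prod_(w in W :\: A) expR (expR (- (a * p))))).
  apply: ler_prod => w; rewrite inE => /andP[wA _]; apply/andP; split.
    by apply: Ex_ge0 => // G; apply: expR_ge0.
  apply: le_trans (expR_ge1Dx _).
  apply: (@le_trans _ _ (Ex p (fun G => 1 + expR (- (16 * (a * p))) * expR (2 * #|nbrs G w A|%:R)))).
    apply: le_Ex => // G; rewrite /heavy -/a; case: ifP => hG.
      rewrite -expRD (@le_trans _ _ (expR (- (16 * (a * p)) + 2 * #|nbrs G w A|%:R))) //.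
        by rewrite ler_expR; lra.
      by rewrite lerDr.
    by rewrite expR0 lerDl mulr_ge0 ?expR_ge0.
  rewrite ExD Ex_cst ExZ lerD2l.
  have dD : forall u v, u \in A -> v \in A -> u != v -> [disjoint star u [set w] & star v [set w]].
    move=> u v uA vA uv; apply: star_disjoint; rewrite // inE.
    by apply: contraNneq wA => <-.
  have XD u : u \in A -> dep (star u [set w]) (fun G => adj G w u).
    move=> uA; have uw : u != w by apply: contraNneq wA => <-.
    by apply: dep_star; [rewrite inE|move=> S G SG; rewrite !(adj_sym _ w) SG // inE].
  have Xq u : u \in A -> Pr p (fun G => adj G w u) <= p.
    by move=> uA; rewrite Pr_adj //; apply: contraNneq wA => ->.
  have := Ex_expR_count_le p0 p1 dD XD (l := 2) Xq.
  have -> : [set i | i \in A] = A by apply/setP => i; rewrite inE.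
  move=> /(_ (ler0n _ _)) h; apply: (le_trans (ler_wpM2l (expR_ge0 _) h)).
  rewrite -expRD ler_expR -/a.
  have := expR2_le16.
  have : 0 <= a * p by rewrite mulr_ge0.
  by rewrite -mulrA (mulrC p); nra.
rewrite prodr_const -expRM_natl ler_expR; apply: le_trans hW.
by rewrite ler_wpM2r ?expR_ge0 // ler_nat; apply/subset_leq_card/subsetDl.
Qed.

(** An extended [K] lies in the neighbourhood of a single [w]. A vertex [w] that is not heavy
    accounts for at most [(16 * a * p) ^ k.+1] sets, a heavy one for [D ^ k] times its degree, and
    the sum of these degrees is under control by [heavy_prob]. *)
Lemma extended_count G W A k (D : R) : 0 <= D ->
  (forall w, w \in W :\: A -> #|nbrs G w A|%:R <= D) ->
  #|[set K : {set T} | [&& K \subset A, #|K| == k.+1 & ~~ unextended G W A K]]|%:R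
    <= #|W|%:R * (16 * (#|A|%:R * p)) ^+ k.+1 + D ^+ k * \sum_(w in W :\: A) heavy G A w.
Proof.
move=> D0 hD.
have ap : 0 <= 16 * (#|A|%:R * p) by rewrite !mulr_ge0.
apply: (@le_trans _ _ (\sum_(w in W :\: A) #|nbrs G w A|%:R ^+ k.+1)).
  apply: (@le_trans _ _ (\sum_(w in W :\: A) 'C(#|nbrs G w A|, k.+1))%:R); last first.
    rewrite natr_sum; apply: ler_sum => w _; rewrite -natrX ler_nat.
    by apply: leq_trans (ffact_le_exp _ _); rewrite -bin_ffact leq_pmulr // fact_gt0.
  rewrite ler_nat (eq_bigr (fun w => #|[set K : {set T} | (K \subset nbrs G w A) & (#|K| == k.+1)]|)).
    2: by move=> w _; rewrite cards_draws.
  apply: leq_trans (card_bigcup_le _ _).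
  apply/subset_leq_card/subsetP => K; rewrite inE => /and3P[KA Kk].
  rewrite negb_forall => /existsP[w]; rewrite negb_imply negbK => /andP[wWA /forall_inP hw].
  apply/bigcupP; exists w => //; rewrite inE Kk andbT; apply/subsetP => u uK.
  by rewrite inE (subsetP KA) // hw.
rewrite mulr_sumr; apply: (@le_trans _ _ (\sum_(w in W :\: A)
    ((16 * (#|A|%:R * p)) ^+ k.+1 + D ^+ k * heavy G A w))).
  apply: ler_sum => w /hD dw; rewrite /heavy; case: ltrP => h.
    rewrite [leLHS]exprSr; apply: (@le_trans _ _ (D ^+ k * #|nbrs G w A|%:R)).
      by rewrite ler_wpM2r //; apply: lerXn2r; rewrite ?nnegrE.
    by rewrite lerDr exprn_ge0.
  by rewrite mulr0 addr0; apply: lerXn2r; rewrite ?nnegrE.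
rewrite big_split /= lerD2r sumr_const -[leLHS]mulr_natl ler_wpM2r ?exprn_ge0 // ler_nat.
exact/subset_leq_card/subsetDl.
Qed.

(** The edges between [A] and [W :\: A] are exposed first; unless the heavy degrees add up to
    [3 * a * L], at least half of all [k.+1]-subsets are unextended, and Janson's inequality is
    applied to these with the edges inside [A]. Each of the two failures has probability at most
    [expR (- (2 * a * L))]. The degree cap [D] is part of the event, so that its failure is not paid
    once for every [A]. *)
Lemma open_clique_prob W A k (D L : R) : (1 <= k)%N -> (2 * k.+1 <= #|A|)%N -> 0 <= D ->
  1 <= #|A|%:R * L ->
  #|W|%:R * expR (- (#|A|%:R * p)) <= 1 ->
  (2 ^ k.+2 * k.+1`!)%:R * (#|W|%:R * (16 * (#|A|%:R * p)) ^+ k.+1 + D ^+ k * (3 * (#|A|%:R * L)))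
    <= #|A|%:R ^+ k.+1 ->
  (forall i, (2 <= i <= k.+1)%N ->
    (2 ^ (2 * k.+1 + 3) * k.+1`!)%:R * (2 * (#|A|%:R * L)) <= #|A|%:R ^+ i * p ^+ 'C(i, 2)) ->
  Pr p (fun G => [forall w in W :\: A, #|nbrs G w A|%:R <= D] &&
     ~~ [exists K : {set T}, [&& K \subset A, #|K| == k.+1, clique G K & unextended G W A K]])
    <= 2 * expR (- (2 * (#|A|%:R * L))).
Proof.
move=> k1 ka D0 aL hW hcount hLam; set a : R := #|A|%:R in aL hW hcount hLam *.
pose Hv G := 3 * (a * L) <= \sum_(w in W :\: A) heavy G A w.
pose Deg G := [forall w in W :\: A, #|nbrs G w A|%:R <= D].
pose NoK G := ~~ [exists K : {set T}, [&& K \subset A, #|K| == k.+1, clique G K & unextended G W A K]].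
apply: (@le_trans _ _ (Pr p Hv + Pr p (fun G => [&& Deg G, NoK G & ~~ Hv G]))).
  apply: le_trans (Pr_or p0 p1 _ _); apply: le_Pr => // G /andP[d n].
  by case: (boolP (Hv G)) => //= hv; rewrite /Deg /NoK d n.
rewrite mulr2n mulrDl mul1r; apply: lerD.
  apply: le_trans (heavy_prob _ hW) _; rewrite ler_expR; lra.
pose Dout := \bigcup_(w in W :\: A) star w A.
apply: (Pr_mix_le p0 p1 (D := Dout)) => S.
pose O := [set K : {set T} | [&& K \subset A, #|K| == k.+1 & unextended S W A K]].
have adjS G w u : w \in W :\: A -> u \in A -> adj (mix Dout S G) w u = adj S w u.
  move=> wWA uA; have [->|wu] := eqVneq w u; first by rewrite !adj_irr.
  rewrite !(adjE _ wu) in_mix (_ : vpair_of wu \in Dout) //.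
  by apply/bigcupP; exists w => //; apply: mem_star => //; move: wWA; rewrite inE => /andP[].
have nbrsS G w : w \in W :\: A -> nbrs (mix Dout S G) w A = nbrs S w A.
  by move=> wWA; apply/setP => u; rewrite !inE; case: (boolP (u \in A)) => //= uA; rewrite adjS.
have unextS G K : K \subset A -> unextended (mix Dout S G) W A K = unextended S W A K.
  move=> KA; apply: eq_forallb => w; case: (boolP (w \in W :\: A)) => //= wWA; congr (~~ _).
  by apply: eq_forallb => u; case: (boolP (u \in K)) => //= uK; rewrite adjS // (subsetP KA).
have cliqueS G K : K \subset A -> clique (mix Dout S G) K = clique G K.
  move=> KA; rewrite !clique_inner.
  have nD e : e \in inner K -> e \notin Dout.
    rewrite inE => eK; apply/negP => /bigcupP[w]; rewrite inE => /andP[wA _] /in_star[u uA eu].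
    by case/negP: wA; apply: (subsetP KA); apply: (subsetP eK); rewrite eu !inE eqxx.
  by apply/subsetP/subsetP => h e eK; have := h e eK; rewrite in_mix (negPf (nD e eK)).
have HvS G : Hv (mix Dout S G) = Hv S.
  rewrite /Hv; congr (_ <= _); apply: eq_bigr => w wWA.
  by rewrite /heavy nbrsS.
have DegS G : Deg (mix Dout S G) = Deg S.
  by apply: eq_forallb => w; case: (boolP (w \in W :\: A)) => //= wWA; rewrite nbrsS.
case: (boolP (Deg S && ~~ Hv S)) => [/andP[dS hS]|nS]; last first.
  rewrite (eq_Pr p (B := fun=> false)) ?Pr_pred0 ?expR_ge0 // => G.
  by rewrite DegS HvS; move: nS; case: (Deg S); case: (Hv S); rewrite ?andbF.
have Obig : 'C(#|A|, k.+1)%:R / 2 <= #|O|%:R :> R.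
  have := @extended_count S W A k D D0 (forall_inP dS).
  set Bd := [set K | _] => hB.
  have OB : (#|O| + #|Bd| = 'C(#|A|, k.+1))%N.
    rewrite -cards_draws -cardsUI (_ : O :&: Bd = set0) ?cards0 ?addn0.
      apply: eq_card => K; rewrite !inE.
      by case: (K \subset A); case: (_ == _); case: unextended.
    apply/setP => K; rewrite !inE.
    by case: (K \subset A); case: (_ == _); case: unextended.
  have hB2 : (2 ^ k.+2 * k.+1`!)%:R * #|Bd|%:R <= (2 ^ k.+1 * k.+1`!)%:R * 'C(#|A|, k.+1)%:R :> R.
    apply: le_trans (exp_le_bin ka); apply: le_trans hcount.
    rewrite ler_wpM2l //; apply: le_trans hB _; rewrite lerD2l ler_wpM2l ?exprn_ge0 //.
    by apply: ltW; rewrite ltNge.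
  move: hB2; rewrite expnS -mulnA natrM -mulrA mulrCA ler_pM2l; last first.
    by rewrite ltr0n muln_gt0 expn_gt0 fact_gt0.
  move: OB => /(congr1 (fun m => m%:R : R)); rewrite natrD => OB h; lra.
have aL0 : 0 < 2 * (a * L) by lra.
have := @janson_cliques A k.+1 O ((2 ^ (2 * k.+1 + 3) * k.+1`!)%:R * (2 * (a * L))) _ ka _ Obig.
have c0 : 0 < (2 ^ (2 * k.+1 + 3) * k.+1`!)%:R :> R by rewrite ltr0n muln_gt0 expn_gt0 fact_gt0.
rewrite mulrAC divff ?mul1r ?lt0r_neq0 // => h.
apply: le_trans (h _ _ _ _) => //.
- apply: le_Pr => // G /and3P[_ nK _]; apply/forall_inP => K; rewrite inE => /and3P[KA Kk Ku].
  apply: contra nK => cK; apply/existsP; exists K; rewrite KA Kk cliqueS // cK unextS //.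
- by move=> K; rewrite inE => /and3P[KA /eqP Kk _].
- by rewrite mulr_gt0.
Qed.

End OpenCliques.

(** * Closed edges *)

Section FarPairs.
Variables (R : realType) (T : finType) (p : R).
Hypotheses (p0 : 0 <= p) (p1 : p <= 1).
Implicit Types (G S : graph T) (x y z u v w : T) (A K W : {set T}).

Local Notation N := (#|T|%:R : R).

Definition degree G x := #|[set y | adj G x y]|.

(** The vertices at distance at least three. Far pairs are never edges; they only bound from below
    the number of [open_pairs], a set that ignores the edges inside [A]. *)
Definition far G x :=
  [set v | [&& v != x, ~~ adj G x v & [forall u, ~~ (adj G x u && adj G v u)]]].

Definition near2 G x y := ([set u | adj G x u] :|: [set u | adj G y u]) :\: [set x; y].

(** After the edges at [x] and [y] are exposed, a vertex far from both has no neighbour in the known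
    set [near2 G x y], independently for distinct vertices. *)
Lemma far_pair_upper x y (l r : R) : x != y -> 0 < l <= 1 / 2 ->
  Pr p (fun G => N * (1 - p) ^+ #|near2 G x y| * (1 + 2 * l) + r / l
                   <= #|far G x :&: far G y|%:R) <= expR (- r).
Proof.
move=> xy hl; apply: (Pr_mix_le p0 p1 (D := star x [set: T] :|: star y [set: T])) => S.
set D := star x _ :|: _.
have inD u (t : T) : t \in [set x; y] -> forall tu : t != u, vpair_of tu \in D.
  move=> txy tu; rewrite inE; move: txy; rewrite !inE => /orP[]/eqP E.
    by apply/orP; left; apply/exists_inP; exists u; rewrite ?inE /= ?E.
  by apply/orP; right; apply/exists_inP; exists u; rewrite ?inE /= ?E.
have adjS G u (t : T) : t \in [set x; y] -> adj (mix D S G) t u = adj S t u.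
  move=> txy; have [->|tu] := eqVneq t u; first by rewrite !adj_irr.
  by rewrite !(adjE _ tu) in_mix inD.
have adjG G u v : u \notin [set x; y] -> v \notin [set x; y] -> adj (mix D S G) u v = adj G u v.
  move=> uxy vxy; have [->|uv] := eqVneq u v; first by rewrite !adj_irr.
  rewrite !(adjE _ uv) in_mix; case: ifP => //; rewrite inE => /orP[]/in_star[w _] /= E.
    have : x \in [set u; v] by rewrite E !inE eqxx.
    by move: uxy vxy; rewrite !inE !negb_or (eq_sym x u) (eq_sym x v) => /andP[/negPf-> _] /andP[/negPf->].
  have : y \in [set u; v] by rewrite E !inE eqxx.
  by move: uxy vxy; rewrite !inE !negb_or (eq_sym y u) (eq_sym y v) => /andP[_ /negPf->] /andP[_ /negPf->].
pose U := near2 S x y; pose V := ~: (U :|: [set x; y]).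
have nU G : near2 (mix D S G) x y = U.
  by apply/setP => u; rewrite !inE !adjS ?inE ?eqxx ?orbT.
have dD : forall v w, v \in V -> w \in V -> v != w -> [disjoint star v U & star w U].
  by move=> v w; rewrite !in_setC !in_setU !negb_or => /andP[vU _] _ vw; apply: star_disjoint.
have XD v : v \in V -> dep (star v U) (fun G => [forall u in U, ~~ adj G v u]).
  move=> vV; apply: dep_star => [|S' G' SG].
    by move: vV; rewrite !in_setC !in_setU !negb_or => /andP[].
  by apply: eq_forallb => u; case: (boolP (u \in U)) => //= uU; rewrite SG.
have := chernoff_upper p0 p1 dD XD (l := l) (q := (1 - p) ^+ #|U|) (m := N * (1 - p) ^+ #|U|) r.
move=> h; apply: le_trans (h _ hl _).
- apply: le_Pr => // G; rewrite nU => /le_trans; apply; rewrite ler_nat.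
  apply/subset_leq_card/subsetP => v; rewrite in_setI => /andP[].
  rewrite !in_set => /and3P[vx xv /forallP hx] /and3P[vy yv /forallP hy].
  rewrite !adjS ?inE ?eqxx ?orbT // in xv yv.
  have vxy : v \notin [set x; y] by rewrite !inE negb_or vx vy.
  apply/andP; split.
    by rewrite !inE (negPf vx) (negPf vy) (negPf xv) (negPf yv).
  apply/forall_inP => u; rewrite /U in_setD in_setU !in_set => /andP[uxy uadj].
  have {}uxy : u \notin [set x; y] by rewrite in_setU.
  have xin : x \in [set x; y] by rewrite !inE eqxx.
  have yin : y \in [set x; y] by rewrite !inE eqxx orbT.
  have hux := hx u; rewrite (adjS _ _ _ xin) (adjG _ _ _ vxy uxy) in hux.
  have huy := hy u; rewrite (adjS _ _ _ yin) (adjG _ _ _ vxy uxy) in huy.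
  by case/orP: uadj => E; [move: hux|move: huy]; rewrite E.
- by move=> v vV; rewrite Pr_no_adj //; move: vV; rewrite !in_setC !in_setU !negb_or => /andP[].
- by rewrite mulrC ler_wpM2r ?exprn_ge0 ?subr_ge0 // ler_nat max_card.
Qed.

Lemma far_lower x (l r : R) : 0 < l ->
  Pr p (fun G => #|far G x|%:R <= (N - 1 - (degree G x)%:R) * (1 - p) ^+ degree G x * (1 - l) - r / l)
    <= expR (- r).
Proof.
move=> l0; apply: (Pr_mix_le p0 p1 (D := star x [set: T])) => S.
set D := star x _.
have adjS G u : adj (mix D S G) x u = adj S x u.
  have [->|tu] := eqVneq x u; first by rewrite !adj_irr.
  by rewrite !(adjE _ tu) in_mix inE; case: exists_inP => // -[]; exists u; rewrite ?inE.
have adjG G u v : u != x -> v != x -> adj (mix D S G) u v = adj G u v.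
  move=> ux vx; have [->|uv] := eqVneq u v; first by rewrite !adj_irr.
  rewrite !(adjE _ uv) in_mix; case: ifP => // /in_star[w _] /= E.
  have : x \in [set u; v] by rewrite E !inE eqxx.
  by rewrite !inE (eq_sym x u) (eq_sym x v) (negPf ux) (negPf vx).
pose U := [set u | adj S x u]; pose V := ~: (x |: U).
have dgU G : degree (mix D S G) x = #|U|.
  by apply: eq_card => u; rewrite !inE adjS.
have xU : x \notin U by rewrite inE adj_irr.
have dD : forall v w, v \in V -> w \in V -> v != w -> [disjoint star v U & star w U].
  by move=> v w; rewrite !in_setC !in_setU1 !negb_or => /andP[_ vU] _ vw; apply: star_disjoint.
have XD v : v \in V -> dep (star v U) (fun G => [forall u in U, ~~ adj G v u]).
  rewrite in_setC in_setU1 negb_or => /andP[_ vU]; apply: dep_star => // S' G' SG.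
  by apply: eq_forallb => u; case: (boolP (u \in U)) => //= uU; rewrite SG.
have cV : #|[set i | i \in V]|%:R = N - 1 - #|U|%:R.
  have := cardsC (x |: U); rewrite cardsU1 xU -/V => /(congr1 (fun m => m%:R : R)).
  have -> : [set i | i \in V] = V by apply/setP => i; rewrite inE.
  by rewrite !natrD => <-; rewrite /=; ring.
have q0 : 0 <= (1 - p) ^+ #|U| by rewrite exprn_ge0 // subr_ge0.
have := chernoff_lower p0 p1 dD XD (l := l) (q := (1 - p) ^+ #|U|) (m := (1 - p) ^+ #|U| * #|[set i | i \in V]|%:R) r.
move=> h; apply: le_trans (h _ l0 q0 _).
- apply: le_Pr => // G; rewrite dgU cV [_ ^+ _ * _]mulrC; apply: le_trans.
  rewrite ler_nat; apply/subset_leq_card/subsetP => v; rewrite in_set => /andP[].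
  rewrite in_setC in_setU1 negb_or => /andP[vx vU] /forall_inP hv.
  rewrite !inE vx adjS; move: vU; rewrite inE => -> /=.
  apply/forallP => u; rewrite adjS negb_and; case: (boolP (adj S x u)) => //= xu.
  have ux : u != x by rewrite eq_sym; exact: adj_neq xu.
  by rewrite adjG // hv // inE.
- by move=> v; rewrite in_setC in_setU1 negb_or => /andP[_ vU]; rewrite Pr_no_adj.
- by rewrite lexx andbT mulr_ge0.
Qed.

Lemma card_ordered_pairs A (Q : {set vpair T}) (r : rel T) :
  (forall x y, x \in A -> y \in A -> r x y -> exists2 e, e \in Q & val e = [set x; y]) ->
  (\sum_(x in A) \sum_(y in A) r x y <= 2 * #|Q|)%N.
Proof.
move=> rQ.
have -> : (\sum_(x in A) \sum_(y in A) r x y =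
    #|[set u : T * T | [&& u.1 \in A, u.2 \in A & r u.1 u.2]]|)%N.
  rewrite pair_big_dep /= -sum1_card [LHS]big_mkcond [RHS]big_mkcond; apply: eq_bigr => -[x y] _ /=.
  by rewrite inE /=; case: (x \in A); case: (y \in A); case: (r x y).
apply: (@leq_trans #|\bigcup_(e in Q) [set u : T * T | val e == [set u.1; u.2]]|).
  apply/subset_leq_card/subsetP => -[x y]; rewrite inE /= => /and3P[xA yA rxy].
  have [e eQ eE] := rQ x y xA yA rxy.
  by apply/bigcupP; exists e => //; rewrite inE /= eE.
apply: leq_trans (card_bigcup_le _ _) _; rewrite mulnC -sum_nat_const.
apply: leq_sum => e _; have /cards2P[a [b [ab eab]]] := valP e.
apply: (@leq_trans #|[set (a, b); (b, a)]|); last by rewrite cards2; case: (_ != _).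
apply/subset_leq_card/subsetP => -[x y]; rewrite !inE => /eqP E; rewrite /= in E.
have {}E : val e = [set x; y] by [].
have xe : x \in [set a; b] by rewrite -eab E !inE eqxx.
have ye : y \in [set a; b] by rewrite -eab E !inE eqxx orbT.
have ae : a \in [set x; y] by rewrite -E eab !inE eqxx.
have be : b \in [set x; y] by rewrite -E eab !inE eqxx orbT.
move: xe ye ae be; rewrite !inE !xpair_eqE (eq_sym a x) (eq_sym a y) (eq_sym b x) (eq_sym b y).
by case: eqP; case: eqP; case: eqP; case: eqP => //= *; subst; rewrite ?eqxx in ab.
Qed.

Definition open_pairs G A := [set e : vpair T | (val e \subset A) && unextended G [set: T] A (val e)].

Lemma far_open_pairs G A x y : x \in A -> y \in A -> y \in far G x ->
  exists2 e, e \in open_pairs G A & val e = [set x; y].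
Proof.
move=> xA yA; rewrite !inE => /and3P[yx _ /forallP h]; rewrite eq_sym in yx.
exists (vpair_of yx) => //; rewrite inE /= subUset !sub1set xA yA /=.
apply/forall_inP => w _; apply/negP => /forall_inP hw; have := h w.
by rewrite adj_sym hw ?inE ?eqxx // adj_sym hw // !inE eqxx orbT.
Qed.

Lemma bernoulli_ge k : 1 - k%:R * p <= (1 - p) ^+ k.
Proof.
elim: k => [|k IHk]; first by rewrite expr0; lra.
have q0 : 0 <= 1 - p by rewrite subr_ge0.
rewrite exprS; apply: le_trans (ler_wpM2l q0 IHk); rewrite -natr1.
have : 0 <= k%:R * p * p by rewrite !mulr_ge0.
by lra.
Qed.

(** A small codegree makes being far from [x] and being far from [y] almost independent:
    [near2 G x y] has at most [c + 2] vertices fewer than the sum of both degrees. *)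
Lemma near2_degree G x y (c : R) : (codegree G x y)%:R <= c -> (c + 2) * p <= 1 / 2 ->
  (1 - p) ^+ #|near2 G x y| <=
  (1 - p) ^+ degree G x * (1 - p) ^+ degree G y * (1 + 2 * ((c + 2) * p)).
Proof.
move=> hc hcp; have q0 : 0 <= 1 - p by rewrite subr_ge0.
set c' := (codegree G x y + 2)%N.
have c'p : c'%:R * p <= (c + 2) * p by rewrite ler_wpM2r // natrD lerD2r.
have c'0 : 0 <= c'%:R * p by rewrite mulr_ge0.
have h : (degree G x + degree G y <= #|near2 G x y| + c')%N.
  have cE : codegree G x y = #|[set u | adj G x u] :&: [set u | adj G y u]|.
    by apply: eq_card => u; rewrite !inE.
  rewrite /degree -cardsUI /c' cE addnA [X in (_ <= X)%N]addnAC leq_add2r /near2.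
  have := cardsID [set x; y] ([set u | adj G x u] :|: [set u | adj G y u]).
  have : (#|([set u | adj G x u] :|: [set u | adj G y u]) :&: [set x; y]| <= 2)%N.
    apply: leq_trans (subset_leq_card (subsetIr _ _)) _.
    by rewrite cards2; case: (_ != _).
  by lia.
have e1 : (1 - p) ^+ #|near2 G x y| * (1 - p) ^+ c' <= (1 - p) ^+ degree G x * (1 - p) ^+ degree G y.
  rewrite -!exprD ler_wiXn2l //; first by have := p0; lra.
have := bernoulli_ge c'; have : 0 <= (1 - p) ^+ #|near2 G x y| by rewrite exprn_ge0.
set u := (1 - p) ^+ #|_| in e1 *; set w := _ * (1 - p) ^+ degree G y in e1 *.
set b := (1 - p) ^+ c' in e1 *; set e := (c + 2) * p in hcp c'p *.
move=> u0 hb.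
have h1 : u * (1 - e) <= w by apply: le_trans e1; rewrite ler_wpM2l //; lra.
have h2 : 1 <= (1 - e) * (1 + 2 * e) by nra.
apply: (@le_trans _ _ (u * (1 - e) * (1 + 2 * e))).
  by rewrite -mulrA ler_peMr.
by rewrite ler_wpM2r //; lra.
Qed.

Lemma degree_defect (M d k l : R) : 0 <= l <= 1 / 2 -> 0 <= k -> k <= d ->
  M * (1 - l) - (1 + d) <= (M - 1 - k) * (1 - l).
Proof. by move=> /andP[l0 l1] k0 kd; nra. Qed.

(** The left side is an off-diagonal entry of the Gram matrix [Bxy] of the centred indicators: [P]
    counts common far vertices, [u] and [v] are the weighted counts for one vertex, and [w] is the
    product of the two densities. *)
Lemma covariance_bound (M e l w d b P u v : R) :
  P <= M * (w * (1 + 2 * e)) * (1 + 2 * l) + b ->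
  w * (M * (1 - l) - (1 + d)) - b <= u -> w * (M * (1 - l) - (1 + d)) - b <= v ->
  0 <= M * w * e * (1 - 2 * l) ->
  P - u - v + M * w <= (M * (4 * e + 4 * l) + 2 * (1 + d)) * w + 3 * b.
Proof. by move=> *; lra. Qed.

(* Second moment: the vectors [1_{far x} - (1-p)^{deg x}] are nearly orthogonal,
   so that few vertices [v] can have many fewer far partners in [A] than expected. *)
Lemma open_pairs_lower G A (l r d c z : R) :
  0 < l <= 1 / 2 -> 0 <= r -> 0 < z -> 0 <= d -> 0 <= c ->
  (forall k : nat, k%:R <= d -> z / 2 <= (1 - p) ^+ k) ->
  (c + 2) * p <= 1 / 2 ->
  N * (4 * ((c + 2) * p) + 4 * l) + 2 * (1 + d) <= #|A|%:R / 16 ->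
  3 * (r / l) <= #|A|%:R * z ^+ 2 / 64 ->
  64 * N <= #|A|%:R ^+ 2 * z ^+ 2 ->
  (forall x, (degree G x)%:R <= d) ->
  (forall x y, x != y -> (codegree G x y)%:R <= c) ->
  (forall x y, x != y ->
     #|far G x :&: far G y|%:R <= N * (1 - p) ^+ #|near2 G x y| * (1 + 2 * l) + r / l) ->
  (forall x, (N - 1 - (degree G x)%:R) * (1 - p) ^+ degree G x * (1 - l) - r / l <= #|far G x|%:R) ->
  #|A|%:R ^+ 2 * z / 8 <= #|open_pairs G A|%:R.
Proof.
move=> /andP[l0 l1] r0 z0 d0 c0 hz hc hkap hbeta hN hdeg hcodeg hpair hsingle.
have [->|A0] := posnP #|A|; first by rewrite expr0n /= !mul0r.
set s : R := #|A|%:R in hkap hbeta hN *.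
have s0 : 0 < s by rewrite ltr0n.
have l20 : 0 <= 1 - 2 * l by lra.
have l2 : 0 <= 1 + 2 * l by lra.
pose zz x := (1 - p) ^+ degree G x.
have zz_lo x : z / 2 <= zz x by apply: hz.
have zz_ge x : 0 <= zz x by apply: le_trans (zz_lo x); rewrite divr_ge0 // ltW.
have zz_le x : zz x <= 1 by rewrite /zz exprn_ile1 // ?subr_ge0 //; have := p0; lra.
have N0 : 0 <= N by rewrite ler0n.
have rl0 : 0 <= r / l by rewrite divr_ge0 // ltW.
have e0 : 0 <= (c + 2) * p by rewrite mulr_ge0 //; lra.
pose kap : R := N * (4 * ((c + 2) * p) + 4 * l) + 2 * (1 + d).
have kap0 : 0 <= kap.
  have h : 0 <= N * (4 * ((c + 2) * p) + 4 * l) by rewrite mulr_ge0 //; clear - e0 l0; lra.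
  by rewrite /kap; clear - h d0; lra.
pose f x v : R := (v \in far G x)%:R.
have fsum x : \sum_v f x v = #|far G x|%:R.
  rewrite -sum1_card natr_sum [RHS]big_mkcond; apply: eq_bigr => v _.
  by rewrite /f; case: (v \in _).
pose Bxy x y := \sum_v (f x v - zz x) * (f y v - zz y).
have BE x y : Bxy x y = #|far G x :&: far G y|%:R - zz y * #|far G x|%:R
    - zz x * #|far G y|%:R + N * (zz x * zz y).
  rewrite /Bxy -!fsum.
  have -> : #|far G x :&: far G y|%:R = \sum_v f x v * f y v.
    rewrite -sum1_card natr_sum [LHS]big_mkcond; apply: eq_bigr => v _.
    by rewrite /f in_setI -natrM mulnb; case: (_ && _).
  have -> : N * (zz x * zz y) = \sum_(v : T) zz x * zz y.
    by rewrite sumr_const mulr_natl.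
  rewrite !mulr_sumr -!sumrB -big_split; apply: eq_bigr => v _ /=; ring.
have Bdiag x : Bxy x x <= 2 * N.
  rewrite BE setIid.
  have h1 : #|far G x|%:R <= N by rewrite ler_nat max_card.
  have h2 : 0 <= zz x * #|far G x|%:R by rewrite mulr_ge0.
  have h3 : N * (zz x * zz x) <= N * 1 by rewrite ler_wpM2l // mulr_ile1.
  by clear - h1 h2 h3; lra.
have Boff x y : x != y -> Bxy x y <= kap * (zz x * zz y) + 3 * (r / l).
  move=> xy; rewrite BE.
  have h1 := hpair x y xy; have h2 := near2_degree (hcodeg x y xy) hc.
  rewrite -/(zz x) -/(zz y) in h2; set w := zz x * zz y in h2 *.
  have w0 : 0 <= w by rewrite mulr_ge0.
  set e := (c + 2) * p in h2 hc e0 kap kap0 *.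
  have {}h1 : #|far G x :&: far G y|%:R <= N * (w * (1 + 2 * e)) * (1 + 2 * l) + r / l.
    by apply: le_trans h1 _; rewrite lerD2r ler_wpM2r ?ler_wpM2l.
  have single u v : zz u * zz v = w -> w * (N * (1 - l) - (1 + d)) - r / l <= zz v * #|far G u|%:R.
    move=> E; apply: le_trans (ler_wpM2l (zz_ge v) (hsingle u)).
    rewrite [leRHS]mulrBr -/(zz u).
    have -> : zz v * ((N - 1 - (degree G u)%:R) * zz u * (1 - l))
      = w * ((N - 1 - (degree G u)%:R) * (1 - l)) by rewrite -E; ring.
    apply: lerB; last by rewrite ler_piMl.
    by rewrite ler_wpM2l //; apply: degree_defect; rewrite ?(ltW l0) ?l1 //.
  have s1 := single x y erefl; have s2 := single y x (mulrC _ _).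
  have Nw : 0 <= N * w by rewrite mulr_ge0.
  have Nwe : 0 <= N * w * e * (1 - 2 * l) by apply: mulr_ge0 => //; exact: mulr_ge0.
  exact: covariance_bound h1 s1 s2 Nwe.
pose Z := \sum_(x in A) zz x.
have Zs : s * z / 2 <= Z.
  rewrite -mulrA /s mulr_natl -sumr_const; apply: ler_sum => x _; exact: zz_lo.
have Z0 : 0 < Z by apply: lt_le_trans Zs; rewrite divr_gt0 ?mulr_gt0.
pose dv v := \sum_(x in A) f x v.
have moment : \sum_(v in A) (dv v - Z) ^+ 2 <= kap * Z ^+ 2 + 3 * (r / l) * s ^+ 2 + 2 * N * s.
  apply: (@le_trans _ _ (\sum_v (dv v - Z) ^+ 2)).
    by rewrite [leLHS]big_mkcond; apply: ler_sum => v _; case: ifP => // _; rewrite sqr_ge0.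
  have -> : \sum_v (dv v - Z) ^+ 2 = \sum_(x in A) \sum_(y in A) Bxy x y.
    transitivity (\sum_(x in A) \sum_v \sum_(y in A) (f x v - zz x) * (f y v - zz y)); last first.
      by apply: eq_bigr => x _; rewrite exchange_big.
    rewrite [RHS]exchange_big /=; apply: eq_bigr => v _.
    by rewrite /dv /Z -sumrB expr2 big_distrlr.
  apply: (@le_trans _ _ (\sum_(x in A) (\sum_(y in A) (kap * (zz x * zz y) + 3 * (r / l)) + 2 * N))).
    apply: ler_sum => x xA; rewrite (bigD1 x) //= [in leRHS](bigD1 x) //=.
    rewrite -addrA addrC [leRHS]addrC -!addrA.
    have h1 := Bdiag x.
    have h2 : \sum_(y in A | y != x) Bxy x y <= \sum_(y in A | y != x) (kap * (zz x * zz y) + 3 * (r / l)).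
      by apply: ler_sum => y /andP[_ yx]; apply: Boff; rewrite eq_sym.
    have h3 : 0 <= kap * (zz x * zz x) by rewrite !mulr_ge0.
    by clear - h1 h2 h3 rl0; lra.
  rewrite big_split /= sumr_const -[X in _ + X]mulr_natr -/s lerD2r.
  rewrite (eq_bigr (fun x => kap * zz x * Z + 3 * (r / l) * s)); last first.
    move=> x _; rewrite big_split /= sumr_const -[X in _ + X]mulr_natr -/s; congr (_ + _).
    by rewrite /Z mulr_sumr; apply: eq_bigr => y _; ring.
  rewrite big_split /= sumr_const -[X in _ + X]mulr_natr -/s -mulr_suml -mulr_sumr -/Z.
  by apply: eq_ler; ring.
have low : s * Z / 2 <= \sum_(v in A) dv v.
  (* Completing the square gives a lower bound for [dv v] that is linear in the squared deviation,
     so the second moment is summed without singling out exceptional vertices. *)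
  have pt v : 3 / 4 * Z - (dv v - Z) ^+ 2 / Z <= dv v.
    rewrite -subr_ge0.
    have -> : dv v - (3 / 4 * Z - (dv v - Z) ^+ 2 / Z) = ((dv v - Z) + Z / 2) ^+ 2 / Z.
      by field; apply: lt0r_neq0.
    by rewrite divr_ge0 ?sqr_ge0 // ltW.
  apply: le_trans (_ : \sum_(v in A) (3 / 4 * Z - (dv v - Z) ^+ 2 / Z) <= _); last first.
    by apply: ler_sum => v _; exact: pt.
  rewrite sumrB sumr_const -[X in _ <= X - _]mulr_natl -/s -mulr_suml.
  have ZZ : (s * z / 2) ^+ 2 <= Z ^+ 2.
    by apply: lerXn2r; rewrite ?nnegrE ?(ltW Z0) // divr_ge0 ?mulr_ge0 ?ltW.
  have b1 : kap * Z ^+ 2 <= s / 16 * Z ^+ 2 by rewrite ler_wpM2r ?sqr_ge0.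
  have b2 : 3 * (r / l) * s ^+ 2 <= s / 16 * Z ^+ 2.
    apply: le_trans (ler_wpM2r (sqr_ge0 s) hbeta) _.
    apply: (@le_trans _ _ (s / 16 * (s * z / 2) ^+ 2)); last by rewrite ler_wpM2l // divr_ge0 // ltW.
    by apply: eq_ler; field.
  have b3 : 2 * N * s <= s / 8 * Z ^+ 2.
    apply: (@le_trans _ _ (s / 8 * (s * z / 2) ^+ 2)); last by rewrite ler_wpM2l // divr_ge0 // ltW.
    by have h := ler_wpM2l (ltW s0) hN; clear - h; lra.
  have h : (\sum_(v in A) (dv v - Z) ^+ 2) / Z <= s * Z / 4.
    by rewrite ler_pdivrMr //; apply: le_trans moment _; clear - b1 b2 b3; lra.
  by clear - h; lra.
have up : \sum_(v in A) dv v <= 2 * #|open_pairs G A|%:R.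
  have := @card_ordered_pairs A (open_pairs G A) (fun x y => y \in far G x)
    (fun x y xA yA => far_open_pairs xA yA).
  rewrite -(ler_nat R) natrM => h; apply: le_trans h.
  rewrite natr_sum /dv exchange_big /=; apply: ler_sum => x _.
  by rewrite natr_sum.
have h : s * (s * z / 2) <= s * Z by rewrite ler_pM2l.
by clear - h low up; lra.
Qed.

(** [open_pairs G A] is determined by the edges leaving [A]; once these are exposed, its members are
    still independent edges of probability [p]. *)
Lemma no_open_edge_prob A (M : R) :
  Pr p (fun G => (M <= #|open_pairs G A|%:R) && [disjoint open_pairs G A & G]) <= expR (- (p * M)).
Proof.
pose Dout := \bigcup_(w in [set: T] :\: A) star w A.
apply: (Pr_mix_le p0 p1 (D := Dout)) => S.
have adjS G w u : w \notin A -> u \in A -> adj (mix Dout S G) w u = adj S w u.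
  move=> wA uA; have [->|wu] := eqVneq w u; first by rewrite !adj_irr.
  rewrite !(adjE _ wu) in_mix (_ : vpair_of wu \in Dout) //.
  by apply/bigcupP; exists w; [rewrite !inE wA|apply: mem_star].
have opS G : open_pairs (mix Dout S G) A = open_pairs S A.
  apply/setP => e; rewrite !inE; case: (boolP (val e \subset A)) => //= /subsetP eA.
  apply: eq_forallb => w; case: (boolP (w \in A)) => wA; rewrite !inE wA //=.
  by congr (~~ _); apply: eq_forallb => u; case: (boolP (u \in val e)) => //= /eA uA; rewrite adjS.
have [MQ|MQ] := lerP M #|open_pairs S A|%:R; last first.
  rewrite (eq_Pr p (B := fun=> false)) ?Pr_pred0 ?expR_ge0 // => G.
  by rewrite opS leNgt MQ.
apply: (@le_trans _ _ (Pr p (fun G => [disjoint open_pairs S A & G]))).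
  apply: le_Pr => // G; rewrite opS => /andP[_ /pred0P h]; apply/pred0P => e /=.
  have := h e; rewrite /= in_mix; case: ifP => // eD _; apply/negbTE/negP => /andP[].
  rewrite inE => /andP[/subsetP eA _] _.
  case/bigcupP: eD => w; rewrite !inE andbT => /negP wA /exists_inP[u uA /eqP eu].
  by apply: wA; apply: eA; rewrite eu !inE eqxx.
rewrite Pr_disj; apply: (@le_trans _ _ (expR (- (p * #|open_pairs S A|%:R)))); last first.
  by rewrite ler_expR lerN2 ler_wpM2l.
rewrite -mulNr expRM_natr; apply: lerXn2r; rewrite ?nnegrE ?expR_ge0 ?subr_ge0 //.
exact: expR_ge1Dx.
Qed.

Lemma open_edge_closed_clique G A e :
  e \in open_pairs G A -> e \in G -> closed_clique G A (val e).
Proof.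
rewrite inE => /andP[eA /forall_inP ue] eG; apply/and4P; split=> //.
- rewrite clique_inner; apply/subsetP => e'; rewrite inE => e'e.
  suff -> : e' = e by [].
  by apply/val_inj/eqP; rewrite eqEcard e'e (eqP (valP e)) (eqP (valP e')).
- by rewrite (eqP (valP e)).
- apply/forallP => w; apply/implyP => wK; apply/negPn/negP => wA.
  by have := ue w; rewrite !inE wA => /(_ isT); rewrite wK.
Qed.

(** [d] and [c] cap degrees and codegrees, [z] is the expected density of far vertices, and [l], [r]
    are Chernoff parameters. The conditions on far sets concern vertices and pairs only; the union
    over the sets [A] is paid for the missing edge alone. *)
Lemma lower_bound_edges (s : nat) (l r d c z : R) :
  0 < l <= 1 / 2 -> 0 <= r -> 0 < z -> 0 <= d -> 0 <= c ->
  (forall k : nat, k%:R <= d -> z / 2 <= (1 - p) ^+ k) ->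
  (c + 2) * p <= 1 / 2 ->
  N * (4 * ((c + 2) * p) + 4 * l) + 2 * (1 + d) <= s%:R / 16 ->
  3 * (r / l) <= s%:R * z ^+ 2 / 64 ->
  64 * N <= s%:R ^+ 2 * z ^+ 2 ->
  Pr p (fun G => ~~ [forall A : {set T}, (#|A| == s) ==> [exists K : {set T}, closed_clique G A K]])
    <= Pr p (fun G => [exists x, d < (degree G x)%:R])
     + Pr p (fun G => [exists u : T * T, (u.1 != u.2) && (c < (codegree G u.1 u.2)%:R)])
     + (N ^+ 2 * expR (- r) + N * expR (- r))
     + N ^+ s * expR (- (p * (s%:R ^+ 2 * z / 8))).
Proof.
move=> hl r0 z0 d0 c0 hz hc hkap hbeta hN.
pose E1 G := [exists x, d < (degree G x)%:R].
pose E2 G := [exists u : T * T, (u.1 != u.2) && (c < (codegree G u.1 u.2)%:R)].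
pose E3 G := [exists u : T * T, (u.1 != u.2) &&
  (N * (1 - p) ^+ #|near2 G u.1 u.2| * (1 + 2 * l) + r / l <= #|far G u.1 :&: far G u.2|%:R)].
pose E4 G := [exists x,
  #|far G x|%:R <= (N - 1 - (degree G x)%:R) * (1 - p) ^+ degree G x * (1 - l) - r / l].
pose E5 G := [exists (A : {set T} | #|A| == s), (s%:R ^+ 2 * z / 8 <= #|open_pairs G A|%:R)
   && [disjoint open_pairs G A & G]].
apply: (@le_trans _ _ (Pr p (fun G => [|| E1 G || E2 G, E3 G || E4 G | E5 G]))).
  apply: le_Pr => // G; apply: contraNT; rewrite !negb_or => /andP[/andP[/existsPn n1 /existsPn n2]].
  case/andP=> /andP[/existsPn n3 /existsPn n4] /existsPn n5.
  apply/forallP => A; apply/implyP => As.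
  have := n5 A; rewrite As /= negb_and => /orP[/negP nM|]; last first.
    move=> /pred0Pn[e /andP[/= e1 e2]].
    by apply/existsP; exists (val e); exact: open_edge_closed_clique.
  case: nM; rewrite -(eqP As).
  apply: (@open_pairs_lower G A l r d c z) => //; rewrite ?(eqP As) //.
  - by move=> x; rewrite leNgt; exact: n1.
  - by move=> x y xy; have := n2 (x, y); rewrite /= xy /= -leNgt.
  - by move=> x y xy; have := n3 (x, y); rewrite /= xy /= -ltNge => /ltW.
  - by move=> x; have := n4 x; rewrite -ltNge => /ltW.
apply: le_trans (Pr_or p0 p1 _ _) _; rewrite -addrA; apply: lerD; first exact: Pr_or.
apply: le_trans (Pr_or p0 p1 _ _) _; apply: lerD.
  apply: le_trans (Pr_or p0 p1 _ _) _; apply: lerD.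
    rewrite -natrX -mulnn -card_prod; apply: (Pr_exists_le p0 p1) => -[x y] /=.
    have [->|xy] := eqVneq x y.
      by rewrite (eq_Pr p (B := fun=> false)) // Pr_pred0 expR_ge0.
    exact: far_pair_upper.
  apply: (Pr_exists_le p0 p1) => x; apply: far_lower; by case/andP: hl.
apply: (@le_trans _ _ (#|[set A : {set T} | #|A| == s]|%:R * expR (- (p * (s%:R ^+ 2 * z / 8))))).
  apply: (Pr_exists_in_le p0 p1) => A _; exact: no_open_edge_prob.
rewrite ler_wpM2r ?expR_ge0 // -natrX ler_nat card_draws.
by apply: leq_trans (ffact_le_exp _ _); rewrite -bin_ffact leq_pmulr // fact_gt0.
Qed.

End FarPairs.

(** * Closed cliques with many vertices *)

Section Reduction.
Variables (R : realType) (T : finType) (p : R).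
Hypotheses (p0 : 0 <= p) (p1 : p <= 1).
Implicit Types (G S : graph T) (x y z u v w : T) (A K W : {set T}).

Local Notation N := (#|T|%:R : R).

Definition common G K := [set w | [forall u in K, adj G w u]].

Definition has_open_clique G W A k :=
  [exists K : {set T}, [&& K \subset A, #|K| == k, clique G K & unextended G W A K]].

(** A single event for all [a]-subsets of [W]. It reads only edges inside [W], so for
    [W = common G K] it is independent of the edges at [K]. *)
Definition bad_set (D : R) a k G W := [exists w in W, D < #|nbrs G w W|%:R] ||
  [exists (A : {set T} | (A \subset W) && (#|A| == a)), ~~ has_open_clique G W A k].

Lemma bad_set_prob W k a (m D L r : R) : (1 <= k)%N -> (2 * k.+1 <= a)%N -> 0 <= D ->
  1 <= a%:R * L -> #|W|%:R <= m ->
  m * expR (- (a%:R * p)) <= 1 ->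
  (2 ^ k.+2 * k.+1`!)%:R * (m * (16 * (a%:R * p)) ^+ k.+1 + D ^+ k * (3 * (a%:R * L)))
    <= a%:R ^+ k.+1 ->
  (forall i, (2 <= i <= k.+1)%N ->
    (2 ^ (2 * k.+1 + 3) * k.+1`!)%:R * (2 * (a%:R * L)) <= a%:R ^+ i * p ^+ 'C(i, 2)) ->
  2 * (p * m) + 2 * r <= D ->
  Pr p (fun G => bad_set D a k.+1 G W)
    <= N * expR (- r) + N ^+ a * (2 * expR (- (2 * (a%:R * L)))).
Proof.
move=> k1 ka D0 aL Wm hW hcount hLam hD.
pose E1 G := [exists w in W, D < #|nbrs G w W|%:R].
pose E2 G := [exists (A : {set T} | (A \subset W) && (#|A| == a)),
   [forall w in W :\: A, #|nbrs G w A|%:R <= D] && ~~ has_open_clique G W A k.+1].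
apply: (@le_trans _ _ (Pr p (fun G => E1 G || E2 G))).
  apply: le_Pr => // G; rewrite /bad_set -/(E1 G); case: (boolP (E1 G)) => //= nE1 /existsP[A /andP[AWa nA]].
  apply/existsP; exists A; rewrite AWa nA andbT /=; apply/forall_inP => w; rewrite inE => /andP[_ wW].
  case/andP: AWa => AW _.
  have : ~~ (D < #|nbrs G w W|%:R) by apply: contra nE1 => h; apply/existsP; exists w; rewrite wW.
  rewrite -leNgt; apply: le_trans; rewrite ler_nat; apply/subset_leq_card/subsetP => u.
  by rewrite !inE => /andP[/(subsetP AW)-> ->].
apply: le_trans (Pr_or p0 p1 _ _) _; apply: lerD.
  apply: (@le_trans _ _ (#|[set w | w \in W]|%:R * expR (- r))).
    apply: (Pr_exists_in_le p0 p1) => w _.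
    have h := @degree_upper R T p p0 p1 w W (1 / 2) r (p * m).
    apply: le_trans (h _ _); first last.
    - by rewrite ler_wpM2l.
    - by apply/andP; split; lra.
    by apply: le_Pr => // G hG; apply: ltW; apply: le_lt_trans hG; lra.
  by rewrite ler_wpM2r ?expR_ge0 // ler_nat max_card.
apply: (@le_trans _ _ (#|[set A : {set T} | (A \subset W) && (#|A| == a)]|%:R * (2 * expR (- (2 * (a%:R * L)))))).
  apply: (Pr_exists_in_le p0 p1) => A /andP[AW /eqP Aa]; rewrite -Aa.
  have eW : 0 <= expR (- (a%:R * p)) by exact: expR_ge0.
  have t0 : 0 <= (16 * (a%:R * p)) ^+ k.+1 by rewrite exprn_ge0 // !mulr_ge0.
  apply: (open_clique_prob p0 p1 k1) => //; rewrite ?Aa //.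
    by apply: le_trans hW; rewrite ler_wpM2r.
  by apply: le_trans hcount; rewrite ler_wpM2l // lerD2r ler_wpM2r.
rewrite ler_wpM2r ?mulr_ge0 ?expR_ge0 // -natrX ler_nat cards_draws.
apply: leq_trans (leq_bin2l _ (max_card _)) _.
by apply: leq_trans (ffact_le_exp _ _); rewrite -bin_ffact leq_pmulr // fact_gt0.
Qed.

Lemma common_card_prob K (r : R) :
  Pr p (fun G => 2 * (N * p ^+ #|K|) + 2 * r <= #|common G K|%:R) <= expR (- r).
Proof.
have dD : forall v w, v \in ~: K -> w \in ~: K -> v != w -> [disjoint star v K & star w K].
  by move=> v w; rewrite inE => vK _ vw; apply: star_disjoint.
have XD v : v \in ~: K -> dep (star v K) (fun G => [forall u in K, adj G v u]).
  rewrite inE => vK; apply: dep_star => // S G SG.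
  by apply: eq_forallb => u; case: (boolP (u \in K)) => //= uK; rewrite SG.
have := chernoff_upper p0 p1 dD XD (l := 1 / 2) (q := p ^+ #|K|) (m := N * p ^+ #|K|) r.
move=> h; apply: le_trans (h _ _ _).
- apply: le_Pr => // G hG; apply: (@le_trans _ _ #|common G K|%:R).
    by apply: le_trans hG; lra.
  rewrite ler_nat; apply/subset_leq_card/subsetP => v; rewrite [v \in common _ _]inE => hv.
  rewrite inE hv andbT inE; apply/negP => vK; move/forall_inP: hv => /(_ v vK).
  by rewrite adj_irr.
- by move=> v; rewrite inE => vK; rewrite Pr_all_adj.
- by apply/andP; split; lra.
- by rewrite mulrC ler_wpM2r ?exprn_ge0 // ler_nat max_card.
Qed.

(** Exposing all edges at [K] determines [common G K], which avoids [K], and reveals no edge inside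
    it. *)
Lemma bad_common_prob K (D : R) a k (m q : R) : 0 <= q ->
  (forall W, #|W|%:R <= m -> Pr p (fun G => bad_set D a k G W) <= q) ->
  Pr p (fun G => (#|common G K|%:R <= m) && bad_set D a k G (common G K)) <= q.
Proof.
move=> q0 hq; pose Dk := \bigcup_(u in K) star u [set: T].
apply: (Pr_mix_le p0 p1 (D := Dk)) => S.
have inD u (t : T) (ut : u != t) : u \in K -> vpair_of ut \in Dk.
  by move=> uK; apply/bigcupP; exists u => //; rewrite inE; apply/exists_inP; exists t; rewrite ?inE.
have cS G : common (mix Dk S G) K = common S K.
  apply/setP => w; rewrite !inE; apply: eq_forallb => u; case: (boolP (u \in K)) => //= uK.
  have [->|wu] := eqVneq w u; first by rewrite !adj_irr.
  rewrite eq_sym in wu; rewrite !(adj_sym _ w) !(adjE _ wu) in_mix.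
  by rewrite inD.
set W := common S K in cS *.
have WK w : w \in W -> w \notin K.
  by rewrite inE => /forall_inP h; apply/negP => /h; rewrite adj_irr.
clearbody W.
have adjG G u v : u \in W -> v \in W -> adj (mix Dk S G) u v = adj G u v.
  move=> uW vW; have [->|uv] := eqVneq u v; first by rewrite !adj_irr.
  rewrite !(adjE _ uv) in_mix; case: ifP => // /bigcupP[w wK /in_star[t _]] /= E.
  have : w \in [set u; v] by rewrite E !inE eqxx.
  by rewrite !inE => /orP[]/eqP E'; move: wK; rewrite E'; [move/negP: (WK _ uW)|move/negP: (WK _ vW)].
have nG G w : w \in W -> nbrs (mix Dk S G) w W = nbrs G w W.
  by move=> wW; apply/setP => u; rewrite !inE; case: (boolP (u \in W)) => //= uW; rewrite adjG.
have bG G : bad_set D a k (mix Dk S G) W = bad_set D a k G W.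
  congr (_ || _).
    by apply: eq_existsb => w; case: (boolP (w \in W)) => //= wW; rewrite nG.
  apply: eq_existsb => A; case: (boolP (A \subset W)) => //= /subsetP AW; congr (_ && ~~ _).
  apply: eq_existsb => B; case: (boolP (B \subset A)) => //= /subsetP BA; congr [&& _, _ & _].
    apply: eq_forallb => u; case: (boolP (u \in B)) => //= uB.
    apply: eq_forallb => v; case: (boolP (v \in B)) => //= vB.
    by rewrite adjG // AW // BA.
  apply: eq_forallb => w; case: (boolP (w \in W :\: A)) => //=; rewrite inE => /andP[_ wW].
  by congr (~~ _); apply: eq_forallb => u; case: (boolP (u \in B)) => //= uB; rewrite adjG // AW // BA.
have [Wm|Wm] := boolP (#|W|%:R <= m).
  apply: le_trans (hq W Wm); apply: le_Pr => // G.
  by rewrite cS bG => /andP[].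
rewrite (eq_Pr p (B := fun=> false)) ?Pr_pred0 // => G.
by rewrite cS (negPf Wm).
Qed.

Definition inner_edges G A := #|[set e : vpair T | (e \in inner A) && (e \in G)]|.

Lemma inner_edges_lower A (l r : R) : 0 < l ->
  Pr p (fun G => (inner_edges G A)%:R <= p * 'C(#|A|, 2)%:R * (1 - l) - r / l) <= expR (- r).
Proof.
move=> l0.
have dD : forall e f : vpair T, e \in inner A -> f \in inner A -> e != f -> [disjoint [set e] & [set f]].
  by move=> e f _ _ ef; rewrite disjoints1 inE.
have XD (e : vpair T) : e \in inner A -> dep [set e] (fun G => e \in G).
  by move=> _; apply: dep_in => S G; apply; rewrite inE.
have cA : #|[set e | e \in inner A]| = 'C(#|A|, 2).
  by rewrite -card_inner; apply: eq_card => e; rewrite !inE.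
have := chernoff_lower p0 p1 dD XD (l := l) (q := p) (m := p * 'C(#|A|, 2)%:R) r.
move=> h; apply: (h _ l0 p0).
- move=> e _; have h2 := Pr_sub p [set e]; rewrite cards1 expr1 in h2.
  by rewrite -[leLHS]h2; apply: le_Pr => // G; rewrite sub1set.
- by rewrite cA lexx andbT mulr_ge0.
Qed.

Lemma inner_edges_le_sum G A : (2 * inner_edges G A <= \sum_(x in A) #|nbrs G x A|)%N.
Proof.
pose O := [set u : T * T | [&& u.1 \in A, u.2 \in A & adj G u.1 u.2]].
pose F := [set e : vpair T | (e \in inner A) && (e \in G)].
have -> : (\sum_(x in A) #|nbrs G x A| = #|O|)%N.
  rewrite (eq_bigr (fun x => \sum_(y in nbrs G x A) 1)%N) => [|x _]; last by rewrite sum1_card.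
  rewrite pair_big_dep /= sum1dep_card; apply: eq_card => -[x y]; rewrite !inE /=.
  by case: (x \in A).
rewrite /inner_edges -/F mulnC -sum_nat_const.
apply: (@leq_trans (\sum_(e in F) \sum_(u in O) (val e == [set u.1; u.2]))).
  apply: leq_sum => e; rewrite inE => /andP[eA eG]; rewrite inE in eA.
  have /cards2P[a [b [ab eab]]] := valP e.
  have [aA bA] : a \in A /\ b \in A.
    by split; apply: (subsetP eA); rewrite eab !inE eqxx ?orbT.
  have eE : vpair_of ab = e by apply: val_inj; rewrite /= eab.
  have adjab : adj G a b by rewrite (adjE _ ab) eE.
  have ab2 : (a, b) != (b, a) by rewrite xpair_eqE negb_and ab.
  rewrite (bigD1 (a, b)) /=; last by rewrite inE /= aA bA.
  rewrite (bigD1 (b, a)) /=; last by rewrite inE /= aA bA adj_sym adjab eq_sym ab2.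
  have e1 : val e == [set a; b] by rewrite eab.
  have e2 : val e == [set b; a] by rewrite eab setUC.
  by rewrite e1 e2.
rewrite exchange_big /= -sum1_card; apply: leq_sum => -[x y] _ /=.
have [e0 /andP[e0F /eqP e0E]|no] := pickP (fun e : vpair T => (e \in F) && (val e == [set x; y])).
  rewrite (bigD1 e0) //= e0E eqxx big1 // => e /andP[_ ne].
  by apply/eqP; rewrite eqb0; apply: contra ne => /eqP E; apply/eqP/val_inj; rewrite e0E.
by rewrite big1 // => e eF; have := no e; rewrite eF /= => ->.
Qed.

(* The form of the error term makes [sqrt |A|] shrink by a factor [sqrt p] up to an
   additive [O(sqrt c)] on passing from [A] to [nbrs G x A]. *)
Definition regular (c : R) G := [forall A : {set T}, (c <= p * #|A|%:R) ==>
  [exists x in A, p * (#|A|%:R - 1) - 4 * Num.sqrt (p * #|A|%:R * (c / 25)) <= #|nbrs G x A|%:R]].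

(** If all degrees inside [A] are small, [A] spans too few edges. Sets that satisfy the size
    condition have [b >= 2] vertices, so a failure probability of [expR (- (2 * b * L))] survives
    the union over the [N ^+ b] sets and then over the [N + 1] sizes. *)
Lemma regular_prob (L : R) : 1 <= L -> expR L = N ->
  Pr p (fun G => ~~ regular (25 * L) G) <= (N + 1) * expR (- (2 * L)).
Proof.
move=> L1 LN.
pose bad G A := (25 * L <= p * #|A|%:R) && [forall x in A,
   #|nbrs G x A|%:R < p * (#|A|%:R - 1) - 4 * Num.sqrt (p * #|A|%:R * L)].
apply: (@le_trans _ _ (Pr p (fun G => [exists b : 'I_(#|T|.+1), [exists (A : {set T} | #|A| == b), bad G A]]))).
  apply: le_Pr => // G; rewrite negb_forall => /existsP[A]; rewrite negb_imply => /andP[cA nA].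
  apply/existsP; exists (Ordinal (max_card (mem A) : #|A| < #|T|.+1)%N).
  apply/existsP; exists A; rewrite eqxx /bad cA /=; apply/forall_inP => x xA.
  rewrite ltNge; apply: contra nA => hx; apply/exists_inP; exists x => //.
  by rewrite (_ : 25 * L / 25 = L) //; field.
apply: (@le_trans _ _ (#|'I_(#|T|.+1)|%:R * expR (- (2 * L)))); last by rewrite card_ord natr1.
apply: (Pr_exists_le p0 p1) => -[b /= _].
have e0 := expR_ge0 (- (2 * L)).
have [b2|b2] := ltnP b 2.
  apply: le_trans (Pr_exists p0 p1 _ _) _; rewrite big1 // => A /eqP Ab.
  rewrite (eq_Pr p (B := fun=> false)) ?Pr_pred0 // => G; apply/negbTE/negP => /andP[h _].
  have : p * #|A|%:R <= 1 * 1.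
    by apply: ler_pM => //; rewrite (ler_nat R _ 1) Ab -ltnS.
  by lra.
apply: (@le_trans _ _ (#|[set A : {set T} | #|A| == b]|%:R * expR (- (2 * (b%:R * L))))).
  apply: (Pr_exists_in_le p0 p1) => A /eqP Ab.
  have [cA|cA] := boolP (25 * L <= p * #|A|%:R); last first.
    rewrite (eq_Pr p (B := fun=> false)) ?Pr_pred0 ?expR_ge0 // => G.
    by rewrite /bad (negPf cA).
  set q := Num.sqrt (p * #|A|%:R * L).
  have b0 : 0 < #|A|%:R :> R by rewrite ltr0n Ab; lia.
  have pb : 0 < p * #|A|%:R by lra.
  have q2 : q ^+ 2 = p * #|A|%:R * L by rewrite sqr_sqrtr // mulr_ge0 //; lra.
  have q0 : 0 < q by rewrite sqrtr_gt0 mulr_gt0 //; lra.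
  (* With this [l], the relative loss and the error [r / l] are each about [q] edges per vertex of
     [A]; doubled into degrees they make the [4 * q] of [regular]. *)
  pose l := 2 * q / (p * #|A|%:R).
  have l0 : 0 < l by rewrite divr_gt0 // mulr_gt0.
  have := inner_edges_lower A (2 * (b%:R * L)) l0.
  apply: le_trans; apply: le_Pr => // G /andP[_ /forall_inP h].
  have h1 : 2 * (inner_edges G A)%:R <= #|A|%:R * (p * (#|A|%:R - 1) - 4 * q).
    apply: (@le_trans _ _ (\sum_(x in A) #|nbrs G x A|%:R)).
      by rewrite -natr_sum -natrM ler_nat inner_edges_le_sum.
    rewrite mulr_natl -sumr_const; apply: ler_sum => x /h; exact: ltW.
  have h2 : 'C(#|A|, 2)%:R * 2 = #|A|%:R * (#|A|%:R - 1) :> R.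
    have := bin_ffact #|A| 2; rewrite !ffactnS ffactn0 muln1 => /(congr1 (fun k => k%:R : R)).
    rewrite !natrM => ->; congr (_ * _).
    by rewrite -[in RHS](prednK (_ : 0 < #|A|)%N) ?Ab; [rewrite -natr1; ring|lia].
  set B : R := #|A|%:R in b0 pb q2 h1 h2 l l0 *.
  rewrite -Ab -/B; set I : R := (inner_edges G A)%:R in h1 *; set C2 : R := 'C(_, _)%:R in h2 *.
  have e1 : p * B * l = 2 * q by rewrite /l mulrC divfK // lt0r_neq0.
  have e2 : L / l = q / 2.
    apply: (mulIf (lt0r_neq0 l0)); rewrite divfK ?lt0r_neq0 //.
    have -> : q / 2 * l = q ^+ 2 / (p * B) by rewrite /l expr2; set v := (p * B)^-1; clear; lra.
    by rewrite q2 mulrAC divff ?mul1r // lt0r_neq0.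
  have e3 : p * C2 * (1 - l) - 2 * (B * L) / l = (B * (p * (B - 1)) - B * (p * B * l) + p * l * B) / 2 - 2 * B * (L / l).
    have -> : C2 = B * (B - 1) / 2 by move: h2; clear; lra.
    have -> : 2 * (B * L) / l = 2 * B * (L / l) by rewrite !mulrA.
    by clear; lra.
  rewrite e3 e1 e2.
  have plB : 0 <= p * l * B by apply: mulr_ge0; [apply: mulr_ge0 => //|]; exact: ltW.
  by clear - h1 plB; lra.
rewrite card_draws.
apply: (@le_trans _ _ (N ^+ b * expR (- (2 * (b%:R * L))))).
  rewrite ler_wpM2r ?expR_ge0 // -natrX ler_nat.
  by apply: leq_trans (ffact_le_exp _ _); rewrite -bin_ffact leq_pmulr // fact_gt0.
rewrite -LN -expRM_natl -expRD ler_expR.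
have : 2 <= b%:R :> R by rewrite (ler_nat R 2).
by clear - L1; nra.
Qed.

(** As [p <= 1 / 4], the ratio [sqrt p] is at most [1 / 2] and the losses add up to at most
    [6 * lam]. By the hypothesis this is half of the main term, so that squaring leaves a quarter of
    [p ^+ j * #|A|]. *)
Lemma regular_chain G A (L : R) j : 1 <= L -> p <= 1 / 4 -> regular (25 * L) G ->
  12 * Num.sqrt L <= Num.sqrt p ^+ j * Num.sqrt #|A|%:R ->
  exists K : {set T}, [/\ K \subset A, #|K| = j, clique G K &
    p ^+ j * #|A|%:R / 4 <= #|A :&: common G K|%:R].
Proof.
move=> L1 p4 hreg hj.
set q := Num.sqrt p in hj *; set lam := Num.sqrt L in hj *; set y0 := Num.sqrt #|A|%:R in hj *.
have q0 : 0 <= q by exact: sqrtr_ge0.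
have qq : q ^+ 2 = p by exact: sqr_sqrtr.
have q2 : q <= 1 / 2.
  rewrite -(ler_pXn2r (n := 2)) ?nnegrE ?divr_ge0 // qq; lra.
have L0 : 0 <= L by lra.
have lam2 : lam ^+ 2 = L by exact: sqr_sqrtr.
have lam0 : 1 <= lam.
  rewrite -(ler_pXn2r (n := 2)) ?nnegrE ?sqrtr_ge0 // lam2; lra.
have y00 : 0 <= y0 by exact: sqrtr_ge0.
(* With [y_i = sqrt |A :&: common G K_i|], a step reads [y_(i+1) >= q * y_i - 3 * lam],
   so that the accumulated loss is a geometric sum. *)
have chain i : (i <= j)%N -> exists K : {set T}, [/\ K \subset A, #|K| = i, clique G K &
    q ^+ i * y0 - 6 * lam <= Num.sqrt #|A :&: common G K|%:R].
  elim: i => [_|i IHi ij].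
    exists set0; rewrite sub0set cards0; split=> //.
      by apply/cliqueP => x y; rewrite inE.
    have -> : A :&: common G set0 = A.
      by apply/setIidPl/subsetP => x _; rewrite inE; apply/forall_inP => u; rewrite inE.
    by rewrite expr0 mul1r -/y0; clear - lam0; lra.
  have [K [KA Ki cK hK]] := IHi (ltnW ij).
  set B := A :&: common G K in hK; set y := Num.sqrt _ in hK.
  have y_ge0 : 0 <= y by exact: sqrtr_ge0.
  have yy : y ^+ 2 = #|B|%:R by rewrite sqr_sqrtr.
  have hq : 12 * lam <= q ^+ i.+1 * y0.
    apply: le_trans hj _; rewrite ler_wpM2r // ler_wiXn2l //; clear - q2; lra.
  have hqy : q ^+ i.+1 * y0 - 3 * lam <= q * y.
    have := ler_wpM2l q0 hK; rewrite mulrBr mulrA -exprS => h.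
    have : q * (6 * lam) <= 1 / 2 * (6 * lam) by rewrite ler_wpM2r // mulr_ge0 //; clear - lam0; lra.
    by move: h; clear; lra.
  have hqy9 : 9 * lam <= q * y by move: hq hqy; clear; lra.
  have pB : p * #|B|%:R = (q * y) ^+ 2 by rewrite exprMn qq yy.
  have cB : 25 * L <= p * #|B|%:R.
    rewrite pB -lam2; move: hqy9 lam0; clear; nra.
  move/forallP/(_ B)/implyP/(_ cB)/exists_inP : (hreg) => [x xB].
  have -> : 25 * L / 25 = L by field.
  have -> : Num.sqrt (p * #|B|%:R * L) = q * y * lam.
    rewrite pB -lam2 -exprMn sqrtr_sqr ger0_norm // !mulr_ge0 //; exact: le_trans ler01 lam0.
  have -> : p * (#|B|%:R - 1) = (q * y) ^+ 2 - p by rewrite mulrBr pB mulr1.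
  move=> hx; have [xA xK] : x \in A /\ {in K, forall u, adj G x u}.
    by move: xB; rewrite /B inE => /andP[xA]; rewrite inE => /forall_inP.
  have xnK : x \notin K by apply/negP => /xK; rewrite adj_irr.
  exists (x |: K); split.
  - by rewrite subUset sub1set xA.
  - by rewrite cardsU1 xnK Ki.
  - exact: clique_ext.
  have -> : A :&: common G (x |: K) = nbrs G x B.
    apply/setP => w; rewrite /B in_setI [RHS]in_set in_setI -andbA; congr (_ && _); rewrite !in_set.
    apply/forall_inP/andP => [h|[/forall_inP h1 h2] u].
      split; last by rewrite adj_sym h // !inE eqxx.
      by apply/forall_inP => u uK; apply: h; rewrite !inE uK orbT.
    by rewrite in_setU1 => /predU1P[->|/h1//]; rewrite adj_sym.
  apply: le_trans (_ : q * y - 3 * lam <= _); first by move: hqy; clear; lra.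
  have t0 : 0 <= q * y - 3 * lam by move: hqy9 lam0; clear; lra.
  rewrite -[leLHS]ger0_norm // -sqrtr_sqr ler_sqrt //; last first.
  apply: le_trans hx; move: hqy9 lam0 p1; clear; nra.
have [K [KA Kj cK hK]] := chain j (leqnn j).
exists K; split=> //.
set y := Num.sqrt _ in hK.
have yy : y ^+ 2 = #|A :&: common G K|%:R by rewrite sqr_sqrtr.
rewrite -yy.
have -> : p ^+ j * #|A|%:R / 4 = (q ^+ j * y0 / 2) ^+ 2.
  by rewrite !exprMn -exprM mulnC exprM qq sqr_sqrtr // exprVn; field.
have h : q ^+ j * y0 / 2 <= y by move: hK hj; clear; lra.
apply: lerXn2r; rewrite ?nnegrE ?sqrtr_ge0 // divr_ge0 // mulr_ge0 // exprn_ge0 //.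
Qed.

(** A vertex adjacent to all of [C :|: K] lies in [common G K] because of [K], and then in [B]
    because [C] is unextended there. *)
Lemma closed_clique_of_common G A K (D : R) a k : (1 < k)%N ->
  K \subset A -> clique G K -> (a <= #|A :&: common G K|)%N ->
  ~~ bad_set D a k G (common G K) -> exists B : {set T}, closed_clique G A B.
Proof.
move=> k1 KA cK aK; rewrite negb_or => /andP[_ /existsPn h].
have [B] : exists B, B \in [set B : {set T} | B \subset A :&: common G K & #|B| == a].
  by apply/set0Pn; rewrite -card_gt0 cards_draws bin_gt0.
rewrite inE subsetI => /andP[/andP[BA BK] Ba].
have := h B; rewrite BK Ba /= negbK => /existsP[C /and4P[CB /eqP Ck cC /forall_inP uC]].
have CK w u : w \in C -> u \in K -> adj G w u.
  move=> wC uK; have := subsetP BK w (subsetP CB w wC).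
  by rewrite inE => /forall_inP; apply.
exists (C :|: K); apply/and4P; split.
- by rewrite subUset KA (subset_trans CB BA).
- apply/cliqueP => x y; rewrite !inE => /orP[xC|xK] /orP[yC|yK] xy.
  + by move/cliqueP: cC; apply.
  + exact: CK.
  + by rewrite adj_sym; exact: CK.
  + by move/cliqueP: cK; apply.
- by apply: leq_trans (subset_leq_card (subsetUl _ _)); rewrite Ck.
- apply/forallP => w; apply/implyP => /forall_inP hw; apply: (subsetP BA).
  apply/negPn/negP => wB.
  have wK : w \in common G K.
    by rewrite inE; apply/forall_inP => u uK; apply: hw; rewrite inE uK orbT.
  have := uC w; rewrite inE wB wK => /(_ isT)/negP; apply.
  by apply/forall_inP => u uC'; apply: hw; rewrite inE uC'.
Qed.

(** The union bound runs over the [N ^+ j] possible [K] and not over the sets [A], all of which are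
    covered at once by [regular] and [bad_set]. *)
Lemma lower_bound_chained_cliques (s a j k : nat) (m D L q : R) : (1 < k)%N ->
  1 <= L -> expR L = N -> p <= 1 / 4 -> 0 <= q ->
  12 * Num.sqrt L <= Num.sqrt p ^+ j * Num.sqrt s%:R ->
  a%:R <= p ^+ j * s%:R / 4 ->
  (forall W, #|W|%:R <= m -> Pr p (fun G => bad_set D a k G W) <= q) ->
  Pr p (fun G => ~~ [forall A : {set T}, (#|A| == s) ==> [exists K : {set T}, closed_clique G A K]])
    <= (N + 1) * expR (- (2 * L)) + N ^+ j * expR (- (m / 2 - N * p ^+ j)) + N ^+ j * q.
Proof.
move=> k1 L1 LN p4 q0 hj ha hq.
pose E1 G := ~~ regular (25 * L) G.
pose E2 G := [exists (K : {set T} | #|K| == j), m <= #|common G K|%:R].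
pose E3 G := [exists (K : {set T} | #|K| == j),
  (#|common G K|%:R <= m) && bad_set D a k G (common G K)].
apply: (@le_trans _ _ (Pr p (fun G => (E1 G || E2 G) || E3 G))).
  apply: le_Pr => // G; apply: contraNT; rewrite !negb_or negbK => /andP[/andP[hreg /existsPn n2] /existsPn n3].
  apply/forallP => A; apply/implyP => /eqP As; apply/existsP.
  have [|K [KA Kj cK hK]] := regular_chain L1 p4 hreg (A := A) (j := j); first by rewrite As.
  apply: (@closed_clique_of_common _ _ K D a k) => //.
    by rewrite -(ler_nat R); apply: le_trans ha _; rewrite -As.
  have := n2 K; have := n3 K; rewrite Kj eqxx /= -ltNge negb_and => /orP[/negP n|//] h.
  by case: n; exact: ltW.
apply: le_trans (Pr_or p0 p1 _ _) _; apply: lerD.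
  apply: le_trans (Pr_or p0 p1 _ _) _; apply: lerD; first exact: regular_prob.
  apply: (@le_trans _ _ (#|[set K : {set T} | #|K| == j]|%:R * expR (- (m / 2 - N * p ^+ j)))).
    apply: (Pr_exists_in_le p0 p1) => K /eqP Kj.
    apply: le_trans (common_card_prob K _); apply: le_Pr => // G; rewrite Kj; apply: le_trans.
    by apply: eq_ler; field.
  rewrite ler_wpM2r ?expR_ge0 // -natrX ler_nat card_draws.
  by apply: leq_trans (ffact_le_exp _ _); rewrite -bin_ffact leq_pmulr // fact_gt0.
apply: (@le_trans _ _ (#|[set K : {set T} | #|K| == j]|%:R * q)).
  by apply: (Pr_exists_in_le p0 p1) => K _; exact: bad_common_prob.
rewrite ler_wpM2r // -natrX ler_nat card_draws.
by apply: leq_trans (ffact_le_exp _ _); rewrite -bin_ffact leq_pmulr // fact_gt0.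
Qed.

(** The case of an empty [K], whose common neighbourhood is everything. *)
Lemma lower_bound_open_cliques (s k : nat) (D q : R) : (1 < k)%N ->
  Pr p (fun G => bad_set D s k G [set: T]) <= q ->
  Pr p (fun G => ~~ [forall A : {set T}, (#|A| == s) ==> [exists K : {set T}, closed_clique G A K]]) <= q.
Proof.
move=> k1; apply: le_trans; apply: le_Pr => // G; apply: contraNT => nb.
have cT : common G set0 = [set: T].
  by apply/setP => w; rewrite !inE; apply/forall_inP => u; rewrite inE.
apply/forallP => A; apply/implyP => /eqP As; apply/existsP.
apply: (@closed_clique_of_common _ _ set0 D s k) => //; rewrite ?sub0set //.
- by apply/cliqueP => x y; rewrite inE.
- by rewrite cT setIT As.
- by rewrite cT.
Qed.

End Reduction.

(** * Choice of parameters *)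

(** The threshold [1600 = 40 ^ 2] comes from here: [expR (L / 40) >= L / 40] and
    [(L / 40) ^+ 2 >= L]. *)
Lemma expR_ge_exp20 (R : realType) (L : R) : 1600 <= L -> L ^+ 20 <= expR L.
Proof.
move=> hL.
have -> : L = 40%:R * (L / 40) by field.
rewrite expRM_natl; apply: (@le_trans _ _ ((L / 40) ^+ 40)).
  have -> : (L / 40) ^+ 40 = ((L / 40) ^+ 2) ^+ 20 by rewrite -exprM.
  apply: lerXn2r; rewrite ?nnegrE; nra.
have h := expR_ge1Dx (L / 40).
by apply: lerXn2r; rewrite ?nnegrE ?expR_ge0 //; move: h hL; clear; lra.
Qed.

(* [L], [u] and [lam] stand for [ln n], [sqrt p] and [sqrt (ln n)]. *)
Section Asymptotics.
Variables (R : realType) (T : finType) (p L u lam : R).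
Hypotheses (p0 : 0 <= p) (p1 : p <= 1) (u0 : 0 <= u) (uu : u ^+ 2 = p).
Hypotheses (lam_ge0 : 0 <= lam) (lamlam : lam ^+ 2 = L).
Local Notation N := (#|T|%:R : R).
Hypotheses (LN : expR L = N) (hL : 1600 <= L).
Implicit Types (G : graph T).
Local Notation chi G := ((clique_chromatic_number G)%:R : R).
Ltac focus_arith := clear -p0 p1 u0 uu lam_ge0 lamlam LN hL.

Lemma card_gt0_expR : 0 < N. Proof. by rewrite -LN expR_gt0. Qed.

Lemma log_ge1 : 1 <= L. Proof. by move: hL; lra. Qed.

Lemma log_gt0 : 0 < L. Proof. exact: lt_le_trans ltr01 log_ge1. Qed.

Lemma sqrt_p_le1 : u <= 1.
Proof. by rewrite -(ler_pXn2r (n := 2)) ?nnegrE // uu expr1n. Qed.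

Lemma sqrt_p_gt0 : 0 < p -> 0 < u.
Proof. by move=> pp; rewrite lt0r u0 andbT; apply: contraTneq pp => e; rewrite -uu e expr0n ltxx. Qed.

Lemma sqrt_log_ge1 : 1 <= lam.
Proof. by rewrite -(ler_pXn2r (n := 2)) ?nnegrE // lamlam expr1n log_ge1. Qed.

Lemma log_pow20 : L ^+ 20 <= N. Proof. by rewrite -LN; exact: expR_ge_exp20. Qed.

Lemma log_pow_le k (c : R) : (k <= 16)%N -> 0 <= c -> c <= L ^+ 4 -> c * L ^+ k <= N.
Proof.
move=> k16 c0 cL; apply: le_trans log_pow20.
have L1 := log_ge1; have L0 := log_gt0; have L00 := ltW L0.
apply: (@le_trans _ _ (L ^+ 4 * L ^+ k)); first by rewrite ler_wpM2r // exprn_ge0.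
rewrite -exprD ler_weXn2l //; lia.
Qed.

Lemma log_pow4 : 10 ^+ 6 <= L ^+ 4.
Proof.
have L0 := log_gt0; have h : 40 ^+ 4 <= L ^+ 4 :> R.
  by apply: lerXn2r; rewrite ?nnegrE ?(ltW L0) //; move: hL; lra.
by apply: le_trans h; lra.
Qed.

Lemma expR_log2 : N * expR (- (2 * L)) = N^-1.
Proof. by rewrite -LN -expRN -expRD; congr expR; ring. Qed.

Lemma expR_log3 : N ^+ 2 * expR (- (3 * L)) = N^-1.
Proof. by rewrite -LN -expRN -expRM_natl -expRD; congr expR; ring. Qed.

(** About [2 * L / p] vertices dominate by a union bound over [x]. The condition
    [p ^ (5/2) N >= lam] leaves room for that many vertices, and it is also the condition for
    [1 / p] to be the smaller term in the minimum. *)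
Lemma upper_dominating : 0 < p -> lam <= p ^+ 2 * u * N ->
  Pr p (fun G => 4 * (L / p) < chi G) <= N^-1.
Proof.
move=> pp hp; have N0 := card_gt0_expR; have L1 := log_ge1; have L0 := log_gt0; have lam1 := sqrt_log_ge1.
set k := (Num.truncn (2 * L / p)).+2.
have Lp : 0 < L / p by rewrite divr_gt0 // L0.
have pL : L <= L / p by rewrite ler_pdivlMr // ler_piMr // ltW.
have k1 : 2 * L / p < k.-1%:R by exact: truncnS_gt.
have k2 : k%:R <= 4 * (L / p).
  have : (Num.truncn (2 * L / p))%:R <= 2 * L / p by rewrite truncn_le -mulrA mulr_ge0 // ltW.
  rewrite /k -addn2 natrD => h; move: h pL hL; focus_arith; lra.
have up := sqrt_p_gt0 pp.
have kN : (k <= #|T|)%N.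
  rewrite -(ler_nat R); apply: le_trans k2 _.
  rewrite mulrA ler_pdivrMr // mulrC; rewrite leNgt; apply/negP => hlt.
  have h1 : 1 <= 4 * L * u ^+ 3.
    apply: le_trans lam1 _; apply: le_trans hp _; rewrite -uu.
    have -> : (u ^+ 2) ^+ 2 * u * N = u ^+ 3 * (N * u ^+ 2) by ring.
    rewrite uu [leRHS]mulrC ler_wpM2l ?exprn_ge0 //; apply: ltW; rewrite mulrC; move: hlt; rewrite [L * 4]mulrC [N * p]mulrC; exact.
  have h2 : 1 <= 4 * L * p.
    apply: le_trans h1 _; rewrite ler_wpM2l ?mulr_ge0 ?(ltW L0) //.
    by rewrite -[leRHS]uu ler_wiXn2l // sqrt_p_le1.
  have : 16 * L ^+ 2 <= N by apply: log_pow_le; [by []|exact: ler0n|move: log_pow4; focus_arith; lra].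
  move=> h3.
  have h4 : N * p * (4 * L) < L * 4 * (4 * L) by rewrite ltr_pM2r // mulr_gt0.
  have h5 : N <= N * (4 * L * p) by rewrite ler_peMr // ltW.
  by move: h3 h4 h5; focus_arith; lra.
apply: (@le_trans _ _ (Pr p (fun G => k < clique_chromatic_number G)%N)).
  by apply: le_Pr => // G h; rewrite -(ltr_nat R); apply: le_lt_trans k2 h.
apply: le_trans (chi_prob_dominating p0 p1 _) _; first by rewrite kN.
rewrite -expR_log2 ler_wpM2l ?(ltW N0) // ler_expR lerN2 [p * _]mulrC -ler_pdivrMr //; exact: ltW.
Qed.

Lemma upper_degree : Pr p (fun G => 2 * (p * N) + 6 * L < chi G) <= N^-1.
Proof.
rewrite -expR_log2; apply: le_trans (@chi_prob_degree R T p p0 p1 L (ltW log_gt0)).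
apply: le_Pr => // G; apply: le_lt_trans; move: hL; focus_arith; lra.
Qed.

Lemma sqr_le_expR (x : R) : 0 <= x -> x ^+ 2 <= expR x.
Proof.
move=> x0; have -> : x = 2%:R * (x / 2) by field.
rewrite expRM_natl; apply: lerXn2r; rewrite ?nnegrE ?expR_ge0 //; first by lra.
have e2 : 2 <= expR 1 :> R by have := expR_ge1Dx (1 : R); lra.
have -> : x / 2 = 1 + (x / 2 - 1) by ring.
rewrite expRD; have h := expR_ge1Dx (x / 2 - 1).
have h0 := expR_ge0 (x / 2 - 1); nra.
Qed.

(** Degrees are at most [4 * p * N] and codegrees at most [8 * L * p ^+ 2 * N]; the root of their
    product is at most [7 * L * p ^ (3/2) N / lam], as [32 <= 7 ^ 2]. *)
Lemma upper_triangle : 0 < p -> 1 <= p ^+ 2 * N -> p ^+ 2 * u * N <= lam ->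
  Pr p (fun G => 14 * (L * (p * u * N / lam)) + 257 * (p * N * expR (- (p ^+ 2 * N))) + 516 * L < chi G)
    <= 3 / N.
Proof.
move=> pp hx hp; have N0 := card_gt0_expR; have L1 := log_ge1; have L0 := log_gt0; have lam1 := sqrt_log_ge1.
set x := p ^+ 2 * N in hx *.
have up := sqrt_p_gt0 pp.
have lam0 : 0 < lam by apply: lt_le_trans lam1.
(* Otherwise [p ^ (5/2) N = u ^+ 5 * N] would exceed [lam], since [N >= L ^+ 20]. This keeps the
   second order errors in [lone_degree_prob] below 2. *)
have usmall : 7 * (L * lam) * u <= 1.
  rewrite leNgt; apply/negP => hlt.
  have h1 : 1 < (7 * (L * lam) * u) ^+ 5 by rewrite exprn_egt1.
  have : (7 * (L * lam) * u) ^+ 5 = 7 ^+ 5 * L ^+ 5 * lam ^+ 4 * lam * u ^+ 5 by ring.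
  rewrite (_ : lam ^+ 4 = L ^+ 2); last by rewrite -lamlam -exprM.
  move=> h2; rewrite h2 in h1.
  have h3 : u ^+ 5 * N <= lam by apply: le_trans hp; rewrite -uu; apply: eq_ler; ring.
  have h4 : 7 ^+ 5 * L ^+ 5 * L ^+ 2 * lam * lam <= N.
    have -> : 7 ^+ 5 * L ^+ 5 * L ^+ 2 * lam * lam = 7 ^+ 5 * L ^+ 8 by rewrite -[in RHS]lamlam; rewrite -lamlam; ring.
    by apply: log_pow_le; [by []|exact: exprn_ge0|move: log_pow4; focus_arith; lra].
  have u5 : 0 < u ^+ 5 by rewrite exprn_gt0.
  have q0 : 0 < 7 ^+ 5 * L ^+ 5 * L ^+ 2 * lam by rewrite !mulr_gt0 ?exprn_gt0.
  move: h1 h3 h4 q0 u5 N0; set q := _ * lam; focus_arith; nra.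
have xp : x * p <= lam * u.
  rewrite /x -{2}uu; move: hp u0; rewrite (_ : p ^+ 2 * N * u ^+ 2 = p ^+ 2 * u * N * u); last by ring.
  by move=> h1 h2; rewrite ler_wpM2r.
have Lxp : 7 * (L * (x * p)) <= 1.
  apply: le_trans usmall.
  by rewrite -(mulrA 7) ler_wpM2l // -(mulrA L) ler_wpM2l ?(ltW L0).
have x0 : 0 <= x by apply: le_trans ler01 hx.
pose f := p * N * expR (- x).
have f0 : 0 <= f by rewrite !mulr_ge0 ?expR_ge0.
pose k := (Num.truncn (f + L)).+1.
have fL0 : 0 <= f + L by rewrite addr_ge0 // ltW.
have k1 : f + L < k%:R by exact: truncnS_gt.
have k2 : k%:R <= f + 2 * L.
  have : (Num.truncn (f + L))%:R <= f + L by rewrite truncn_le.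
  by rewrite /k -natr1; move: hL; focus_arith; lra.
have fpp : N * f * p ^+ 3 <= 1.
  have -> : N * f * p ^+ 3 = x ^+ 2 * expR (- x) by rewrite /f /x; ring.
  by rewrite expRN ler_pdivrMr ?expR_gt0 // mul1r sqr_le_expR.
have fp2 : f <= p * N by rewrite /f ler_piMr ?mulr_ge0 // -expR0 ler_expR oppr_le0.
have hk : k.+1%:R * p ^+ 2 + N * k%:R * p ^+ 3 <= 2.
  have a1 : k.+1%:R * p ^+ 2 <= (p * N + 3 * L) * p ^+ 2.
    rewrite ler_wpM2r ?exprn_ge0 // -natr1; move: k2 fp2 hL; focus_arith; lra.
  have a2 : (p * N + 3 * L) * p ^+ 2 <= 4 * (L * (x * p)).
    have b1 : p * N * p ^+ 2 = x * p by rewrite /x; ring.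
    have b2 : p ^+ 2 <= x * p.
      apply: (@le_trans _ _ p); last by rewrite ler_peMl.
      by rewrite expr2 ler_piMr.
    have b3 : x * p <= L * (x * p) by rewrite ler_peMl ?mulr_ge0 //; move: hL; focus_arith; lra.
    have b4 : L * p ^+ 2 <= L * (x * p) by rewrite ler_wpM2l // ltW.
    by move: b1 b3 b4; focus_arith; lra.
  have a3 : N * k%:R * p ^+ 3 <= 1 + 2 * (L * (x * p)).
    have q0 : 0 <= N * p ^+ 3 by rewrite mulr_ge0 ?exprn_ge0 // ltW.
    have := ler_wpM2l q0 k2.
    have -> : N * p ^+ 3 * k%:R = N * k%:R * p ^+ 3 by ring.
    have -> : N * p ^+ 3 * (f + 2 * L) = N * f * p ^+ 3 + 2 * (L * (x * p)) by rewrite /x; ring.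
    by move: fpp; focus_arith; lra.
  by move: a1 a2 a3 Lxp; focus_arith; lra.
pose d1 := 2 * (p * N) + 2 * (2 * L); pose d2 := 2 * (p ^+ 2 * N) + 2 * (3 * L).
pose E1 G := [exists y, d1 <= #|[set z | adj G y z]|%:R].
pose E2 G := [exists v : T * T, (v.1 != v.2) && (d2 <= (codegree G v.1 v.2)%:R)].
pose E3 G := [exists v, (257 * k <= #|[set z | lone_edge G v z]|)%N].
apply: (@le_trans _ _ (Pr p (fun G => (E1 G || E2 G) || E3 G))).
  apply: le_Pr => // G; apply: contraTT; rewrite !negb_or -leNgt => /andP[/andP[/existsPn n1 /existsPn n2] /existsPn n3].
  have pN0 : 0 <= p * N by rewrite mulr_ge0.
  have d10 : 0 <= d1 by rewrite /d1; move: pN0 L0; focus_arith; lra.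
  have d20 : 0 <= d2 by rewrite /d2 -/x; move: x0 L0; focus_arith; lra.
  have := @chi_le_triangle_real R T G d1 d2 (257 * k) d10 d20.
  move=> h; apply: (le_trans (h _ _ _)).
  - by move=> y; apply: ltW; rewrite ltNge; exact: n1.
  - by move=> y z yz; apply: ltW; rewrite ltNge; have := n2 (y, z); rewrite /= yz.
  - by move=> y; apply: ltnW; rewrite ltnNge; exact: n3.
  have pL : 3 * L <= p * N.
    have -> : p * N = x / p by rewrite /x; field; apply: lt0r_neq0.
    rewrite ler_pdivlMr //; apply: (@le_trans _ _ 1) => //.
    have b1 : L * p <= L * (x * p) by rewrite ler_wpM2l ?(ltW L0) // ler_peMl.
    have b2 : 0 <= L * p by rewrite mulr_ge0 ?(ltW L0).
    by apply: le_trans Lxp; move: b1 b2; focus_arith; lra.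
  have dd : d1 * d2 <= (7 * (L * (p * u * N / lam))) ^+ 2.
    have a1 : d1 <= 4 * (p * N) by rewrite /d1; move: pL pN0 L0; set m := p * N; move: m => m; focus_arith; lra.
    have a2 : d2 <= 8 * (L * x).
      rewrite /d2 -/x; have : L <= L * x by rewrite ler_peMr // ltW.
      have : x <= L * x by rewrite ler_peMl //; move: hL; focus_arith; lra.
      by focus_arith; lra.
    apply: le_trans (ler_pM d10 d20 a1 a2) _.
    have -> : (7 * (L * (p * u * N / lam))) ^+ 2 = 49 * L ^+ 2 * p ^+ 2 * u ^+ 2 * N ^+ 2 / lam ^+ 2.
      by field; apply: lt0r_neq0.
    rewrite uu lamlam.
    have -> : 49 * L ^+ 2 * p ^+ 2 * p * N ^+ 2 / L = 49 * (L * (p ^+ 3 * N ^+ 2)).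
      by field; apply: lt0r_neq0.
    have -> : 4 * (p * N) * (8 * (L * x)) = 32 * (L * (p ^+ 3 * N ^+ 2)) by rewrite /x; ring.
    have : 0 <= L * (p ^+ 3 * N ^+ 2) by rewrite !mulr_ge0 ?exprn_ge0 // ltW.
    by focus_arith; lra.
  have t0 : 0 <= 7 * (L * (p * u * N / lam)).
    by rewrite !mulr_ge0 ?invr_ge0 ?(ltW L0) // ltW.
  have sq : Num.sqrt (d1 * d2) <= 7 * (L * (p * u * N / lam)).
    by rewrite -[leRHS]ger0_norm // -sqrtr_sqr ler_sqrt // sqr_ge0.
  rewrite natrM -/f; have : 257 * k%:R <= 257 * (f + 2 * L) by rewrite ler_wpM2l.
  by move: sq hL; focus_arith; lra.
have -> : 3 / N = N^-1 + N^-1 + N^-1 by focus_arith; lra.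
apply: le_trans (Pr_or p0 p1 _ _) _; apply: lerD.
  apply: le_trans (Pr_or p0 p1 _ _) _; apply: lerD.
    by rewrite -expR_log2; exact: degree_ge_prob.
  by rewrite -expR_log3; exact: codegree_ge_prob.
apply: le_trans (lone_degree_prob p0 p1 (b := 256) _ _ _ hk) _ => //.
  by rewrite -/f -/x; apply: ltW; apply: le_lt_trans k1; rewrite lerDl ltW.
rewrite -expR_log2 ler_wpM2l ?(ltW N0) //.
(* [256 = 16 * 16] dominates [expR 4], whence [b = 256] and the coefficient 257. *)
have e2 : expR 2 / 256%:R <= expR (- 2) :> R.
  rewrite ler_pdivrMr // expRN -ler_pdivrMl ?invr_gt0 ?expR_gt0 // invrK.
  have h := expR2_le16 R; have h0 := expR_ge0 (2 : R).
  apply: (@le_trans _ _ (16 * 16)); first by apply: ler_pM.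
  lra.
apply: (@le_trans _ _ (expR (- 2) ^+ k)).
  by apply: lerXn2r; rewrite ?nnegrE ?expR_ge0 // divr_ge0 // expR_ge0.
by rewrite -expRM_natl ler_expR; move: k1 f0; focus_arith; lra.
Qed.

End Asymptotics.

(** * Parameters for the lower bounds *)

Section LowerAsymptotics.
Variables (R : realType) (T : finType) (p L u C : R).
Hypotheses (p0 : 0 <= p) (p1 : p <= 1) (u0 : 0 <= u) (uu : u ^+ 2 = p).
Local Notation N := (#|T|%:R : R).
Hypotheses (LN : expR L = N) (hL : 1600 <= L) (hC : 10 ^+ 16 <= C).
Implicit Types (G : graph T).
Local Notation chi G := ((clique_chromatic_number G)%:R : R).
Ltac focus_arith := clear -p0 p1 u0 uu LN hL hC.

Lemma chi_lt_prob (s : nat) (B : R) : (0 < s)%N -> B * s%:R <= N ->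
  Pr p (fun G => chi G < B) <=
  Pr p (fun G => ~~ [forall A : {set T},
    (#|A| == s) ==> [exists K : {set T}, closed_clique G A K]]).
Proof.
move=> s0 hB; apply: le_Pr => // G; apply: contraTT; rewrite negbK -leNgt => /forallP hA.
have := @chi_ge_closed_clique T G s s0 _.
rewrite -(ler_nat R) natrM => h; rewrite -(ler_pM2r (_ : 0 < s%:R)) ?ltr0n //.
apply: le_trans hB _; apply: h => A /eqP As.
by have /implyP/(_ As)/existsP := hA A.
Qed.

(** [s] is about [C * L ^+ 2 / (p * z)], that is [N] divided by the claimed bound. The roughly
    [s ^+ 2 * z] open pairs then contain about [C * L ^+ 2 * s] expected edges, against [L * s] in
    the exponent of the union bound. *)
Lemma lower_edges : C * L ^+ 2 <= p * expR (- (N * p ^+ 2)) * N ->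
  Pr p (fun G => chi G < p * expR (- (N * p ^+ 2)) * N / (C * L ^+ 2)) <= 5 / N.
Proof.
set x := N * p ^+ 2; set z := expR (- x) => h.
have N0 := card_gt0_expR LN; have L1 := log_ge1 hL; have L0 := log_gt0 hL.
have z0 : 0 < z by exact: expR_gt0.
have x0 : 0 <= x by rewrite mulr_ge0 ?exprn_ge0 // ltW.
have z1 : z <= 1 by rewrite /z -expR0 ler_expR oppr_le0.
have C0 : 0 < C by apply: lt_le_trans hC; rewrite exprn_gt0.
have C4 : 10 ^+ 4 <= C by apply: le_trans hC; focus_arith; lra.
have CL0 : 0 < C * L ^+ 2 by rewrite mulr_gt0 // exprn_gt0.
have L2 : 1 <= L ^+ 2 by rewrite exprn_ege1.
have CL1 : 10 ^+ 4 <= C * L ^+ 2 by apply: le_trans C4 _; rewrite ler_peMr // ltW.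
have pp : 0 < p.
  rewrite lt0r p0 andbT; apply: contraTneq h => ->.
  by rewrite !mul0r -ltNge.
have up : 0 < u := sqrt_p_gt0 u0 uu pp.
have u1 : u <= 1 := sqrt_p_le1 p1 u0 uu.
have pu : p <= u by rewrite -uu expr2 ler_piMr.
set y := p * z in h *.
have y0 : 0 < y by rewrite mulr_gt0.
have yp : y <= p by rewrite ler_piMr.
set Q := C * L ^+ 2 / y.
have Qy : Q * y = C * L ^+ 2 by rewrite /Q divfK // lt0r_neq0.
have QN : Q <= N by rewrite ler_pdivrMr // [N * y]mulrC.
have Q2 : 2 <= Q.
  rewrite ler_pdivlMr //; apply: (@le_trans _ _ 2); first by rewrite ler_piMr // (le_trans yp).
  by apply: le_trans CL1; focus_arith; lra.
set s := Num.truncn Q; set S := (s%:R : R).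
have sQ : S <= Q by rewrite truncn_le; apply: le_trans Q2.
have Qs : Q <= 2 * S.
  have : Q < S + 1 by rewrite natr1; exact: truncnS_gt.
  by move: Q2; focus_arith; lra.
have S1 : 1 <= S by move: Q2 Qs; focus_arith; lra.
have s0 : (0 < s)%N by rewrite -(ltr_nat R); apply: lt_le_trans S1.
have S0 : 0 < S by apply: lt_le_trans S1.
have a : C * L ^+ 2 <= 2 * S * y by rewrite -Qy ler_wpM2r // ltW.
(* Otherwise [z * N <= 1], and the right side of the hypothesis would be at most [p]. *)
have xL : x <= L.
  rewrite leNgt; apply/negP => Lx.
  have : z * N <= 1 by rewrite -LN -expRD -expR0 ler_expR; move: Lx; focus_arith; lra.
  move: h; rewrite /y -mulrA => h1 h2.
  have := le_trans h1 (ler_piMr p0 h2) => h3.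
  by move: p1 h3 CL1; focus_arith; lra.
have k1 : C * L ^+ 2 * (N * p) <= 2 * S.
  apply: (@le_trans _ _ (2 * S * y * (N * p))); first by rewrite ler_wpM2r // mulr_ge0 // ltW.
  have -> : 2 * S * y * (N * p) = 2 * S * (x * z) by rewrite /y /x; ring.
  rewrite ler_piMr ?mulr_ge0 // ?(ltW S0) // /z expRN ler_pdivrMr ?expR_gt0 // mul1r.
  by have := expR_ge1Dx x; lra.
have k2 : C * L ^+ 2 <= 2 * S * u.
  by apply: le_trans a _; rewrite ler_wpM2l ?mulr_ge0 // ?(ltW S0) // (le_trans yp).
have k3 : C ^+ 2 * L ^+ 3 * N <= 4 * (S ^+ 2 * z ^+ 2).
  rewrite -(ler_pM2r L0); apply: (@le_trans _ _ ((2 * S * y) ^+ 2 * N)).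
    have -> : C ^+ 2 * L ^+ 3 * N * L = (C * L ^+ 2) ^+ 2 * N by ring.
    rewrite ler_wpM2r ?(ltW N0) //; apply: lerXn2r => //; rewrite nnegrE ?(ltW CL0) //.
    by rewrite !mulr_ge0 ?(ltW S0) ?(ltW z0).
  have -> : (2 * S * y) ^+ 2 * N = 4 * (S ^+ 2 * z ^+ 2) * x by rewrite /y /x; ring.
  by rewrite ler_wpM2l // !mulr_ge0 ?exprn_ge0 ?(ltW S0) ?(ltW z0).
(* The errors in the exponent of [(1 - p) ^+ k] in [pw] add up to [14 * L * u]; they must stay below
   [1 / 2] for the loss to be a factor 2. *)
have us : 28 * L * u <= 1.
  rewrite leNgt; apply/negP => hlt.
  have h1 : 1 < (28 * L * u) ^+ 4 by rewrite exprn_egt1.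
  have e : (28 * L * u) ^+ 4 = 28 ^+ 4 * L ^+ 4 * p ^+ 2 by rewrite -uu; ring.
  have h2 : 28 ^+ 4 * L ^+ 5 <= N.
    apply: (log_pow_le LN hL) => //; last by apply: le_trans (log_pow4 hL); lra.
  have h3 : 28 ^+ 4 * L ^+ 4 * p ^+ 2 * N <= 28 ^+ 4 * L ^+ 5.
    have -> : 28 ^+ 4 * L ^+ 4 * p ^+ 2 * N = 28 ^+ 4 * L ^+ 4 * x by rewrite /x; ring.
    have -> : 28 ^+ 4 * L ^+ 5 = 28 ^+ 4 * L ^+ 4 * L by ring.
    by rewrite ler_wpM2l // mulr_ge0 ?exprn_ge0 // ltW.
  have h4 : N < (28 * L * u) ^+ 4 * N by rewrite ltr_pMl.
  by rewrite e in h4; have := lt_le_trans h4 (le_trans h3 h2); rewrite ltxx.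
have Lu0 : 0 <= L * u by rewrite mulr_ge0 // ltW.
have Lp : L * p <= (L * u) * (1 / 28).
  have -> : L * p = (L * u) * u by rewrite -uu; ring.
  rewrite ler_wpM2l //.
  have : u <= L * u by rewrite ler_peMl.
  by move: us; focus_arith; lra.
have c1 : (8 * L + 2) * p <= 1 / 2.
  have : p <= L * p by rewrite ler_peMl.
  by move: Lp us; focus_arith; lra.
(* Makes the term [4 * l * N] equal to [S / 64], a fixed part of the budget [S / 16]. *)
set l := S / (256 * N).
have N256 : 0 < 256 * N by move: N0; focus_arith; lra.
have l0 : 0 < l by rewrite divr_gt0.
have lN : l * N = S / 256 by rewrite /l; field; apply: lt0r_neq0.
(* The degree cap from [degree_upper] with [l = u]. Multiplied by [p], its two errors are
   [2 * x * u] and [2 * L * u]; the choice [u = sqrt p] balances them. *)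
set d := N * p * (1 + 2 * u) + 2 * L / u.
have Lu' : 0 <= L / u by rewrite divr_ge0 // ltW.
have d0 : 0 <= d by rewrite /d -mulrA addr_ge0 ?mulr_ge0 ?addr_ge0 ?mulr_ge0 ?(ltW N0) ?(ltW L0) ?invr_ge0.
have s16 : N * (4 * ((8 * L + 2) * p) + 4 * l) + 2 * (1 + d) <= S / 16.
  have b1 : 10 ^+ 4 * (N * p * L) <= 2 * S.
    apply: le_trans k1; have -> : 10 ^+ 4 * (N * p * L) = 10 ^+ 4 * L * (N * p) by ring.
    rewrite ler_wpM2r ?mulr_ge0 ?(ltW N0) // ler_pM // ?(ltW L0) //.
    by rewrite expr2 ler_peMl // ltW.
  have b2 : 10 ^+ 4 * (L / u) <= 2 * S.
    rewrite mulrA ler_pdivrMr //; apply: le_trans k2.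
    by rewrite ler_pM // ?(ltW L0) // expr2 ler_peMl // ltW.
  have b3 : 10 ^+ 4 <= 2 * S by move: CL1 k2 u1 S0; focus_arith; nra.
  have b4 : N * p <= N * p * L by rewrite ler_peMr // mulr_ge0 // ltW.
  have b5 : N * p * u <= N * p by rewrite ler_piMr // mulr_ge0 // ltW.
  have -> : N * (4 * ((8 * L + 2) * p) + 4 * l) + 2 * (1 + d)
    = 32 * (N * p * L) + 10 * (N * p) + 4 * (l * N) + 2 + 4 * (N * p * u) + 4 * (L / u).
    by rewrite /d; ring.
  rewrite lN; move: b1 b2 b3 b4 b5.
  move: (N * p * L) (N * p) (N * p * u) (L / u) => t1 t2 t3 t4; focus_arith; lra.
have l12 : 0 < l <= 1 / 2.
  rewrite l0 /= /l ler_pdivrMr //; move: (le_trans sQ QN) N0; focus_arith; lra.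
have r3 : 3 * (3 * L / l) <= S * z ^+ 2 / 64.
  have -> : 3 * (3 * L / l) = 9 * 256 * (L * N) / S by rewrite /l; field; rewrite !lt0r_neq0.
  rewrite ler_pdivrMr //.
  have -> : S * z ^+ 2 / 64 * S = S ^+ 2 * z ^+ 2 / 64 by ring.
  have : 9 * 256 * 64 * 4 * (L * N) <= C ^+ 2 * L ^+ 3 * N.
    have -> : C ^+ 2 * L ^+ 3 * N = C ^+ 2 * L ^+ 2 * (L * N) by ring.
    rewrite ler_wpM2r ?mulr_ge0 ?(ltW L0) ?(ltW N0) //.
    apply: (@le_trans _ _ (C ^+ 2)); last by rewrite ler_peMr // sqr_ge0.
    apply: (@le_trans _ _ ((10 ^+ 4) ^+ 2)); first by lra.
    by apply: lerXn2r; rewrite ?nnegrE ?exprn_ge0 ?(ltW C0).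
  by move: k3; focus_arith; lra.
have n64 : 64 * N <= S ^+ 2 * z ^+ 2.
  have : 256 * N <= C ^+ 2 * L ^+ 3 * N.
    rewrite ler_wpM2r ?(ltW N0) //.
    apply: (@le_trans _ _ (C ^+ 2)); last by rewrite ler_peMr ?sqr_ge0 // exprn_ege1.
    apply: (@le_trans _ _ ((10 ^+ 4) ^+ 2)); first by lra.
    by apply: lerXn2r; rewrite ?nnegrE ?exprn_ge0 ?(ltW C0).
  by move: k3; focus_arith; lra.
have pw (k : nat) : k%:R <= d -> z / 2 <= (1 - p) ^+ k.
  move=> kd.
  have q1 : expR (- (p + 2 * p ^+ 2)) <= 1 - p.
    have p5 : p <= 1 / 5.
      have : p <= L * p by rewrite ler_peMl.
      by move: Lp us; focus_arith; lra.
    rewrite expRN -[leRHS]invrK ler_pV2 ?inE ?unitfE ?lt0r_neq0 ?expR_gt0 ?invr_gt0 //; last first.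
    - by move: p5; focus_arith; lra.
    - by move: p5; focus_arith; lra.
    apply: le_trans (expR_ge1Dx _).
    rewrite -[leLHS]mul1r ler_pdivrMr; last by move: p5; focus_arith; lra.
    have : 0 <= p ^+ 2 * (1 - 2 * p) by rewrite mulr_ge0 ?exprn_ge0 //; move: p5; focus_arith; lra.
    by focus_arith; lra.
  apply: (@le_trans _ _ (expR (- (p + 2 * p ^+ 2)) ^+ k)); last first.
    by apply: lerXn2r => //; rewrite nnegrE ?expR_ge0 // (le_trans _ q1) ?expR_ge0.
  rewrite -expRM_natl.
  apply: (@le_trans _ _ (expR (- x - 1 / 2))).
    rewrite expRD ler_wpM2l ?(ltW z0) // expRN lef_pV2 ?posrE ?expR_gt0 //.
    by apply: le_trans (expR_le_quad _) _; lra.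
  rewrite ler_expR -opprD mulrN lerN2.
  have pd : k%:R * (p + 2 * p ^+ 2) <= d * (p + 2 * p ^+ 2).
    by rewrite ler_wpM2r // addr_ge0 // mulr_ge0 // exprn_ge0.
  apply: le_trans pd _.
  have -> : d * (p + 2 * p ^+ 2) = x + 2 * (x * u) + 2 * (L * u)
     + 2 * (x * p) + 4 * (x * (p * u)) + 4 * (L * u * p).
    rewrite /d /x -uu; field; exact: lt0r_neq0.
  have xu : x * u <= L * u by rewrite ler_wpM2r.
  have xp : x * p <= L * u by apply: ler_pM.
  have xpu : x * (p * u) <= L * u by apply: ler_pM => //; rewrite ?mulr_ge0 // ler_piMl.
  have Lup : L * u * p <= L * u by rewrite ler_piMr.
  by move: xu xp xpu Lup us; focus_arith; lra.
apply: (le_trans (@chi_lt_prob s (y * N / (C * L ^+ 2)) s0 _)).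
  rewrite mulrAC ler_pdivrMr // mulrAC mulrC ler_wpM2l ?(ltW N0) //.
  by rewrite -Qy mulrC ler_wpM2r // ltW.
have c0 : 0 <= 8 * L by rewrite mulr_ge0 // ltW.
have r0 : 0 <= 3 * L by rewrite mulr_ge0 // ltW.
apply: (le_trans (lower_bound_edges p0 p1 l12 r0 z0 d0 c0 pw c1 s16 r3 n64)).
have -> : 5 / N = N^-1 + N^-1 + (N^-1 + N^-1) + N^-1 by ring.
apply: lerD; [apply: lerD; [apply: lerD | apply: lerD] |].
- rewrite -(expR_log2 LN).
  apply: (Pr_exists_le p0 p1) => v.
  have u12 : 0 < u <= 1 / 2.
    have : u <= L * u by rewrite ler_peMl.
    by rewrite up /=; move: us; focus_arith; lra.
  have pN : p * #|[set: T]|%:R <= N * p by rewrite cardsT mulrC.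
  apply: le_trans (degree_upper p0 p1 v (2 * L) u12 pN).
  apply: le_Pr => // G hd; apply: le_trans (ltW hd) _; apply: eq_ler.
  by rewrite /degree /nbrs; congr (_%:R); apply: eq_card => w; rewrite !inE.
- rewrite -(expR_log3 LN); apply: le_trans (codegree_ge_prob T p0 p1 (3 * L)).
  apply: le_Pr => // G /existsP[v /andP[v12 hv]]; apply/existsP; exists v; rewrite v12 /=.
  apply: le_trans (ltW hv); rewrite [p ^+ 2 * _]mulrC -/x; move: xL; focus_arith; lra.
- by rewrite (expR_log3 LN).
- rewrite -(expR_log3 LN) ler_wpM2r ?expR_ge0 // expr2 ler_peMr ?(ltW N0) //.
  by rewrite -LN -expR0 ler_expR ltW.
rewrite -/S -LN -expRM_natl -expRN -expRD ler_expR -/S.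
have : 2 * (L * S) <= p * (S ^+ 2 * z / 8).
  have -> : p * (S ^+ 2 * z / 8) = S * (2 * S * y) / 16 by rewrite /y; field.
  have : S * (C * L ^+ 2) <= S * (2 * S * y) by rewrite ler_wpM2l ?(ltW S0).
  have : 32 * (L * S) <= S * (C * L ^+ 2).
    have -> : S * (C * L ^+ 2) = C * L * (L * S) by ring.
    rewrite ler_wpM2r ?mulr_ge0 ?(ltW L0) ?(ltW S0) //.
    by move: C4 L1; focus_arith; nra.
  by focus_arith; lra.
have : L <= L * S by rewrite ler_peMr // ltW.
by focus_arith; lra.
Qed.

End LowerAsymptotics.

Ltac focus_arith p0 hL hC := clear -p0 hL hC.

(** [t] stands for the scale and [s] is about [C * L * N / t]. The bound on [N * p ^+ 3] makes
    triples with a light common neighbour a small fraction of all triples, [a5] controls the heavy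
    ones, and [a4] and [a3] are Janson's conditions for pairs and triples. *)
Lemma lower_sparse (R : realType) (T : finType) (p L u lam C t : R)
    (p0 : 0 <= p) (p1 : p <= 1) (u0 : 0 <= u) (uu : u ^+ 2 = p)
    (lam_ge0 : 0 <= lam) (lamlam : lam ^+ 2 = L)
    (LN : expR L = #|T|%:R) (hL : 1600 <= L) (hC : 10 ^+ 16 <= C)
    (tp : t * p <= 1) (ht : C * L <= t) :
  let N := #|T|%:R in t * lam <= p * u * N -> N * p ^+ 3 <= 1 / 10 ^+ 9 ->
  Pr p (fun G : graph T => (clique_chromatic_number G)%:R < t / (C * L)) <= 3 / N.
Proof.
move=> N tN d3.
rewrite -/N in LN; have N0 : 0 < N := card_gt0_expR LN; have L1 := log_ge1 hL; have L0 := log_gt0 hL.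
have C0 : 0 < C by apply: lt_le_trans hC; rewrite exprn_gt0.
have CL0 : 0 < C * L by rewrite mulr_gt0.
have C6 : 10 ^+ 6 <= C by apply: le_trans (hC); focus_arith p0 hL hC; lra.
have CL6 : 10 ^+ 6 <= C * L by apply: le_trans C6 _; rewrite ler_peMr // ltW.
have t0 : 0 < t by apply: lt_le_trans ht.
have lam1 : 1 <= lam by exact: sqrt_log_ge1 lam_ge0 lamlam hL.
have u1 : u <= 1 := sqrt_p_le1 p1 u0 uu.
have pN : C * L <= p * N.
  apply: le_trans ht _; apply: (@le_trans _ _ (t * lam)); first by rewrite ler_peMr // ltW.
  by apply: le_trans tN _; rewrite ler_wpM2r ?(ltW N0) // ler_piMr.
have tN1 : t <= N.
  apply: (@le_trans _ _ (t * lam)); first by rewrite ler_peMr // ltW.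
  by apply: le_trans tN _; rewrite ler_piMl ?(ltW N0) // mulr_ile1.
set Q := C * L * N / t.
have Qt : Q * t = C * L * N by rewrite /Q divfK // lt0r_neq0.
have Q6 : C * L <= Q by rewrite ler_pdivlMr // ler_wpM2l // ltW.
have Q0 : 0 < Q by apply: lt_le_trans Q6.
set s := Num.truncn Q; set S := (s%:R : R).
have sQ : S <= Q by rewrite truncn_le // ltW.
have Qs : Q <= 2 * S.
  have : Q < S + 1 by rewrite natr1; exact: truncnS_gt.
  by move: Q6 CL6; focus_arith p0 hL hC; lra.
have S6 : 6 <= S by move: Q6 CL6 Qs; focus_arith p0 hL hC; lra.
have S0 : 0 < S by move: S6; focus_arith p0 hL hC; lra.
have s0 : (0 < s)%N by rewrite -(ltr_nat R).
have a1 : C * L * lam <= 2 * S * (p * u).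
  rewrite -(ler_pM2r N0) mulrAC -Qt -[leLHS]mulrA.
  apply: (@le_trans _ _ (Q * (p * u * N))); first by rewrite ler_wpM2l // ltW.
  by rewrite mulrA ler_wpM2r ?(ltW N0) // ler_wpM2r // mulr_ge0.
have a2 : C * L * (N * p) <= 2 * S.
  by apply: le_trans Qs; rewrite mulrA -Qt -mulrA ler_piMr // ltW.
have a4 : C * L <= 2 * S * p.
  apply: (@le_trans _ _ (C * L * lam)); first by rewrite ler_peMr // ltW.
  by apply: le_trans a1 _; rewrite mulrA ler_piMr // !mulr_ge0 // ltW.
have a3 : C ^+ 2 * L ^+ 3 <= 4 * (S ^+ 2 * p ^+ 3).
  have := ler_pM (ltW (mulr_gt0 CL0 (lt_le_trans ltr01 lam1))) (ltW (mulr_gt0 CL0 (lt_le_trans ltr01 lam1))) a1 a1.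
  have -> : C * L * lam * (C * L * lam) = C ^+ 2 * L ^+ 3 by rewrite -lamlam; ring.
  by have -> : 2 * S * (p * u) * (2 * S * (p * u)) = 4 * (S ^+ 2 * p ^+ 3) by rewrite -uu; ring.
have a5 : C ^+ 2 * (L ^+ 2 * (N * p) ^+ 2) <= 4 * S ^+ 2.
  have h0 : 0 <= C * L * (N * p) by rewrite !mulr_ge0 // ltW.
  have := ler_pM h0 h0 a2 a2.
  have -> : C * L * (N * p) * (C * L * (N * p)) = C ^+ 2 * (L ^+ 2 * (N * p) ^+ 2) by ring.
  by have -> : 2 * S * (2 * S) = 4 * S ^+ 2 by ring.
have C12 : 10 ^+ 12 <= C ^+ 2.
  apply: (@le_trans _ _ ((10 ^+ 6) ^+ 2)); first by lra.
  by apply: lerXn2r; rewrite ?nnegrE ?exprn_ge0 ?(ltW C0).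
apply: (le_trans (@chi_lt_prob R T p p0 p1 s (t / (C * L)) s0 _)).
  rewrite mulrAC ler_pdivrMr //; apply: (@le_trans _ _ (t * Q)); first by rewrite ler_wpM2l // ltW.
  by rewrite mulrC Qt mulrC.
apply: (@lower_bound_open_cliques R T p p0 p1 s 3 (4 * (p * N))) => //.
have D0 : 0 <= 4 * (p * N) by rewrite !mulr_ge0 // ltW.
have SL : 1 <= S * L by rewrite mulr_ege1 //; move: S6; focus_arith p0 hL hC; lra.
have mN : #|[set: T]|%:R <= N by rewrite cardsT.
have s3 : (2 * 3 <= s)%N by rewrite -(ler_nat R).
have Le : 2 * L <= C * L by rewrite ler_wpM2r ?(ltW L0) //; move: C6; focus_arith p0 hL hC; lra.
have me : N * expR (- (S * p)) <= 1.
  rewrite -LN -expRD -expR0 ler_expR; move: a4 Le; focus_arith p0 hL hC; lra.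
have h1 : (2 ^ 4 * 3`!)%:R * (N * (16 * (S * p)) ^+ 3 + (4 * (p * N)) ^+ 2 * (3 * (S * L))) <= S ^+ 3.
  rewrite (_ : (2 ^ 4 * 3`!)%N = 96%N) //.
  have b1 : S ^+ 3 * (N * p ^+ 3) <= S ^+ 3 * (1 / 10 ^+ 9) by rewrite ler_wpM2l // exprn_ge0 // ltW.
  have b2 : 10 ^+ 12 * (L * (N * p) ^+ 2) <= 4 * S ^+ 2.
    apply: le_trans a5; apply: ler_pM => //; first by rewrite mulr_ge0 ?sqr_ge0 // ltW.
    by rewrite ler_wpM2r ?sqr_ge0 // expr2 ler_peMl // ltW.
  have b3 : 10 ^+ 12 * (L * (N * p) ^+ 2) * S <= 4 * S ^+ 2 * S by rewrite ler_wpM2r // ltW.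
  have -> : 96 * (N * (16 * (S * p)) ^+ 3 + (4 * (p * N)) ^+ 2 * (3 * (S * L)))
     = 96 * 16 ^+ 3 * (S ^+ 3 * (N * p ^+ 3)) + 96 * 48 * (L * (N * p) ^+ 2 * S) by ring.
  have S3 : 0 <= S ^+ 3 by rewrite exprn_ge0 // ltW.
  have e3 : 4 * S ^+ 2 * S = 4 * S ^+ 3 by ring.
  rewrite e3 in b3; move: b1 b3 S3; rewrite -[10 ^+ 12 * _ * S]mulrA.
  move: (S ^+ 3) (N * p ^+ 3) (L * (N * p) ^+ 2 * S) => y1 y2 y3; focus_arith p0 hL hC; lra.
have h2 (i : nat) : (1 < i <= 3)%N ->
    (2 ^ (2 * 3 + 3) * 3`!)%:R * (2 * (S * L)) <= S ^+ i * p ^+ 'C(i, 2).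
  rewrite natrM natrX (_ : 3`! = 6)%N // -[(2 * 3 + 3)%N]/9%N.
  case: i => [|[|[|[|i]]]] //= _.
    rewrite (_ : 'C(2, 2) = 1)%N // expr1.
    have : S * (C * L) <= S * (2 * S * p) by rewrite ler_wpM2l // ltW.
    have : 10 ^+ 6 * (S * L) <= C * (S * L) by rewrite ler_wpM2r // mulr_ge0 // ltW.
    have -> : S * (2 * S * p) = 2 * (S ^+ 2 * p) by ring.
    have := mulr_ge0 (ltW S0) (ltW L0); rewrite [S * (C * L)]mulrCA.
    by move: (S * L) (S ^+ 2 * p) => y1 y2; focus_arith p0 hL hC; lra.
  rewrite (_ : 'C(3, 2) = 3)%N //.
  have : 10 ^+ 12 * L <= 4 * (S ^+ 2 * p ^+ 3).
    apply: le_trans a3; apply: ler_pM => //; first exact: ltW.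
    by rewrite exprS ler_peMr ?exprn_ege1 // ltW.
  move=> b1; have : 10 ^+ 12 * L * S <= 4 * (S ^+ 2 * p ^+ 3) * S by rewrite ler_wpM2r // ltW.
  have -> : 4 * (S ^+ 2 * p ^+ 3) * S = 4 * (S ^+ 3 * p ^+ 3) by ring.
  have := mulr_ge0 (ltW S0) (ltW L0); rewrite -mulrA (mulrC L).
  by move: (S * L) (S ^+ 3 * p ^+ 3) => y1 y2; focus_arith p0 hL hC; lra.
have rD : 2 * (p * N) + 2 * (p * N) <= 4 * (p * N).
  by move: (p * N) => y; focus_arith p0 hL hC; lra.
apply: (le_trans (bad_set_prob p0 p1 (k := 2) _ s3 D0 SL mN me h1 h2 rD)) => //.
have -> : 3 / N = N^-1 + 2 * N^-1 by move: (N^-1) => y; focus_arith p0 hL hC; lra.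
apply: lerD.
  rewrite -(expR_log2 LN) ler_wpM2l ?(ltW N0) // ler_expR lerN2; exact: le_trans pN.
rewrite -/N -/S mulrCA ler_wpM2l // -LN -expRM_natl -expRN -expRD ler_expR -/S.
have : L <= S * L by rewrite ler_peMl ?(ltW L0) //; move: S6; focus_arith p0 hL hC; lra.
by move: (S * L) => y; focus_arith p0 hL hC; lra.
Qed.

(** The target is [1 / p]: sets of [C * L * N * p] vertices contain closed cliques. [w] is the
    expected number of common neighbours of [j] vertices, and [A = w * p] the expected degree among
    them. *)
Lemma lower_dense (R : realType) (T : finType) (p L C t : R)
    (p0 : 0 <= p) (p1 : p <= 1)
    (LN : expR L = #|T|%:R) (hL : 1600 <= L) (hC : 10 ^+ 16 <= C)
    (tp : t * p <= 1) (ht : C * L <= t) :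
  let N := #|T|%:R in 1 / 10 ^+ 9 <= N * p ^+ 3 ->
  Pr p (fun G : graph T => (clique_chromatic_number G)%:R < t / (C * L)) <= 6 / N.
Proof.
move=> N; set de : R := 1 / 10 ^+ 9; move=> d3.
rewrite -/N in LN; have N0 : 0 < N := card_gt0_expR LN; have L1 := log_ge1 hL; have L0 := log_gt0 hL.
have de0 : 0 < de by rewrite /de divr_gt0 // exprn_gt0.
have C0 : 0 < C by apply: lt_le_trans hC; rewrite exprn_gt0.
have CL0 : 0 < C * L by rewrite mulr_gt0.
have t0 : 0 < t by apply: lt_le_trans ht.
have CLp : C * L * p <= 1 by apply: le_trans tp; rewrite ler_wpM2r.
have pC : 10 ^+ 16 * p <= 1.
  apply: le_trans CLp; rewrite ler_wpM2r //; apply: le_trans (hC) _.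
  by rewrite ler_peMr // ltW.
have pp : 0 < p.
  rewrite lt0r p0 andbT; apply/eqP => p00; move: d3; rewrite p00 expr0n mulr0.
  by rewrite leNgt de0.
(* [n p^(j + 3) >= de > n p^(j + 4)]: a clique with [j] vertices has few enough common
   neighbours for Janson's inequality to close it by [4] further vertices. *)
have /ex_minnP[j jP jmin] : exists i : nat, N * p ^+ (i + 4) < de.
  exists #|T|; rewrite exprD mulrA.
  have h1 : N * p ^+ #|T| <= 1.
    apply: (@le_trans _ _ (2 ^+ #|T| * p ^+ #|T|)).
      rewrite ler_wpM2r ?exprn_ge0 // -natrX ler_nat; apply: ltnW; exact: ltn_expl.
    rewrite -exprMn exprn_ile1 ?mulr_ge0 //; move: pC; focus_arith p0 hL hC; lra.
  have h2 : p ^+ 4 <= p by rewrite -[leRHS]expr1 ler_wiXn2l.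
  apply: le_lt_trans (_ : p ^+ 4 < de); first by rewrite ler_piMl ?exprn_ge0.
  by rewrite /de; move: h2 pC; move: (p ^+ 4) => y; focus_arith p0 hL hC; lra.
have w3 : de <= N * p ^+ j * p ^+ 3.
  case: j jmin {jP} => [|j] jmin; first by rewrite expr0 mulr1.
  rewrite leNgt; apply/negP => h; have := jmin j.
  move=> hj; have : (j < j)%N; last by rewrite ltnn.
  by apply: hj; move: h; rewrite -mulrA -exprD addSnnS.
set P := p ^+ j in w3; set w := N * P in w3.
have w4 : w * p ^+ 4 <= de by rewrite /w /P -mulrA -exprD ltW.
have P0 : 0 < P by rewrite exprn_gt0.
have P1 : P <= 1 by rewrite exprn_ile1.
have w0 : 0 < w by rewrite mulr_gt0.
have wN : w <= N by rewrite /w ler_piMr // ltW.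
set A := w * p.
have A0 : 0 < A by rewrite mulr_gt0.
(* [C * L * p <= 1] trades two factors [p] in [w * p ^+ 3 >= de] for [(C * L) ^+ 2]. *)
have AL : C ^+ 2 * L ^+ 2 * de <= A.
  apply: (@le_trans _ _ (A * (C * L * p) ^+ 2)); last first.
    by rewrite ler_piMr ?(ltW A0) // exprn_ile1 // !mulr_ge0 // ltW.
  have -> : A * (C * L * p) ^+ 2 = C ^+ 2 * L ^+ 2 * (w * p ^+ 3) by rewrite /A; ring.
  by rewrite ler_wpM2l // mulr_ge0 ?sqr_ge0.
have C32 : 10 ^+ 32 <= C ^+ 2.
  apply: (@le_trans _ _ ((10 ^+ 16) ^+ 2)); first by rewrite -exprM.
  by apply: lerXn2r; rewrite ?nnegrE ?exprn_ge0 ?(ltW C0).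
have L2 : 1 <= L ^+ 2 by rewrite exprn_ege1.
have LL2 : L <= L ^+ 2 by rewrite expr2 ler_peMr // ltW.
have A20 : 10 ^+ 20 * L ^+ 2 <= A.
  apply: le_trans AL; have : 10 ^+ 32 * L ^+ 2 <= C ^+ 2 * L ^+ 2 by rewrite ler_wpM2r // sqr_ge0.
  by rewrite /de; move: L2; move: (L ^+ 2) (C ^+ 2 * L ^+ 2) => y1 y2; focus_arith p0 hL hC; lra.
have Aw : A <= w by rewrite /A ler_piMr // ltW.
have A1 : 10 ^+ 20 <= A by apply: le_trans A20; rewrite ler_peMr // exprn_ge0.
have N8 : 8 <= N by move: A1 Aw wN; focus_arith p0 hL hC; lra.
(* The union over the [N ^+ j] choices of [K] thus costs at most [expR (L ^+ 2)], which exponents of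
   order [A >= 10 ^+ 20 * L ^+ 2] absorb. *)
have jL : j%:R <= L.
  rewrite -ler_expR LN.
  have e1 : p <= expR (- 1).
    rewrite expRN -[leRHS]mul1r ler_pdivlMr ?expR_gt0 //.
    have : p * expR 1 <= p * 16.
      by rewrite ler_wpM2l // (le_trans _ (expR2_le16 R)) // ler_expR; focus_arith p0 hL hC; lra.
    by move: pC; move: (p * expR 1) => y; focus_arith p0 hL hC; lra.
  have eP : P <= expR (- j%:R).
    by rewrite -mulrN1 expRM_natl; apply: lerXn2r; rewrite ?nnegrE ?expR_ge0.
  have : 1 <= N * expR (- j%:R).
    apply: (@le_trans _ _ w); first by move: A1 Aw; focus_arith p0 hL hC; lra.
    by rewrite ler_wpM2l // ltW.
  by rewrite expRN ler_pdivlMr ?expR_gt0 // mul1r.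
have CLA : 10 ^+ 16 * L <= C * L * A.
  apply: (@le_trans _ _ (C * L)); first by rewrite ler_wpM2r // ltW.
  by rewrite ler_peMr ?(ltW CL0) //; move: A1; focus_arith p0 hL hC; lra.
have CLA16 : 32 <= C * L * A by apply: le_trans CLA; focus_arith p0 hL hC; lra.
set Q := C * L * (N * p).
have Np : A <= N * p by rewrite /A ler_wpM2r.
have Q2 : 2 <= Q.
  apply: (@le_trans _ _ (C * L * A)); first by move: CLA16; focus_arith p0 hL hC; lra.
  by rewrite ler_wpM2l // ltW.
set s := Num.truncn Q; set S := (s%:R : R).
have sQ : S <= Q by rewrite truncn_le; apply: le_trans Q2.
have Qs : Q <= 2 * S.
  have : Q < S + 1 by rewrite natr1; exact: truncnS_gt.
  by move: Q2; focus_arith p0 hL hC; lra.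
have S1 : 1 <= S by move: Q2 Qs; focus_arith p0 hL hC; lra.
have S0 : 0 < S by apply: lt_le_trans S1.
have s0 : (0 < s)%N by rewrite -(ltr_nat R).
have PS : C * L * A <= 2 * (P * S).
  have -> : C * L * A = P * Q by rewrite /A /w /Q; ring.
  by rewrite [leRHS]mulrCA ler_wpM2l // ltW.
set a := Num.truncn (P * S / 4); set Z := (a%:R : R).
have aP : Z <= P * S / 4 by rewrite truncn_le // divr_ge0 // mulr_ge0 // ltW.
have aZ : C * L * A <= 16 * Z.
  have : P * S / 4 < Z + 1 by rewrite natr1; exact: truncnS_gt.
  by move: PS CLA16; move: (C * L * A) (P * S) => y1 y2; focus_arith p0 hL hC; lra.
have Z8 : 8 <= Z by move: aZ CLA L1; move: (C * L * A) => y1; focus_arith p0 hL hC; lra.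
have Z0 : 0 < Z by move: Z8; focus_arith p0 hL hC; lra.
apply: (le_trans (@chi_lt_prob R T p p0 p1 s (t / (C * L)) s0 _)).
  rewrite mulrAC ler_pdivrMr //; apply: (@le_trans _ _ (t * Q)); first by rewrite ler_wpM2l // ltW.
  have -> : t * Q = N * (C * L) * (t * p) by rewrite /Q; ring.
  by rewrite ler_piMr // mulr_ge0 // ltW.
(* Eight times the mean leaves the exponent [m / 2 - w = 3 * w] in the bound on [common G K]. *)
pose m := 8 * w.
pose q := N * expR (- (p * m)) + N ^+ a * (2 * expR (- (2 * (Z * L)))).
have q0 : 0 <= q by rewrite addr_ge0 // !mulr_ge0 ?expR_ge0 ?exprn_ge0 ?(ltW N0).
have p4 : p <= 1 / 4 by move: pC; focus_arith p0 hL hC; lra.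
have s12 : 12 * Num.sqrt L <= Num.sqrt p ^+ j * Num.sqrt S.
  rewrite -(ler_pXn2r (n := 2)) ?nnegrE ?mulr_ge0 ?exprn_ge0 ?sqrtr_ge0 //.
  rewrite !exprMn -exprM mulnC exprM !sqr_sqrtr ?(ltW L0) ?(ltW S0) // -/P.
  by move: PS CLA; move: (C * L * A) (P * S) => y1 y2; focus_arith p0 hL hC; lra.
have aP' : Z <= p ^+ j * S / 4 by [].
have hW (W : {set T}) : #|W|%:R <= m -> Pr p (fun G => bad_set (4 * (p * m)) a 4 G W) <= q.
  move=> Wm.
  have pm0 : 0 <= p * m by rewrite !mulr_ge0 // ltW.
  have D0 : 0 <= 4 * (p * m) by rewrite mulr_ge0.
  have ZL : 1 <= Z * L by rewrite mulr_ege1 //; move: Z8; focus_arith p0 hL hC; lra.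
  have s3 : (2 * 4 <= a)%N by rewrite -(ler_nat R).
  (* All of Janson's conditions follow from this one; for [i = 4] it enters through
     [Z ^+ 4 * p ^+ 6 = Z * (Z * p ^+ 2) ^+ 3]. *)
  have Y2 : 10 ^+ 7 * L <= 16 * Z * p ^+ 2.
    apply: (@le_trans _ _ (C * L * A * p ^+ 2)); last by rewrite ler_wpM2r ?sqr_ge0.
    have -> : C * L * A * p ^+ 2 = C * L * (w * p ^+ 3) by rewrite /A; ring.
    apply: (@le_trans _ _ (C * L * de)); last by rewrite ler_wpM2l // ltW.
    have : 10 ^+ 16 * L <= C * L by rewrite ler_wpM2r // ltW.
    by rewrite /de; move: (C * L) => y; focus_arith p0 hL hC; lra.
  have p2p : p ^+ 2 <= p by rewrite expr2 ler_piMr.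
  have Zp2 : Z * p ^+ 2 <= Z * p by rewrite ler_wpM2l // ltW.
  have me : m * expR (- (Z * p)) <= 1.
    apply: (@le_trans _ _ (8 * (N * expR (- (2 * L))))).
      have mN : m <= 8 * N by rewrite ler_wpM2l.
      have m0 : 0 <= m by rewrite mulr_ge0 // ltW.
      rewrite mulrA; apply: ler_pM => //.
      rewrite ler_expR lerN2; move: Y2 Zp2; rewrite -[16 * Z * _]mulrA.
      by move: (Z * p ^+ 2) (Z * p) => y1 y2; focus_arith p0 hL hC; lra.
    by rewrite (expR_log2 LN) ler_pdivrMr ?mul1r.
  have h1 : (2 ^ 5 * 4`!)%:R * (m * (16 * (Z * p)) ^+ 4 + (4 * (p * m)) ^+ 3 * (3 * (Z * L))) <= Z ^+ 4.
    rewrite (_ : (2 ^ 5 * 4`!)%N = 768%N) //.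
    have b1 : Z ^+ 4 * (w * p ^+ 4) <= Z ^+ 4 * de by rewrite ler_wpM2l // exprn_ge0 // ltW.
    have b2 : 10 ^+ 32 * (L * A ^+ 3) <= 16 ^+ 3 * Z ^+ 3.
      have h0 : 0 <= C * L * A by rewrite !mulr_ge0 // ltW.
      have h1 : (C * L * A) ^+ 3 <= (16 * Z) ^+ 3.
        by apply: lerXn2r; rewrite ?nnegrE // mulr_ge0 // ltW.
      rewrite [X in _ <= X]exprMn in h1; apply: le_trans h1.
      have -> : (C * L * A) ^+ 3 = C ^+ 2 * (C * L ^+ 2) * (L * A ^+ 3) by ring.
      rewrite ler_wpM2r ?mulr_ge0 ?exprn_ge0 ?(ltW L0) ?(ltW A0) //.
      apply: le_trans C32 _; rewrite ler_peMr ?sqr_ge0 //.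
      rewrite mulr_ege1 //; apply: le_trans (hC); focus_arith p0 hL hC; lra.
    have b3 : 10 ^+ 32 * (L * A ^+ 3) * Z <= 16 ^+ 3 * Z ^+ 3 * Z by rewrite ler_wpM2r // ltW.
    (* The coefficient [768 * 16 ^+ 4 * 8] is about [4 * 10 ^+ 8]; times [de] it must stay below 1,
       which explains [de = 1 / 10 ^+ 9]. *)
    have -> : 768 * (m * (16 * (Z * p)) ^+ 4 + (4 * (p * m)) ^+ 3 * (3 * (Z * L)))
      = 768 * 16 ^+ 4 * 8 * (Z ^+ 4 * (w * p ^+ 4))
        + 768 * 3 * 32 ^+ 3 * (L * A ^+ 3 * Z) by rewrite /m /A; ring.
    have e4 : 16 ^+ 3 * Z ^+ 3 * Z = 16 ^+ 3 * Z ^+ 4 by ring.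
    have Z4 : 0 <= Z ^+ 4 by rewrite exprn_ge0 // ltW.
    move: b1 b3 Z4; rewrite e4 -[10 ^+ 32 * _ * Z]mulrA /de.
    by move: (Z ^+ 4) (w * p ^+ 4) (L * A ^+ 3 * Z) => y1 y2 y3; focus_arith p0 hL hC; lra.
  have h2 (i : nat) : (1 < i <= 4)%N ->
      (2 ^ (2 * 4 + 3) * 4`!)%:R * (2 * (Z * L)) <= Z ^+ i * p ^+ 'C(i, 2).
    rewrite natrM natrX (_ : 4`! = 24)%N // -[(2 * 4 + 3)%N]/11%N.
    have e0 : 0 <= 10 ^+ 7 * L by rewrite mulr_ge0 // ltW.
    have ZL0 : 0 <= Z * L by rewrite mulr_ge0 // ltW.
    have LL : Z * L <= Z * L ^+ 2 by rewrite ler_wpM2l // ltW.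
    have LLL : Z * L <= Z * L ^+ 3.
      by rewrite ler_wpM2l ?(ltW Z0) // exprS ler_peMr // ltW.
    case: i => [|[|[|[|[|i]]]]] //= _.
    - rewrite (_ : 'C(2, 2) = 1)%N // expr1.
      have : Z * (10 ^+ 7 * L) <= Z * (16 * Z * p) .
        by rewrite ler_wpM2l ?(ltW Z0) // (le_trans Y2) // ler_wpM2l // mulr_ge0 // ltW.
      have -> : Z * (16 * Z * p) = 16 * (Z ^+ 2 * p) by ring.
      rewrite [Z * (10 ^+ 7 * L)]mulrCA; move: ZL0.
      by move: (Z * L) (Z ^+ 2 * p) => y1 y2; focus_arith p0 hL hC; lra.
    - rewrite (_ : 'C(3, 2) = 3)%N //.
      have h0 : (10 ^+ 7 * L) ^+ 2 <= (16 * Z * p ^+ 2) ^+ 2.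
        by apply: lerXn2r; rewrite ?nnegrE // !mulr_ge0 ?sqr_ge0 // ltW.
      have : Z * ((10 ^+ 7 * L) ^+ 2) <= Z * (16 * Z * p ^+ 2) ^+ 2 by rewrite ler_wpM2l // ltW.
      have -> : Z * (16 * Z * p ^+ 2) ^+ 2 = 16 ^+ 2 * (Z ^+ 3 * p ^+ 3 * p) by ring.
      have -> : Z * ((10 ^+ 7 * L) ^+ 2) = 10 ^+ 14 * (Z * L ^+ 2) by ring.
      have : Z ^+ 3 * p ^+ 3 * p <= Z ^+ 3 * p ^+ 3.
        by rewrite ler_piMr // mulr_ge0 // exprn_ge0 // ltW.
      move: ZL0 LL.
      by move: (Z * L) (Z * L ^+ 2) (Z ^+ 3 * p ^+ 3 * p) (Z ^+ 3 * p ^+ 3) => y1 y2 y3 y4; focus_arith p0 hL hC; lra.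
    - rewrite (_ : 'C(4, 2) = 6)%N //.
      have h0 : (10 ^+ 7 * L) ^+ 3 <= (16 * Z * p ^+ 2) ^+ 3.
        by apply: lerXn2r; rewrite ?nnegrE // !mulr_ge0 ?sqr_ge0 // ltW.
      have : Z * ((10 ^+ 7 * L) ^+ 3) <= Z * (16 * Z * p ^+ 2) ^+ 3 by rewrite ler_wpM2l // ltW.
      have -> : Z * (16 * Z * p ^+ 2) ^+ 3 = 16 ^+ 3 * (Z ^+ 4 * p ^+ 6) by ring.
      have -> : Z * ((10 ^+ 7 * L) ^+ 3) = 10 ^+ 21 * (Z * L ^+ 3) by ring.
      move: ZL0 LLL.
      by move: (Z * L) (Z * L ^+ 3) (Z ^+ 4 * p ^+ 6) => y1 y2 y3; focus_arith p0 hL hC; lra.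
  have rD : 2 * (p * m) + 2 * (p * m) <= 4 * (p * m).
    by move: (p * m) => y; focus_arith p0 hL hC; lra.
  exact: (bad_set_prob p0 p1 (k := 3) _ s3 D0 ZL Wm me h1 h2 rD).
apply: (le_trans (lower_bound_chained_cliques p0 p1 (k := 4) _ L1 LN p4 q0 s12 aP' hW)) => //.
have Nj : N ^+ j <= expR (L ^+ 2).
  by rewrite -LN -expRM_natl ler_expR expr2 ler_wpM2r // ltW.
have iN : N^-1 = expR (- L) by rewrite expRN LN.
have i0 : 0 <= N^-1 by rewrite invr_ge0 ltW.
have e1 : (N + 1) * expR (- (2 * L)) <= 2 * N^-1.
  rewrite -(expR_log2 LN) mulrA ler_wpM2r ?expR_ge0 //; move: N8; focus_arith p0 hL hC; lra.
have e2 : N ^+ j * expR (- (m / 2 - N * p ^+ j)) <= N^-1.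
  apply: (le_trans (ler_wpM2r (expR_ge0 _) Nj)).
  rewrite -expRD iN ler_expR /m -/P -/w; move: A20 Aw LL2 L0.
  by move: (L ^+ 2) => y; focus_arith p0 hL hC; lra.
have e3 : N ^+ j * (N * expR (- (p * m))) <= N^-1.
  apply: (le_trans (ler_wpM2r _ Nj)); first by rewrite mulr_ge0 ?expR_ge0 // ltW.
  rewrite -LN -expRN -!expRD ler_expR /m (_ : p * (8 * w) = 8 * A); last by rewrite /A; ring.
  move: A20 LL2 L0.
  by move: (L ^+ 2) => y; focus_arith p0 hL hC; lra.
have e4 : N ^+ j * (N ^+ a * (2 * expR (- (2 * (Z * L))))) <= 2 * N^-1.
  apply: (le_trans (ler_wpM2r _ Nj)); first by rewrite !mulr_ge0 ?exprn_ge0 ?expR_ge0 // ltW.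
  have -> : expR (L ^+ 2) * (N ^+ a * (2 * expR (- (2 * (Z * L)))))
    = 2 * (expR (L ^+ 2) * N ^+ a * expR (- (2 * (Z * L)))) by ring.
  rewrite ler_wpM2l // -LN -expRM_natl -expRN -!expRD ler_expR -/Z.
  have : 2 * L ^+ 2 <= Z * L.
    rewrite expr2 mulrA ler_wpM2r ?(ltW L0) //; move: aZ CLA L0.
    by move: (C * L * A) => y; focus_arith p0 hL hC; lra.
  by move: LL2; move: (L ^+ 2) (Z * L) => y1 y2; focus_arith p0 hL hC; lra.
rewrite /q mulrDr; have -> : 6 / N = 2 * N^-1 + N^-1 + (N^-1 + 2 * N^-1).
  by move: (N^-1) => y; focus_arith p0 hL hC; lra.
by apply: lerD; apply: lerD.
Qed.

(** * Both bounds for an arbitrary edge probability *)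

Lemma clique_chromatic_number_gt0 (T : finType) (G : graph T) :
  (0 < #|T|)%N -> (0 < clique_chromatic_number G)%N.
Proof.
move=> /card_gt0P[x _]; rewrite /clique_chromatic_number; case: ex_minnP => -[|k] //.
by move=> /existsP[f _] _; case: (f x).
Qed.

(** [S] is any number that dominates the scale. Comparing [p ^ (5/2) N] with [lam] tells which term
    of the minimum is smaller, so either alternative of the last hypothesis yields the bound wanted
    in that regime. *)
Lemma chi_upper (R : realType) (T : finType) (p L u lam S : R)
    (p0 : 0 <= p) (p1 : p <= 1) (u0 : 0 <= u) (uu : u ^+ 2 = p)
    (lam_ge0 : 0 <= lam) (lamlam : lam ^+ 2 = L)
    (LN : expR L = #|T|%:R) (hL : 1600 <= L) :
  let N := #|T|%:R in
  1 <= S -> expR (- (N * p ^+ 2)) * N * p / L <= S ->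
  (0 < p -> p * u * N / lam <= S \/ p^-1 <= S) ->
  Pr p (fun G : graph T => 10 ^+ 16 * L * S < (clique_chromatic_number G)%:R) <= 3 / N.
Proof.
move=> N S1 S2 S3; rewrite -/N in LN.
have N0 : 0 < N := card_gt0_expR LN; have L1 := log_ge1 hL; have L0 := log_gt0 hL.
have lam1 : 1 <= lam by exact: sqrt_log_ge1 lam_ge0 lamlam hL.
have lam0 : 0 < lam by apply: lt_le_trans lam1.
have i0 : 0 <= N^-1 by rewrite invr_ge0 ltW.
have i3 : N^-1 <= 3 / N by move: i0; move: (N^-1) => y; clear; lra.
have LS : L <= L * S by rewrite ler_peMr // ltW.
have S2' : p * N * expR (- (p ^+ 2 * N)) <= L * S.
  have -> : p * N * expR (- (p ^+ 2 * N)) = expR (- (N * p ^+ 2)) * N * p.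
    by rewrite [p ^+ 2 * N]mulrC; ring.
  by rewrite [L * S]mulrC -ler_pdivrMr.
have B0 (x : R) : x <= 1000 * (L * S) -> x <= 10 ^+ 16 * L * S.
  move=> h; apply: le_trans h _; rewrite -[leRHS]mulrA ler_wpM2r //; first by apply: le_trans LS; exact: ltW.
  by clear; lra.
case: (leP (p ^+ 2 * N) 1) => [xN|xN].
  apply: le_trans i3; apply: le_trans (upper_degree p0 p1 LN hL).
  apply: le_Pr => // G; apply: le_lt_trans; apply: B0; rewrite -/N.
  (* In this range the edge term is within a constant factor of [p * N / L], so the degree bound is
     of the right order. *)
  have e1 : 1 / 16 <= expR (- (p ^+ 2 * N)).
    rewrite expRN div1r lef_pV2 ?posrE ?expR_gt0 //.
    apply: le_trans (expR2_le16 R); rewrite ler_expR; move: xN; clear; lra.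
  have : p * N * (1 / 16) <= L * S.
    by apply: le_trans S2'; rewrite ler_wpM2l // mulr_ge0 // ltW.
  move: LS; move: (L * S) (p * N) => y1 y2; clear -L1; lra.
have pp : 0 < p.
  rewrite lt0r p0 andbT; apply/eqP => p00; move: xN; rewrite p00 expr0n mul0r.
  by rewrite ltNge ler01.
case: (leP lam (p ^+ 2 * u * N)) => hp.
  apply: le_trans i3; apply: le_trans (upper_dominating p0 p1 u0 uu lam_ge0 lamlam LN hL pp hp).
  apply: le_Pr => // G; apply: le_lt_trans; apply: B0.
  have ip : p^-1 <= S.
    case: (S3 pp) => //; apply: le_trans.
    rewrite ler_pdivlMr // mulrC ler_pdivrMr //; apply: le_trans hp _.
    by apply: eq_ler; ring.
  have : L / p <= L * S by rewrite ler_wpM2l // ltW.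
  by move: LS; move: (L * S) (L / p) => y1 y2; clear -L1; lra.
apply: le_trans (upper_triangle p0 p1 u0 uu lam_ge0 lamlam LN hL pp (ltW xN) (ltW hp)).
apply: le_Pr => // G; apply: le_lt_trans; apply: B0; rewrite -/N.
have up : p * u * N / lam <= S.
  case: (S3 pp) => //; apply: le_trans.
  rewrite ler_pdivrMr // [p^-1 * _]mulrC ler_pdivlMr //; apply: le_trans (ltW hp).
  by apply: eq_ler; ring.
have : L * (p * u * N / lam) <= L * S by rewrite ler_wpM2l // ltW.
move: LS S2'; move: (L * S) (L * (_ / _)) (p * N * _) => y1 y2 y3; clear -L1; lra.
Qed.

(** For [S <= C * L] the claim is that one colour is needed. Otherwise the alternative [S <= 1] is
    void and the other two come with [C * L <= S], which the parameter choices rely on. *)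
Lemma chi_lower (R : realType) (T : finType) (p L u lam S : R)
    (p0 : 0 <= p) (p1 : p <= 1) (u0 : 0 <= u) (uu : u ^+ 2 = p)
    (lam_ge0 : 0 <= lam) (lamlam : lam ^+ 2 = L)
    (LN : expR L = #|T|%:R) (hL : 1600 <= L) :
  let N := #|T|%:R in
  [\/ S <= 1, S <= expR (- (N * p ^+ 2)) * N * p / L |
    [/\ 0 < p, S <= p * u * N / lam & S <= p^-1]] ->
  Pr p (fun G : graph T => (clique_chromatic_number G)%:R < S / (10 ^+ 16 * L)) <= 6 / N.
Proof.
move=> N hS; rewrite -/N in LN.
have N0 : 0 < N := card_gt0_expR LN; have L1 := log_ge1 hL; have L0 := log_gt0 hL.
have lam1 : 1 <= lam by exact: sqrt_log_ge1 lam_ge0 lamlam hL.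
have lam0 : 0 < lam by apply: lt_le_trans lam1.
have i0 : 0 <= N^-1 by rewrite invr_ge0 ltW.
set C : R := 10 ^+ 16; have hC : 10 ^+ 16 <= C by [].
have C1 : 1 <= C by apply: exprn_ege1; clear; lra.
have C0 : 0 < C by apply: lt_le_trans C1.
have CL0 : 0 < C * L by rewrite mulr_gt0.
case: (leP S (C * L)) => [SC|/ltW SC].
  rewrite (_ : Pr _ _ = 0) ?mulr_ge0 //.
  transitivity (Pr p (xpred0 : pred (graph T))); last exact: Pr_pred0.
  apply: eq_Pr => G; apply/negbTE; rewrite -leNgt.
  apply: (@le_trans _ _ 1); first by rewrite ler_pdivrMr ?mul1r.
  by rewrite ler1n clique_chromatic_number_gt0 // -(ltr_nat R).
case: hS => [S1|S2|[pp S3 S4]].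
- by have := le_trans SC S1; rewrite leNgt => /negP[]; apply: lt_le_trans (_ : L <= _);
    [move: hL; clear; lra | rewrite ler_peMl // ltW].
- have e : expR (- (N * p ^+ 2)) * N * p = p * expR (- (N * p ^+ 2)) * N by ring.
  rewrite e in S2.
  have h : C * L ^+ 2 <= p * expR (- (N * p ^+ 2)) * N.
    by rewrite expr2 mulrA -ler_pdivlMr //; exact: le_trans SC S2.
  apply: (@le_trans _ _ (5 / N)); last by rewrite ler_wpM2r //; clear; lra.
  apply: le_trans (lower_edges p0 p1 u0 uu LN hL hC h).
  apply: le_Pr => // G; move=> /lt_le_trans; apply.
  rewrite ler_pdivrMr //; apply: le_trans S2 _; apply: eq_ler.
  by field; rewrite !lt0r_neq0.
have tp : S * p <= 1 by rewrite -ler_pdivlMr // div1r.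
have tN : S * lam <= p * u * N by rewrite -ler_pdivlMr.
case: (leP (N * p ^+ 3) (1 / 10 ^+ 9)) => [d3|/ltW d3].
  apply: (@le_trans _ _ (3 / N)); last by rewrite ler_wpM2r //; clear; lra.
  exact: (lower_sparse p0 p1 u0 uu lam_ge0 lamlam LN hL hC tp SC tN d3).
exact: (lower_dense p0 p1 LN hL hC tp SC d3).
Qed.

Lemma min_term_gt0E (R : realType) (n : nat) (p : R) : 0 < p ->
  min_term n p = Num.min (p * Num.sqrt p * n%:R / Num.sqrt (ln n%:R)) p^-1.
Proof.
move=> pp; rewrite /min_term inver (gt_eqF pp) -EFin_min /=.
congr (Num.min (_ * _ / _) _).
rewrite (_ : 3 / 2 = 1 + 2^-1); last by field.
by rewrite powRD ?powRr1 ?powR12_sqrt ?(ltW pp) // (gt_eqF pp) implybT.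
Qed.

Lemma min_term0 (R : realType) (n : nat) : min_term n (0 : R) = 0.
Proof.
by rewrite /min_term inver eqxx minEle leey /= powR0 ?mul0r.
Qed.

Lemma Gnp_probE (R : realType) (n : nat) (p : R) (A : pred (graph 'I_n)) :
  Gnp_prob p A = Pr p A.
Proof.
rewrite /Gnp_prob /Pr /Ex big_mkcond; apply: eq_bigr => G _.
by case: (A G); rewrite ?mulr1 ?mulr0.
Qed.

(** The scale is a maximum: it dominates every term, as [chi_upper] asks, and equals one of them, as
    [chi_lower] asks. The failure probabilities add up to [3 / n + 6 / n]. *)
Lemma ratio_prob (R : realType) (n : nat) (p : R) : 0 <= p <= 1 ->
  (0 < n)%N -> 1600 <= ln (n%:R : R) ->
  1 - 9 / n%:R <= Gnp_prob p (fun G : graph 'I_n =>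
    (10 ^+ 16 * ln n%:R)^-1
      <= (clique_chromatic_number G)%:R / clique_chromatic_scale n p
      <= 10 ^+ 16 * ln n%:R).
Proof.
move=> /andP[p0 p1] n0 hL; set L := ln _ in hL *.
have LN : expR L = #|'I_n|%:R by rewrite card_ord lnK // posrE ltr0n.
have u0 : 0 <= Num.sqrt p := sqrtr_ge0 p.
have uu : Num.sqrt p ^+ 2 = p := sqr_sqrtr p0.
have L0 := log_gt0 hL.
have lam0 : 0 <= Num.sqrt L := sqrtr_ge0 L.
have lamlam : Num.sqrt L ^+ 2 = L := sqr_sqrtr (ltW L0).
set S := clique_chromatic_scale n p.
have S1 : 1 <= S by rewrite le_max lexx.
have S0 : 0 < S by apply: lt_le_trans S1.
have hu := @chi_upper R 'I_n p L _ _ S p0 p1 u0 uu lam0 lamlam LN hL.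
have hl := @chi_lower R 'I_n p L _ _ S p0 p1 u0 uu lam0 lamlam LN hL.
rewrite /= card_ord in hu hl.
have {}hu := hu S1 _ _.
have {}hu : Pr p (fun G : graph 'I_n => 10 ^+ 16 * L * S < (clique_chromatic_number G)%:R) <= 3 / n%:R.
  apply: hu; first by rewrite !le_max lexx orbT.
  move=> pp; have : min_term n p <= S by rewrite !le_max lexx !orbT.
  by rewrite min_term_gt0E // ge_min => /orP.
have {}hl : Pr p (fun G : graph 'I_n => (clique_chromatic_number G)%:R < S / (10 ^+ 16 * L)) <= 6 / n%:R.
  apply: hl; rewrite /S /clique_chromatic_scale -/L.
  case: (leP 1 (Num.max (expR (- (n%:R * p ^+ 2)) * n%:R * p / L) (min_term n p))) => h1; last by apply: Or31.
  case: (leP (expR (- (n%:R * p ^+ 2)) * n%:R * p / L) (min_term n p)) h1 => h2 h1; last by apply: Or32.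
  apply: Or33.
  have pp : 0 < p.
    rewrite lt0r p0 andbT; apply: contraTneq h1 => ->.
    by rewrite min_term0 -ltNge.
  by rewrite min_term_gt0E // !ge_min !lexx orbT.
set C : R := 10 ^+ 16 in hu hl *.
have C0 : 0 < C by rewrite /C exprn_gt0.
have CL0 : 0 < C * L by rewrite mulr_gt0.
rewrite Gnp_probE lerBlDr -lerBlDl -Pr_not.
apply: (@le_trans _ _ (3 / n%:R + 6 / n%:R)); last first.
  by rewrite -mulrDl; move: (n%:R^-1) => y; lra.
apply: le_trans (lerD hu hl); apply: le_trans (Pr_or p0 p1 _ _).
apply: le_Pr => // G; apply: contraTT; rewrite negbK negb_or -!leNgt => /andP[h1 h2].
rewrite ler_pdivrMr // h1 andbT ler_pdivlMr // mulrC.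
exact: h2.
Qed.

Local Open Scope classical_set_scope.
Local Open Scope ring_scope.

Theorem theorem2 (R : realType) :
  exists C : R, 1 <= C /\
    forall p : nat -> R, (forall n, 0 <= p n <= 1) ->
      (fun n : nat => Gnp_prob (p n) (fun G : graph 'I_n =>
         (C * ln n%:R)^-1
           <= (clique_chromatic_number G)%:R / clique_chromatic_scale n (p n)
           <= C * ln n%:R)) @ \oo --> (1 : R).
Proof.
exists (10 ^+ 16); split => [|p hp]; first by apply: exprn_ege1; lra.
apply/cvgrPdist_le => e e0; near=> n.
have n1 : expR 1600 <= n%:R :> R by near: n; exact: nbhs_infty_ger.
have n2 : 9 / e <= n%:R by near: n; exact: nbhs_infty_ger.
have n0 : 0 < n%:R :> R by apply: lt_le_trans n1; exact: expR_gt0.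
have hL : 1600 <= ln n%:R :> R by rewrite -ler_expR lnK.
have := ratio_prob (hp n) _ hL; rewrite -(ltr_nat R) => /(_ n0) h.
have /andP[p0 p1] := hp n.
rewrite ger0_norm; last by rewrite subr_ge0 Gnp_probE Pr_le1.
rewrite lerBlDr -lerBlDl; apply: le_trans h; rewrite lerB // ler_pdivrMr // mulrC -ler_pdivrMr //.
Unshelve. all: end_near.
Qed.
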